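(* Let $\Omega\subset\mathbb{R}^N$ ($N\ge 2$) be a bounded domain whose boundary is of class $C^\infty$, and let $u$ be the solution of $$\partial_t u=\Delta u \ \text{in } \Omega\times(0,\infty),\qquad u=1 \ \text{on } \Omega\times\{0\},\qquad u=0 \ \text{on } \partial\Omega\times(0,\infty).$$ Suppose there exist sequences $(t_n)_{n\in\mathbb{N}}\subset(0,\infty)$ and $(b_n)_{n\in\mathbb{N}}\subset\mathbb{R}$ such that $\partial_\nu u(t_n)\equiv b_n$ on $\partial\Omega$ for all $n\in\mathbb{N}$, and suppose that $0$ is an accumulation point of $(t_n)_n$. Then $\Omega$ is a ball.
   Context: $u(t)$ denotes $x\mapsto u(x,t)$; $\partial_\nu$ is the normal derivative with respect to the exterior unit normal $\nu$ on $\partial\Omega$ (understood as the weak conormal derivative $\langle\partial_\nu\varphi,\psi\rangle:=\int_\Omega\Delta\varphi\,\tilde\psi+\int_\Omega\nabla\varphi\cdot\nabla\tilde\psi$, $\tilde\psi$ the harmonic extension of $\psi\in H^{1/2}(\partial\Omega)$, which coincides with the classical one for smooth functions), and $\partial_\nu u(t_n)\equiv b_n$ means $\partial_\nu u(t_n)$ equals the constant $b_n$ on $\partial\Omega$. *)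

(* Defs.v *)
From HB Require Import structures.
From mathcomp Require Import all_boot all_order all_algebra.
From mathcomp Require Import all_classical all_reals all_analysis.
Set Implicit Arguments. Unset Strict Implicit. Unset Printing Implicit Defensive.
Import Order.TTheory GRing.Theory Num.Theory.
Import numFieldNormedType.Exports.
Local Open Scope classical_set_scope.
Local Open Scope ring_scope.

Definition evec (R : realType) (N : nat) (i : 'I_N) : 'rV[R]_N := delta_mx 0 i.

Definition eucl (R : realType) (N : nat) (x : 'rV[R]_N) : R :=
  Num.sqrt (\sum_(i < N) (x 0 i) ^+ 2).

Definition iterD (R : realType) (N : nat) (vs : seq 'rV[R]_N)
    (f : 'rV[R]_N -> R) : 'rV[R]_N -> R :=
  foldr (fun v g => 'D_v g) f vs.

Definition smooth (R : realType) (N : nat) (f : 'rV[R]_N -> R) : Prop :=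
  forall vs : seq 'rV[R]_N,
    continuous (iterD vs f) /\
    (forall (x v : 'rV[R]_N), derivable (iterD vs f) x v).

Definition grad (R : realType) (N : nat) (f : 'rV[R]_N -> R) (x : 'rV[R]_N)
  : 'rV[R]_N := \row_(i < N) ('D_(evec R i) f) x.

Definition bdry (R : realType) (N : nat) (O : set 'rV[R]_N) : set 'rV[R]_N :=
  closure O `\` O.

(** Bounded domain with C^infinity boundary, given through a global defining
    function rho: O = {rho < 0}, rho smooth, grad rho <> 0 on the boundary. *)
Definition smooth_bounded_domain (R : realType) (N : nat) (O : set 'rV[R]_N)
  : Prop :=
  open O /\ connected O /\ O !=set0 /\
  (exists M : R, forall x, O x -> eucl x <= M) /\
  exists rho : 'rV[R]_N -> R,
    smooth rho /\ O = [set x | rho x < 0] /\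
    (forall p, bdry O p -> grad rho p != 0).

(** Exterior unit normal at p, computed from any defining function rho
    (it does not depend on the choice of rho). *)
Definition ext_normal (R : realType) (N : nat) (rho : 'rV[R]_N -> R)
  (p : 'rV[R]_N) : 'rV[R]_N := (eucl (grad rho p))^-1 *: grad rho p.

Definition laplacian (R : realType) (N : nat) (f : 'rV[R]_N -> R)
  (x : 'rV[R]_N) : R :=
  \sum_(i < N) ('D_(evec R i) ('D_(evec R i) f)) x.

Definition heat_solution_one (R : realType) (N : nat) (O : set 'rV[R]_N)
  (u : 'rV[R]_N -> R -> R) : Prop :=
  {within closure O `*` `]0, +oo[, continuous (fun z : 'rV[R]_N * R => u z.1 z.2)}
  /\ (forall x t, O x -> 0 < t ->
        derivable (u x) t 1 /\
        (forall i : 'I_N, (forall y, O y -> derivable (u^~ t) y (evec R i)) /\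
           derivable ('D_(evec R i) (u^~ t)) x (evec R i)) /\
        derive1 (u x) t = laplacian (u^~ t) x)
  /\ (forall x t, bdry O x -> 0 < t -> u x t = 0)
  /\ (exists M : R, forall x t, O x -> 0 < t -> `|u x t| <= M)
  /\ (forall K : set 'rV[R]_N, compact K -> K `<=` O ->
        forall eps : R, 0 < eps -> exists delta : R, 0 < delta /\
          forall x t, K x -> 0 < t < delta -> `|u x t - 1| < eps).

Definition normal_deriv_const (R : realType) (N : nat) (O : set 'rV[R]_N)
  (rho : 'rV[R]_N -> R) (u : 'rV[R]_N -> R -> R) (t b : R) : Prop :=
  forall p, bdry O p ->
    (fun h : R => (u p t - u (p - h *: ext_normal rho p) t) / h)
      @ (0 : R)^'+ --> b.

Definition is_euclidean_ball (R : realType) (N : nat) (O : set 'rV[R]_N) : Prop :=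
  exists (c : 'rV[R]_N) (r : R), 0 < r /\ O = [set x | eucl (x - c) < r].

(* Main.v *)
Require Import Defs.
From HB Require Import structures.
From mathcomp Require Import all_boot all_order all_algebra.
From mathcomp Require Import all_classical all_reals all_analysis.
From mathcomp Require Import ring lra.
Set Implicit Arguments. Unset Strict Implicit. Unset Printing Implicit Defensive.
Import Order.TTheory GRing.Theory Num.Theory.
Import numFieldNormedType.Exports.
Local Open Scope classical_set_scope.
Local Open Scope ring_scope.

(* Near the boundary and for small t the solution is a one-dimensional layer: with
   a smooth boundary depth s, r = sqrt t and z = s/r,
     u = Phi(z) + r (a z (1 - Phi(z)) + b z^2 phi(z)) + O(t (1 - exp(-z))),
   where Phi is the error function, phi = Phi', c0 = phi(0), b is smooth, and a is
   minus half of the mean curvature on the boundary. The error is controlled by the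
   maximum principle; the corner layer at t = 0 is absorbed by a shifted heat kernel
   to a small power. Hence the normal derivative at time t is -(c0/r + a) + O(r),
   and if it is constant along a sequence t_n -> 0 then the boundary has constant
   mean curvature.

   It remains to prove Alexandrov's theorem. The moving planes are carried out
   with the defining function alone, never writing the boundary as a graph: at a
   contact point of the boundary with its reflection, the Hopf lemma for the mean
   curvature operator is obtained by maximising one defining function over the
   sublevel set of the other perturbed by eps (exp(-a |x-y|^2) - exp(-a R^2)), where
   the first- and second-order conditions contradict the curvature equation. So the
   domain is symmetric in every direction, and therefore a ball. *)

(** * Inner product and max norm on row vectors *)

Section Vectors.
Context {R : realType} {N : nat}.
Implicit Types (x y z v w : 'rV[R]_N).

(** The depth satisfies the eikonal equation only up to multiples of itself, |grad s|^2 = 1 + beta s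
    + zeta s^2. With s = z r the defect beta s enters the heat residual at the same order 1/r as the
    Laplacian of s, and a, b are the two coefficients that cancel both. In the moving planes,
    contact beyond the plane and orthogonal contact on the plane are instances of one statement
    about a ball whose sphere passes through the contact point and is not tangent to the surface
    there. The main obstacle is that a connected domain may have a disconnected boundary, so contact
    that spreads over one boundary component says nothing about the others. Contact is therefore
    transported into the domain: every point is folded to the far side of the critical plane and
    followed in the direction of motion until it leaves the domain, and the points whose exit is a
    contact point form an open and relatively closed set. Roundness uses more than symmetry: beyond
    the critical plane the reflected caps stay inside, so a point nearer to the centre than some
    point of the domain is a mirror image of that point in an admissible plane. *)

Definition dot x y : R := \sum_(i < N) x 0 i * y 0 i.

Lemma dotC x y : dot x y = dot y x.
Proof. by apply: eq_bigr => i _; rewrite mulrC. Qed.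

Lemma dotDl x y z : dot (x + y) z = dot x z + dot y z.
Proof. by rewrite -big_split; apply: eq_bigr => i _; rewrite !mxE mulrDl. Qed.

Lemma dotDr x y z : dot z (x + y) = dot z x + dot z y.
Proof. by rewrite dotC dotDl !(dotC z). Qed.

Lemma dotZl (c : R) x y : dot (c *: x) y = c * dot x y.
Proof. by rewrite mulr_sumr; apply: eq_bigr => i _; rewrite !mxE mulrA. Qed.

Lemma dotZr (c : R) x y : dot x (c *: y) = c * dot x y.
Proof. by rewrite dotC dotZl dotC. Qed.

Lemma dotNl x y : dot (- x) y = - dot x y.
Proof. by rewrite -scaleN1r dotZl mulN1r. Qed.

Lemma dotNr x y : dot x (- y) = - dot x y.
Proof. by rewrite dotC dotNl dotC. Qed.

Lemma dotBl x y z : dot (x - y) z = dot x z - dot y z.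
Proof. by rewrite dotDl dotNl. Qed.

Lemma dot0l x : dot 0 x = 0.
Proof. by rewrite -(scale0r (0 : 'rV[R]_N)) dotZl mul0r. Qed.

Lemma dot0r x : dot x 0 = 0.
Proof. by rewrite dotC dot0l. Qed.

Definition dotE := (dotDl, dotDr, dotZl, dotZr, dotNl, dotNr, dot0l, dot0r).

Lemma dot_ge0 x : 0 <= dot x x.
Proof. by apply: sumr_ge0 => i _; rewrite -expr2 sqr_ge0. Qed.

Lemma coord_sq_le_dot x i : x 0 i ^+ 2 <= dot x x.
Proof.
rewrite /dot (bigD1 i) //= -expr2 lerDl sumr_ge0 // => j _.
by rewrite -expr2 sqr_ge0.
Qed.

Lemma dot_eq0 x : dot x x = 0 -> x = 0.
Proof.
move=> x0; apply/rowP => i; rewrite mxE; apply/eqP.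
by rewrite -sqrf_eq0 eq_le sqr_ge0 andbT -x0 coord_sq_le_dot.
Qed.

Lemma dot_gt0 x : x != 0 -> 0 < dot x x.
Proof.
move=> x0; rewrite lt_neqAle dot_ge0 andbT eq_sym.
by apply: contra_neq x0; exact: dot_eq0.
Qed.

Lemma dot_evec x i : dot x (evec R i) = x 0 i.
Proof.
rewrite /dot (bigD1 i) //= /evec mxE !eqxx mulr1 big1 ?addr0 // => j ji.
by rewrite mxE (negbTE ji) andbF mulr0.
Qed.

Lemma coord_le_norm x i : `|x 0 i| <= `|x|.
Proof.
rewrite [leRHS]/Num.norm /= mx_normrE; apply/bigmax_geP; right.
by exists (0, i).
Qed.

Lemma norm_le_coord x (M : R) : 0 <= M -> (forall i, `|x 0 i| <= M) -> `|x| <= M.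
Proof.
move=> M0 xM; rewrite [leLHS]/Num.norm /= mx_normrE; apply/bigmax_leP.
by split=> // -[i j] _; rewrite (ord1 i).
Qed.

Lemma norm_sq_le_dot x : `|x| ^+ 2 <= dot x x.
Proof.
have [/eqP x0|/mx_norm_neq0[[i j] xij]] := boolP (mx_norm x == 0).
  by rewrite {1}/Num.norm /= x0 expr0n /= dot_ge0.
have -> : `|x| = `|x i j| by exact: xij.
by rewrite (ord1 i) real_normK ?num_real// coord_sq_le_dot.
Qed.

(** [|x|] is the max norm, the one that carries the topology, so each of the [N] products is bounded
    separately. *)
Lemma dot_le_norm x y : `|dot x y| <= N%:R * (`|x| * `|y|).
Proof.
apply: le_trans (ler_norm_sum _ _ _) _.
rewrite -[X in X%:R](card_ord N) -sumr_const big_distrl/=.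
apply: ler_sum => i _.
by rewrite normrM mul1r ler_pM// coord_le_norm.
Qed.

Lemma euclE x : eucl x = Num.sqrt (dot x x).
Proof. by rewrite /eucl; congr Num.sqrt; apply: eq_bigr => i _; rewrite expr2. Qed.

Lemma eucl_sqr x : eucl x ^+ 2 = dot x x.
Proof. by rewrite euclE sqr_sqrtr// dot_ge0. Qed.

Lemma eucl_ge0 x : 0 <= eucl x.
Proof. by rewrite euclE sqrtr_ge0. Qed.

Lemma eucl_gt0 x : x != 0 -> 0 < eucl x.
Proof. by move=> x0; rewrite euclE sqrtr_gt0 dot_gt0. Qed.

Lemma norm_le_eucl x : `|x| <= eucl x.
Proof.
by rewrite -(ler_pXn2r (n:=2)) ?nnegrE ?eucl_ge0// eucl_sqr norm_sq_le_dot.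
Qed.

Lemma row_sum_evec x : x = \sum_i x 0 i *: evec R i.
Proof. by rewrite [LHS]row_sum_delta. Qed.

End Vectors.

(** * Limits and continuity with explicit radii *)

Section EpsilonDelta.
Context {R : realType}.

Lemma half_gt0_lt (m : R) : 0 < m -> 0 < m / 2 /\ m / 2 < m.
Proof. by move=> m0; split; lra. Qed.

Lemma near_normP {V : normedModType R} (x : V) (P : V -> Prop) :
  (\forall y \near x, P y) <->
  exists2 d, 0 < d & forall y, `|x - y| < d -> P y.
Proof. exact: nbhs_normP. Qed.

Lemma cvg_punctured (f : R -> R) (l : R) : f h @[h --> 0^'] --> l ->
  forall e, 0 < e -> exists2 d, 0 < d &
    forall h, h != 0 -> `|h| < d -> `|l - f h| < e.
Proof.
move=> /cvgrPdist_lt fl e /fl/near_normP[d d0 dP]; exists d => // h h0 hd.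
by apply: dP => //; rewrite sub0r normrN.
Qed.

Lemma cvg_right (f : R -> R) (l : R) : f h @[h --> 0^'+] --> l ->
  forall e, 0 < e -> exists2 d, 0 < d &
    forall h, 0 < h < d -> `|l - f h| < e.
Proof.
move=> /cvgrPdist_lt fl e /fl/near_normP[d d0 dP]; exists d => // h.
move=> /andP[h0 hd]; apply: dP => //; rewrite sub0r normrN gtr0_norm//.
Qed.

Lemma continuous_atP {V : normedModType R} (f : V -> R) (x : V) :
  {for x, continuous f} <->
  forall e, 0 < e -> exists2 d, 0 < d &
    forall y, `|x - y| < d -> `|f x - f y| < e.
Proof.
split=> [/cvgrPdist_lt fx e /fx/near_normP//|H].
by apply/cvgrPdist_lt => e /H/near_normP.
Qed.

Lemma open_normP {V : normedModType R} (A : set V) :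
  (forall x, A x -> exists2 d, 0 < d & forall y, `|x - y| < d -> A y) ->
  open A.
Proof.
by move=> H; rewrite openE => x /H; exact: (iffRL (near_normP x A)).
Qed.

End EpsilonDelta.

(** * One-variable growth estimates and the second derivative test *)

Section OneVariable.
Context {R : realType}.
Implicit Types (g : R -> R).

Lemma is_derive_growth g (x a : R) : is_derive x 1 g a ->
  forall e, 0 < e -> exists2 d, 0 < d &
    forall h, h != 0 -> `|h| < d -> `|a - h^-1 * (g (h + x) - g x)| < e.
Proof.
move=> [gd gv].
have gc : h^-1 *: ((g \o shift x) (h *: 1) - g x) @[h --> 0^'] --> a.
  by rewrite -gv; exact: gd.
move=> e /(cvg_punctured gc)[d d0 dP]; exists d => // h h0 hd.
by have := dP h h0 hd; rewrite /= [h%:A]mulr1.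
Qed.

Lemma right_growth_lt g (a c : R) : is_derive (0 : R) 1 g a -> a < c ->
  exists2 d, 0 < d & forall h, 0 < h < d -> g h < g 0 + c * h.
Proof.
move=> ga ac.
have /(is_derive_growth ga)[d d0 dP] : 0 < c - a by rewrite subr_gt0.
exists d => // h /andP[h0 hd].
have := dP h; rewrite gt_eqF// gtr0_norm// => /(_ isT hd).
rewrite addr0 ltr_norml => /andP[H _].
have {H} : h^-1 * (g h - g 0) < c by lra.
rewrite mulrC ltr_pdivrMr//; lra.
Qed.

(** First-order growth of [g1] makes the derivative of g - c y^2 negative to the right of 0; the
    mean value theorem integrates this. *)
Lemma right_second_order_lt g g1 (a c r : R) : 0 < r ->
  (forall h : R, `|h| < r -> is_derive h 1 g (g1 h)) ->
  is_derive (0 : R) 1 g1 a -> g1 0 = 0 -> a < 2 * c ->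
  exists2 d, 0 < d & forall h, 0 < h < d -> g h < g 0 + c * h ^+ 2.
Proof.
move=> r0 gr g1a g10 ac.
have [d d0 dP] := right_growth_lt g1a ac.
exists (Num.min d r) => [|h]; first by rewrite lt_min d0.
rewrite lt_min => /and3P[h0 hd hr].
have ders x : x \in `]0, h[%R -> is_derive x 1 (fun y => g y - c * y ^+ 2)
    (g1 x - 2 * c * x).
  rewrite in_itv/= => /andP[x0 xh].
  have gx := gr x; rewrite gtr0_norm// in gx.
  have := gx (lt_trans xh hr) => ?.
  apply: is_derive_eq; rewrite /= -!/(GRing.scale _ _) /GRing.scale/=; ring.
have cont : {within `[0, h], continuous (fun y => g y - c * y ^+ 2)}.
  apply: derivable_within_continuous => x; rewrite in_itv/= => /andP[x0 xh].
  have ? : is_derive x 1 g (g1 x).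
    by apply: gr; rewrite ger0_norm// (le_lt_trans xh).
  exact: ex_derive.
have [x] := MVT h0 ders cont; rewrite in_itv/= => /andP[x0 xh].
have := dP x; rewrite g10 add0r x0 (lt_trans xh hd) => /(_ isT) H.
rewrite expr0n/= mulr0 !subr0 => E.
have : (g1 x - 2 * c * x) * h < 0 by rewrite pmulr_llt0//; lra.
by rewrite -E; lra.
Qed.

(** The slopes to both sides of a maximum are nonpositive, so [g1 0 = 0]; a positive [a] would then
    push [- g] below [- g 0] at second order. *)
Lemma second_derivative_test g g1 (a r : R) : 0 < r ->
  (forall h : R, `|h| < r -> is_derive h 1 g (g1 h)) ->
  is_derive (0 : R) 1 g1 a -> (forall h, `|h| < r -> g h <= g 0) ->
  a <= 0.
Proof.
move=> r0 gr g1a gmax.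
have sgn0 (s : R) : s ^+ 2 = 1 -> s * g1 0 <= 0.
  move=> s1; rewrite leNgt; apply/negP => sg.
  have ? : is_derive (0 : R) 1 g (g1 0) by apply: gr; rewrite normr0.
  have sN : `|s| = 1.
    by apply/eqP; rewrite -(@pexpr_eq1 _ _ 2)// real_normK ?num_real// s1.
  have D : is_derive (0 : R) 1 (fun h => - g (s * h)) (- (s * g1 0)).
    have D0 : is_derive (0 : R) 1 (fun h => s * h) s.
      by apply: is_derive_eq; rewrite /GRing.scale/= mulr1.
    have D1 : is_derive (s * 0) 1 g (g1 0) by rewrite mulr0.
    have := is_derive1_comp D1 D0 => ?.
    by apply: is_derive_eq; rewrite mulrC.
  have := @right_growth_lt _ _ 0 D.
  rewrite oppr_lt0 => /(_ sg)[d d0 dP].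
  pose h := Num.min d r / 2.
  have m0 : 0 < Num.min d r by rewrite lt_min d0.
  have h0 : 0 < h by rewrite /h; lra.
  have hlt : h < Num.min d r by rewrite /h; lra.
  move: (hlt); rewrite lt_min => /andP[hd hr].
  have := dP h; rewrite h0 hd mul0r addr0 mulr0 => /(_ isT).
  rewrite ltrN2 ltNge gmax//.
  by rewrite normrM sN mul1r gtr0_norm.
have g10 : g1 0 = 0.
  have := sgn0 1; rewrite expr1n mul1r => /(_ erefl) A.
  have := sgn0 (-1); rewrite sqrrN expr1n mulN1r => /(_ erefl) B.
  lra.
rewrite leNgt; apply/negP => a0.
have D (h : R) : `|h| < r -> is_derive h 1 (fun h => - g h) (- g1 h).
  by move=> /gr ?; apply: is_derive_eq.
have D1 : is_derive (0 : R) 1 (fun h => - g1 h) (- a) by apply: is_derive_eq.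
have := @right_second_order_lt _ _ _ 0 _ r0 D D1.
rewrite g10 oppr0 mulr0 oppr_lt0 => /(_ erefl a0)[d d0 dP].
have m0 : 0 < Num.min d r by rewrite lt_min d0.
have hlt : Num.min d r / 2 < Num.min d r by lra.
move: (hlt); rewrite lt_min => /andP[hd hr].
have h0 : 0 < Num.min d r / 2 by lra.
have := dP (Num.min d r / 2); rewrite h0 hd mul0r addr0 => /(_ isT).
by rewrite ltrN2 ltNge gmax// gtr0_norm.
Qed.

End OneVariable.

(** * Functions of class C^k *)

Section Lines.
Context {R : realType} {N : nat}.
Local Notation E := 'rV[R]_N.
Implicit Types (f : E -> R) (x y v w : E) (V : set E).

Lemma line_is_derive f x v (h d : R) :
  is_derive (x + h *: v) v f d <-> is_derive h 1 (fun k : R => f (x + k *: v)) d.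
Proof.
pose g1 (k : R) := k^-1 *: ((f \o shift (x + h *: v)) (k *: v) - f (x + h *: v)).
pose g2 (k : R) := k^-1 *: (((fun k : R => f (x + k *: v)) \o shift h) (k *: (1 : R))
   - f (x + h *: v)).
have g12 : g1 = g2.
  apply/funext => k; rewrite /g1 /g2 /= [k%:A]mulr1.
  by rewrite scalerDl addrCA addrA addrC addrA.
split=> -[fd fv]; split.
- by rewrite /derivable -/g2 -g12.
- by rewrite -fv /derive -/g2 -g12.
- by rewrite /derivable -/g1 g12.
- by rewrite -fv /derive -/g1 g12.
Qed.

Lemma line_is_derive0 f x v (d : R) :
  is_derive x v f d <-> is_derive (0 : R) 1 (fun k : R => f (x + k *: v)) d.
Proof. by rewrite -line_is_derive scale0r addr0. Qed.

Lemma is_derive_comp1 (F : R -> R) (s : E -> R) x v (a b : R) :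
  is_derive (s x) 1 F a -> is_derive x v s b ->
  is_derive x v (fun y => F (s y)) (a * b).
Proof.
move=> Fa /line_is_derive0 sb; apply/line_is_derive0.
have Fa' : is_derive (s (x + (0 : R) *: v)) 1 F a by rewrite scale0r addr0.
exact: (is_derive1_comp Fa' sb).
Qed.

Lemma is_derive_scale f x v (c d : R) :
  is_derive x v f d -> is_derive x (c *: v) f (c * d).
Proof.
move=> /line_is_derive0 fd; apply/line_is_derive0.
have D0 : is_derive (0 : R) 1 (fun h => c * h) c.
  by apply: is_derive_eq; rewrite /GRing.scale/= mulr1.
have D1 : is_derive (c * 0) 1 (fun k : R => f (x + k *: v)) d by rewrite mulr0.
have := is_derive1_comp D1 D0; rewrite mulrC.
by under [X in is_derive _ _ X]eq_fun do rewrite /= mulrC -scalerA.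
Qed.

Lemma line_mvt f x v (h : R) : 0 < h ->
  (forall k, 0 <= k <= h -> derivable f (x + k *: v) v) ->
  exists2 k, 0 < k < h & f (x + h *: v) - f x = h * 'D_v f (x + k *: v).
Proof.
move=> h0 fd.
have D (k : R) : 0 <= k <= h ->
    is_derive k 1 (fun k : R => f (x + k *: v)) ('D_v f (x + k *: v)).
  by move=> /fd fk; apply/line_is_derive/derivableP.
have [||k] := @MVT R (fun k : R => f (x + k *: v))
    (fun k => 'D_v f (x + k *: v)) 0 h h0.
- by move=> k; rewrite in_itv/= => /andP[/ltW a /ltW b]; apply: D; rewrite a b.
- by apply: derivable_within_continuous => k; rewrite in_itv/= => /D[].
rewrite in_itv/= => kh; rewrite scale0r addr0 subr0 mulrC => E0.
by exists k.
Qed.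

Lemma open_ball V x : open V -> V x ->
  exists2 d, 0 < d & forall y, `|x - y| < d -> V y.
Proof. by move=> oV Vx; apply/near_normP/open_nbhs_nbhs. Qed.

Lemma open_line V x v : open V -> V x ->
  exists2 d, 0 < d & forall h : R, `|h| < d -> V (x + h *: v).
Proof.
move=> oV /(open_ball oV)[d d0 dP].
exists (d / (`|v| + 1)) => [|h hd]; first by rewrite divr_gt0// ltr_wpDl.
apply: dP; rewrite opprD addrA subrr sub0r normrN normrZ.
rewrite (@le_lt_trans _ _ (`|h| * (`|v| + 1)))//.
  by rewrite ler_wpM2l// lerDl.
by rewrite -ltr_pdivlMr// ltr_wpDl.
Qed.

End Lines.

Section Ck.
Context {R : realType} {N : nat}.
Local Notation E := 'rV[R]_N.
Implicit Types (f g : E -> R) (x y v w : E) (V : set E).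

(** Derivatives are taken in every direction [v], not only along the axes; linearity in [v] is
    recovered on open sets by [deriveDdir]. *)
Fixpoint Ck V (n : nat) f : Prop :=
  (forall x, V x -> {for x, continuous f}) /\
  match n with
  | 0%N => True
  | n'.+1 => forall v, (forall x, V x -> derivable f x v) /\ Ck V n' ('D_v f)
  end.

Lemma Ck_continuous V n f x : Ck V n f -> V x -> {for x, continuous f}.
Proof. by case: n => [|n] [+ _]; apply. Qed.

Lemma Ck_derivable V n f x v : Ck V n.+1 f -> V x -> derivable f x v.
Proof. by move=> [_ /(_ v)[+ _]]; apply. Qed.

Lemma Ck_derive V n f v : Ck V n.+1 f -> Ck V n ('D_v f).
Proof. by move=> [_ /(_ v)[]]. Qed.

Lemma Ck_le V m n f : (n <= m)%N -> Ck V m f -> Ck V n f.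
Proof.
elim: m n f => [|m IH] [|n] f //= nm [cf fD]; split=> // v.
by have [fd fD'] := fD v; split=> //; exact: IH.
Qed.

Lemma Ck_sub V W n f : W `<=` V -> Ck V n f -> Ck W n f.
Proof.
move=> WV; elim: n f => [|n IH] f /= [cf fD]; split=> //.
- by move=> x /WV; exact: cf.
- by move=> x /WV; exact: cf.
- by move=> v; have [fd fD'] := fD v; split=> [x /WV /fd|] //; exact: IH.
Qed.

Lemma smooth_Ck V n f : smooth f -> Ck V n f.
Proof.
move=> sf; suff H vs : Ck V n (Defs.iterD vs f) by exact: (H [::]).
elim: n vs => [|n IH] vs /=; have [cf df] := sf vs; split=> //.
- by move=> x _; exact: cf.
- by move=> x _; exact: cf.
- by move=> v; split=> [x _|]; [exact: df|exact: (IH (v :: vs))].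
Qed.

Lemma near_open V x (P : E -> Prop) : open V -> V x ->
  (forall y, V y -> P y) -> \forall y \near x, P y.
Proof.
by move=> oV Vx VP; apply: filterS (open_nbhs_nbhs (conj oV Vx)).
Qed.

Section OpenDomain.
Variable V : set E.
Hypothesis oV : open V.

Lemma Ck_eq n f g : (forall x, V x -> f x = g x) -> Ck V n f -> Ck V n g.
Proof.
have cg (h1 h2 : E -> R) : (forall x, V x -> h1 x = h2 x) ->
    (forall x, V x -> {for x, continuous h1}) ->
    forall x, V x -> {for x, continuous h2}.
  move=> h12 c1 x Vx; apply/continuous_atP => e e0.
  have /continuous_atP/(_ e e0)[d d0 dP] := c1 x Vx.
  have [d' d'0 d'P] := open_ball oV Vx.
  exists (Num.min d d') => [|y]; first by rewrite lt_min d0.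
  by rewrite lt_min => /andP[/dP + /d'P Vy]; rewrite !h12.
elim: n f g => [|n IH] f g fg /= [cf fD]; split=> //; try exact: cg fg cf.
move=> v; have [fd fD'] := fD v; split=> [x Vx|].
  by apply: near_eq_derivable (fd x Vx); apply: (near_open oV Vx) => y /fg.
by apply: (IH _ _ _ fD') => x Vx; apply: near_eq_derive; apply: (near_open oV Vx) => y /fg.
Qed.

Lemma Ck_deriveP n f (df : E -> E -> R) :
  (forall x, V x -> {for x, continuous f}) ->
  (forall x v, V x -> is_derive x v f (df v x)) ->
  (forall v, Ck V n (df v)) -> Ck V n.+1 f.
Proof.
move=> cf fd Cd; split=> // v; split=> [x Vx|].
  by have [] := fd x v Vx.
apply: Ck_eq (Cd v) => x Vx; by have [_ ->] := fd x v Vx.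
Qed.

Lemma Ck0P f : (forall x, V x -> {for x, continuous f}) -> Ck V 0 f.
Proof. by split. Qed.

Opaque Ck.

Lemma Ck_cst n (c : R) : Ck V n (fun=> c).
Proof.
elim: n c => [|n IH] c.
  by apply: Ck0P => x _; exact: cst_continuous.
apply: (@Ck_deriveP _ _ (fun _ _ => 0)) => [x _|v]; last exact: IH.
exact: cst_continuous.
Qed.

Lemma CkD n f g : Ck V n f -> Ck V n g -> Ck V n (fun x => f x + g x).
Proof.
elim: n f g => [|n IH] f g Cf Cg.
  by apply: Ck0P => x Vx; apply: continuousD; [exact: (Ck_continuous Cf Vx)|exact: (Ck_continuous Cg Vx)].
apply: (@Ck_deriveP _ _ (fun v x => 'D_v f x + 'D_v g x)) => [x Vx|x v Vx|v].
- by apply: continuousD; [exact: (Ck_continuous Cf Vx)|exact: (Ck_continuous Cg Vx)].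
- have := derivableP (Ck_derivable (v:=v) Cf Vx).
  have := derivableP (Ck_derivable (v:=v) Cg Vx) => ? ?.
  exact: is_deriveD.
- by apply: IH; exact: Ck_derive.
Qed.

Lemma CkM n f g : Ck V n f -> Ck V n g -> Ck V n (fun x => f x * g x).
Proof.
elim: n f g => [|n IH] f g Cf Cg.
  by apply: Ck0P => x Vx; apply: continuousM; [exact: (Ck_continuous Cf Vx)|exact: (Ck_continuous Cg Vx)].
apply: (@Ck_deriveP _ _ (fun v x => f x * 'D_v g x + g x * 'D_v f x))
    => [x Vx|x v Vx|v].
- by apply: continuousM; [exact: (Ck_continuous Cf Vx)|exact: (Ck_continuous Cg Vx)].
- have := derivableP (Ck_derivable (v:=v) Cf Vx).
  have := derivableP (Ck_derivable (v:=v) Cg Vx) => ? ?.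
  exact: is_deriveM.
- by apply: CkD; apply: IH; (exact: Ck_derive || exact: (Ck_le (leqnSn n))).
Qed.

Lemma CkZ n (c : R) f : Ck V n f -> Ck V n (fun x => c * f x).
Proof. by move=> Cf; apply: CkM => //; exact: Ck_cst. Qed.

Lemma CkN n f : Ck V n f -> Ck V n (fun x => - f x).
Proof. by move=> /(CkZ (-1)); apply: Ck_eq => x _; rewrite mulN1r. Qed.

Lemma CkB n f g : Ck V n f -> Ck V n g -> Ck V n (fun x => f x - g x).
Proof. by move=> Cf Cg; apply: CkD => //; exact: CkN. Qed.

Lemma Ck_sum n (I : Type) (r : seq I) (F : I -> E -> R) :
  (forall i, Ck V n (F i)) -> Ck V n (fun x => \sum_(i <- r) F i x).
Proof.
move=> CF; elim: r => [|i r IH].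
  by apply: Ck_eq (Ck_cst n 0) => x _; rewrite big_nil.
by apply: Ck_eq (CkD (CF i) IH) => x _; rewrite big_cons.
Qed.

Lemma is_derive_coord (i : 'I_N) x v : is_derive x v (fun y : E => y 0 i) (v 0 i).
Proof.
apply/line_is_derive0.
have -> : (fun k : R => (x + k *: v) 0 i) = (fun k => x 0 i + k * v 0 i).
  by apply/funext => k; rewrite !mxE.
by apply: is_derive_eq; rewrite /GRing.scale/=; ring.
Qed.

Lemma Ck_coord n (i : 'I_N) : Ck V n (fun x => x 0 i).
Proof.
case: n => [|n]; first by apply: Ck0P => x _; exact: coord_continuous.
apply: (@Ck_deriveP _ _ (fun v _ => v 0 i)) => [x _|x v _|v].
- exact: coord_continuous.
- exact: is_derive_coord.
- exact: Ck_cst.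
Qed.

Lemma Ck_expR n f : Ck V n f -> Ck V n (fun x => expR (f x)).
Proof.
elim: n f => [|n IH] f Cf.
  apply: Ck0P => x Vx; apply: (@continuous_comp _ _ _ f expR).
    exact: (Ck_continuous Cf Vx).
  exact: continuous_expR.
apply: (@Ck_deriveP _ _ (fun v x => expR (f x) * 'D_v f x)) => [x Vx|x v Vx|v].
- apply: (@continuous_comp _ _ _ f expR).
    exact: (Ck_continuous Cf Vx).
  exact: continuous_expR.
- have D := derivableP (Ck_derivable (v:=v) Cf Vx).
  exact: (is_derive_comp1 (is_derive_expR (f x)) D).
- by apply: CkM; [apply: IH; exact: (Ck_le (leqnSn n))|exact: Ck_derive].
Qed.

Definition rsqrt (y : R) := (Num.sqrt y)^-1.

Lemma is_derive_rsqrt (y : R) : 0 < y -> is_derive y 1 rsqrt (- 2^-1 * rsqrt y ^+ 3).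
Proof.
move=> y0; have s0 : Num.sqrt y != 0 by rewrite gt_eqF// sqrtr_gt0.
have D := is_derive1_sqrt y0.
have := is_deriveV s0 D => D'.
apply: is_derive_eq D' _; rewrite /rsqrt /GRing.scale/=.
by field.
Qed.

Lemma Ck_rsqrt n f : (forall x, V x -> 0 < f x) -> Ck V n f ->
  Ck V n (fun x => rsqrt (f x)).
Proof.
move=> f0; have fc k : Ck V k f ->
    forall x, V x -> {for x, continuous (fun x => rsqrt (f x))}.
  move=> Cf x Vx; apply: (@continuous_comp _ _ _ f rsqrt).
    exact: (Ck_continuous Cf Vx).
  apply: differentiable_continuous; apply/derivable1_diffP.
  by have [] := is_derive_rsqrt (f0 x Vx).
elim: n => [|n IH] Cf; first by apply: Ck0P; exact: (fc _ Cf).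
apply: (@Ck_deriveP _ _ (fun v x => (- 2^-1 * rsqrt (f x) ^+ 3) * 'D_v f x)).
- exact: (fc _ Cf).
- move=> x v Vx; have D := derivableP (Ck_derivable (v:=v) Cf Vx).
  exact: (is_derive_comp1 (is_derive_rsqrt (f0 x Vx)) D).
move=> v; apply: CkM; last exact: Ck_derive.
have Cr : Ck V n (fun x => rsqrt (f x)) by apply: IH; exact: (Ck_le (leqnSn n)).
apply: CkZ; have : Ck V n (fun x => rsqrt (f x) * (rsqrt (f x) * rsqrt (f x))).
  by do 2 apply: CkM => //.
by apply: Ck_eq => x _; rewrite !exprS mulr1.
Qed.

End OpenDomain.
End Ck.

(** * Gradient, Hessian and expansions along curves *)

Section Gradient.
Context {R : realType} {N : nat}.
Local Notation E := 'rV[R]_N.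
Implicit Types (f g : E -> R) (x y z v w : E) (V : set E).

Lemma near_forall_fin (I : finType) x (P : I -> E -> Prop) :
  (forall i, exists2 d, 0 < d & forall y, `|x - y| < d -> P i y) ->
  exists2 d, 0 < d & forall y, `|x - y| < d -> forall i, P i y.
Proof.
move=> H; have H' i : \forall y \near x, P i y by apply/near_normP.
exact: (iffLR (@near_normP R E x (fun y => forall i, P i y)) (filter_forall _ H')).
Qed.

Section OpenDomain.
Variable V : set E.
Hypothesis oV : open V.

(** The step along [v + w] is a step [h *: v] followed by a step [h *: w]. The mean value theorem
    turns the second into a value of ['D_w f] near [x], and continuity of ['D_w f] moves it back to
    [x]. *)
Lemma deriveDdir f x v w : Ck V 1 f -> V x ->
  'D_(v + w) f x = 'D_v f x + 'D_w f x.
Proof.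
move=> Cf Vx; apply/eqP; rewrite -subr_eq0; apply/negP => /negP ne.
set D := 'D_(v + w) f x in ne *.
pose e := `|D - ('D_v f x + 'D_w f x)| / 4.
have e0 : 0 < e by rewrite /e divr_gt0// normr_gt0.
have /line_is_derive0 D1 := derivableP (Ck_derivable (v := v + w) Cf Vx).
have /line_is_derive0 D2 := derivableP (Ck_derivable (v := v) Cf Vx).
have [d1 d10 d1P] := is_derive_growth D1 e0.
have [d2 d20 d2P] := is_derive_growth D2 e0.
have /continuous_atP/(_ _ e0)[d3 d30 d3P] := Ck_continuous (Ck_derive w Cf) Vx.
have [d4 d40 d4P] := open_ball oV Vx.
pose m := Num.min (Num.min d1 d2) (Num.min d3 d4).
have m0 : 0 < m by rewrite !lt_min d10 d20 d30 d40.
pose M := `|v| + `|w| + 1.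
have M1 : 1 <= M by rewrite /M lerDr addr_ge0.
pose h := m / (2 * M).
have h0 : 0 < h by rewrite divr_gt0// mulr_gt0// (lt_le_trans _ M1).
have hm : h * M < m.
  have -> : h * M = m / 2 by rewrite /h; field; rewrite gt_eqF// (lt_le_trans _ M1).
  by lra.
have h_m : h < m by rewrite (le_lt_trans _ hm)// ler_pMr.
clearbody h.
have small k : 0 <= k <= h -> `|x - (x + h *: v + k *: w)| < m.
  move=> /andP[k0 kh]; rewrite -!addrA opprD addrA subrr sub0r normrN.
  apply: le_lt_trans (ler_normD _ _) _; rewrite !normrZ (gtr0_norm h0) (ger0_norm k0).
  apply: le_lt_trans hm; rewrite /M !mulrDr mulr1.
  have := ler_wpM2r (normr_ge0 w) kh; move: h0; lra.
have [|k /andP[k0 kh]] := @line_mvt R N f (x + h *: v) w h h0.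
  move=> k kh; apply: (Ck_derivable Cf); apply: d4P.
  by have := small k kh; rewrite !lt_min => /and3P[_ _ ->].
have := small k; rewrite !ltW//= => /(_ isT); rewrite !lt_min.
move=> /andP[_ /andP[/d3P H3 _]].
move: h_m; rewrite !lt_min => /andP[/andP[hd1 hd2] _].
have := d2P h.
rewrite gt_eqF// gtr0_norm// !addr0 !scale0r !addr0 => /(_ isT hd2) H2.
have := d1P h.
rewrite gt_eqF// gtr0_norm// !addr0 !scale0r !addr0 => /(_ isT hd1) H1 E1.
have E2 : h^-1 * (f (x + h *: (v + w)) - f x) =
   h^-1 * (f (x + h *: v) - f x) + 'D_w f (x + h *: v + k *: w).
  rewrite scalerDr addrA.
  have -> : f (x + h *: v + h *: w) - f x =
    (f (x + h *: v + h *: w) - f (x + h *: v)) + (f (x + h *: v) - f x) by ring.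
  by rewrite E1 mulrDr mulKf ?gt_eqF// addrC.
rewrite E2 in H1.
have : `|D - ('D_v f x + 'D_w f x)| < 4 * e.
  by move: H1 H2 H3 e0; rewrite -/D !ltr_norml; clearbody e D; clear; lra.
by rewrite /e mulrC divfK ?ltxx.
Qed.

Lemma derive_dot f x v : Ck V 1 f -> V x -> 'D_v f x = dot (grad f x) v.
Proof.
move=> Cf Vx; rewrite [in LHS](row_sum_evec v).
have -> : dot (grad f x) v = \sum_i v 0 i * 'D_(evec R i) f x.
  by apply: eq_bigr => i _; rewrite mxE mulrC.
elim: (index_enum _) => [|i r IH]; first by rewrite !big_nil derive0.
rewrite !big_cons deriveDdir// IH; congr (_ + _).
have [_ ->//] := is_derive_scale (v 0 i) (derivableP (Ck_derivable (v:=evec R i) Cf Vx)).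
Qed.

Lemma is_derive_dot f x v : Ck V 1 f -> V x -> is_derive x v f (dot (grad f x) v).
Proof.
by move=> Cf Vx; rewrite -derive_dot//; exact/derivableP/(Ck_derivable Cf).
Qed.

Lemma derive_continuous f x w e : Ck V 1 f -> V x -> 0 < e ->
  exists2 d, 0 < d & forall y, `|x - y| < d ->
    `|dot (grad f x) w - dot (grad f y) w| < e.
Proof.
move=> Cf Vx e0.
have /continuous_atP/(_ _ e0)[d d0 dP] := Ck_continuous (Ck_derive w Cf) Vx.
have [d' d'0 d'P] := open_ball oV Vx.
exists (Num.min d d') => [|y]; first by rewrite lt_min d0.
by rewrite lt_min => /andP[/dP + /d'P Vy]; rewrite !derive_dot.
Qed.

Lemma segment_mvt f x v : Ck V 1 f ->
  (forall k : R, 0 <= k <= 1 -> V (x + k *: v)) ->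
  exists2 k : R, 0 < k < 1 & f (x + v) - f x = dot (grad f (x + k *: v)) v.
Proof.
move=> Cf Vk; have [|k kh] := @line_mvt R N f x v 1 ltr01.
  by move=> k /Vk; exact: (Ck_derivable Cf).
have k1 : 0 <= k <= 1 by case/andP: kh => /ltW -> /ltW.
by rewrite scale1r mul1r derive_dot//; [exists k|exact: Vk].
Qed.

Lemma ray_lt f z w (c : R) : Ck V 1 f -> V z -> dot (grad f z) w < c ->
  exists2 d, 0 < d & forall h, 0 < h < d -> f (z + h *: w) < f z + c * h.
Proof.
move=> Cf Vz wc.
have /line_is_derive0 D := is_derive_dot w Cf Vz.
have [d d0 dP] := right_growth_lt D wc.
by exists d => // h /dP; rewrite scale0r addr0.
Qed.

(** Balls of the max norm are convex, so the segment from [z] to [y] stays where each partial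
    derivative is at most [|grad f x| + 1]. *)
Lemma Ck_lipschitz f x : Ck V 1 f -> V x ->
  exists2 d, 0 < d & exists2 L, 0 <= L & forall y z,
    `|x - y| < d -> `|x - z| < d -> `|f y - f z| <= L * `|y - z|.
Proof.
move=> Cf Vx.
have [d1 d10 d1P] := open_ball oV Vx.
have H (i : 'I_N) : exists2 d, 0 < d & forall y, `|x - y| < d ->
    `|grad f y 0 i| <= `|grad f x| + 1.
  have [d d0 dP] := @derive_continuous f x (evec R i) 1 Cf Vx ltr01.
  exists d => // y /dP; rewrite !dot_evec => yd.
  have := coord_le_norm (grad f x) i; move: yd.
  by rewrite !ltr_norml !ler_norml; lra.
have [d2 d20 d2P] := near_forall_fin H.
exists (Num.min d1 d2); first by rewrite lt_min d10.
exists (N%:R * (`|grad f x| + 1)); first by rewrite mulr_ge0// addr_ge0.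
move=> y z; rewrite !lt_min => /andP[y1 y2] /andP[z1 z2].
have seg d (k : R) : `|x - y| < d -> `|x - z| < d -> 0 <= k <= 1 ->
    `|x - (z + k *: (y - z))| < d.
  move=> yd zd /andP[k0 k1].
  have -> : x - (z + k *: (y - z)) = (1 - k) *: (x - z) + k *: (x - y).
    by rewrite -[x in LHS]scale1r -[in LHS](subrK k 1)
      ![_ *: (_ - _)]scalerBr scalerBl scale1r !scalerDl; apply/rowP => i; rewrite !mxE; ring.
  apply: le_lt_trans (ler_normD _ _) _; rewrite !normrZ ger0_norm ?subr_ge0//.
  rewrite (ger0_norm k0).
  have [->|kn] := eqVneq k 0; first by rewrite mul0r addr0 subr0 mul1r.
  have k0' : 0 < k by rewrite lt_neqAle eq_sym kn.
  have A : k * `|x - y| < k * d by rewrite ltr_pM2l.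
  have B : (1 - k) * `|x - z| <= (1 - k) * d by rewrite ler_wpM2l ?subr_ge0// ltW.
  lra.
have [|k kh] := @segment_mvt f z (y - z) Cf.
  by move=> k kh; apply: d1P; exact: seg.
rewrite [z + (y - z)]addrCA subrr addr0 => ->.
have k1 : 0 <= k <= 1 by case/andP: kh => /ltW -> /ltW.
apply: le_trans (dot_le_norm _ _) _; rewrite mulrA ler_wpM2r//.
rewrite ler_wpM2l//.
apply: norm_le_coord => [|i]; first by rewrite addr_ge0.
by apply: d2P; exact: seg.
Qed.

Definition hess f x : 'M[R]_N :=
  \matrix_(i, j) 'D_(evec R j) ('D_(evec R i) f) x.

Lemma derive2_hess f x v : Ck V 2 f -> V x ->
  'D_v ('D_v f) x = dot (v *m hess f x) v.
Proof.
move=> Cf Vx.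
have Cf1 : Ck V 1 f by exact: Ck_le Cf.
have -> : 'D_v ('D_v f) x = 'D_v (fun y => \sum_i v 0 i * 'D_(evec R i) f y) x.
  apply: near_eq_derive; apply: (near_open oV Vx) => y Vy.
  by rewrite derive_dot//; apply: eq_bigr => i _; rewrite mxE mulrC.
have D i : is_derive x v (fun y => v 0 i * 'D_(evec R i) f y)
   (v 0 i * dot (\row_j 'D_(evec R j) ('D_(evec R i) f) x) v).
  have := is_derive_dot v (Ck_derive (evec R i) Cf) Vx => ?.
  by apply: is_derive_eq; rewrite /GRing.scale/=; ring.
have [_] := is_derive_sum D.
have -> : (\sum_(i < N) (fun y => v 0 i * 'D_(evec R i) f y)) =
   (fun y => \sum_i v 0 i * 'D_(evec R i) f y).
  by apply/funext => y; rewrite fct_sumE.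
move=> ->; rewrite /dot.
under [RHS]eq_bigr do rewrite mxE big_distrl/=.
rewrite exchange_big/=; apply: eq_bigr => i _.
by rewrite mulr_sumr; apply: eq_bigr => j _; rewrite !mxE mulrA.
Qed.

(** Along the parabola the increment of [f] is h^2 (tau.H tau / 2 + grad f.w) + o(h^2): the
    tangential step is a one-variable expansion with zero slope, and the step [h ^+ 2 *: w] goes
    through the mean value theorem. *)
Lemma curve_lt f z tau w (c : R) : Ck V 2 f -> V z -> dot (grad f z) tau = 0 ->
  dot (tau *m hess f z) tau / 2 + dot (grad f z) w < c ->
  exists2 d, 0 < d & forall h, 0 < h < d ->
    f (z + h *: tau + (h ^+ 2) *: w) < f z + c * h ^+ 2.
Proof.
move=> Cf Vz t0 hc; have Cf1 : Ck V 1 f by exact: Ck_le Cf.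
set A := dot (tau *m _) _ in hc; set B := dot (grad f z) w in hc.
pose e := (c - (A / 2 + B)) / 4.
have e0 : 0 < e by rewrite /e; lra.
have [d1 d10 d1P] := open_line tau oV Vz.
have D1 (h : R) : `|h| < d1 ->
    is_derive h 1 (fun h : R => f (z + h *: tau)) ('D_tau f (z + h *: tau)).
  move=> /d1P Vh; apply/line_is_derive/derivableP; exact: (Ck_derivable Cf1).
have D2 : is_derive (0 : R) 1 (fun h : R => 'D_tau f (z + h *: tau)) A.
  apply: (iffLR (@line_is_derive0 R N ('D_tau f) z tau A)).
  rewrite /A -derive2_hess//.
  exact/derivableP/(Ck_derivable (Ck_derive tau Cf)).
have [||d2 d20 d2P] := @right_second_order_lt _ _ _ A (A / 2 + e) _ d10 D1 D2.
- by rewrite scale0r addr0 derive_dot.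
- by move: e0; rewrite mulrDr mulrCA divff// mulr1; lra.
have [d3 d30 d3P] := derive_continuous w Cf1 Vz e0.
have [d4 d40 d4P] := open_ball oV Vz.
pose m := Num.min d3 d4; have m0 : 0 < m by rewrite lt_min d30.
pose M := `|tau| + `|w| + 1.
have M1 : 1 <= M by rewrite /M lerDr addr_ge0.
exists (Num.min (Num.min 1 d2) (m / M)).
  by rewrite !lt_min ltr01 d20 divr_gt0// (lt_le_trans _ M1).
move=> h /andP[h0]; rewrite !lt_min => /andP[/andP[h1 hd2]].
rewrite ltr_pdivlMr ?(lt_le_trans _ M1)// => hM.
have h20 : 0 < h ^+ 2 by rewrite exprn_gt0.
have h2h : h ^+ 2 <= h by rewrite expr2 ler_piMl// ltW.
have small k : 0 <= k <= h ^+ 2 -> `|z - (z + h *: tau + k *: w)| < m.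
  move=> /andP[k0 kh]; rewrite -!addrA opprD addrA subrr sub0r normrN.
  apply: le_lt_trans (ler_normD _ _) _; rewrite !normrZ (gtr0_norm h0) (ger0_norm k0).
  apply: le_lt_trans hM; rewrite /M !mulrDr mulr1.
  have := ler_wpM2r (normr_ge0 w) (le_trans kh h2h); move: h0; lra.
have [|k /andP[k0 kh]] := @line_mvt R N f (z + h *: tau) w _ h20.
  move=> k /small; rewrite lt_min => /andP[_ /d4P Vk].
  exact: (Ck_derivable Cf1).
have /small : 0 <= k <= h ^+ 2 by rewrite !ltW.
rewrite lt_min => /andP[/d3P H3 /d4P Vk]; rewrite derive_dot// => E1.
have := d2P h; rewrite h0 hd2 scale0r addr0 => /(_ isT) H2.
have H4 : dot (grad f (z + h *: tau + k *: w)) w < B + e.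
  by move: H3; rewrite ltr_norml -/B; lra.
have H5 : h ^+ 2 * dot (grad f (z + h *: tau + k *: w)) w < h ^+ 2 * (B + e).
  by rewrite ltr_pM2l.
rewrite -E1 in H5.
have -> : c * h ^+ 2 = (A / 2 + e) * h ^+ 2 + h ^+ 2 * (B + e) + 2 * e * h ^+ 2.
  by rewrite /e; field.
have H6 : 0 < 2 * e * h ^+ 2 by apply: mulr_gt0 => //; apply: mulr_gt0.
by move: H2 H5 H6; clearbody e A B; clear; lra.
Qed.

End OpenDomain.
End Gradient.

(** * Contact of level sets and the Hopf lemma *)

Section Curvature.
Context {R : realType} {N : nat}.
Local Notation E := 'rV[R]_N.
Implicit Types (f g : E -> R) (x y z v w G : E) (V : set E).

(** Trace of the Hessian on the hyperplane orthogonal to [G]. *)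
Definition tanlap f x G : R :=
  laplacian f x - dot (G *m hess f x) G / dot G G.

(** This is div (grad f / |grad f|), the sum of the principal curvatures of the level set of [f]. *)
Definition curv f x : R := tanlap f x (grad f x) / eucl (grad f x).

Lemma laplacian_hess f x : laplacian f x = \sum_i hess f x i i.
Proof. by apply: eq_bigr => i _; rewrite mxE. Qed.

Lemma evec_mul (H : 'M[R]_N) i j : (evec R i *m H) 0 j = H i j.
Proof. by rewrite /evec -rowE mxE. Qed.

Lemma dot_mulmx_sum (H : 'M[R]_N) v w (c : 'I_N -> R) :
  \sum_i c i * dot (evec R i *m H) w = dot ((\row_i c i) *m H) w.
Proof.
rewrite [\row_i c i]row_sum_evec mulmx_suml /dot.
under eq_bigr do rewrite mulr_sumr.
rewrite exchange_big/=; apply: eq_bigr => j _.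
rewrite summxE mulr_suml; apply: eq_bigr => i _.
by rewrite -scalemxAl !mxE mulrA.
Qed.

(** The vectors [t] are the projections of the axes onto the orthogonal complement of [G]. In this
    form two tangential traces can be compared vector by vector, without choosing a tangent
    frame. *)
Lemma tanlap_sum f x G : G != 0 ->
  tanlap f x G = \sum_i
    (let t := evec R i - (G 0 i / dot G G) *: G in dot (t *m hess f x) t).
Proof.
move=> G0; have GG : dot G G != 0 by rewrite gt_eqF// dot_gt0.
set H := hess f x.
have E1 i : (let t := evec R i - (G 0 i / dot G G) *: G in dot (t *m H) t) =
    H i i - (dot G G)^-1 * (G 0 i * dot (evec R i *m H) G)
    - (dot G G)^-1 * (G 0 i * (G *m H) 0 i)
    + (dot (G *m H) G / dot G G ^+ 2) * (G 0 i * G 0 i).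
  rewrite /= mulmxDl mulNmx -scalemxAl !dotE !dot_evec evec_mul; field.
  exact: GG.
under eq_bigr do rewrite E1.
rewrite !big_split/= !sumrN -!mulr_sumr dot_mulmx_sum//.
have -> : \row_i G 0 i = G by apply/rowP => i; rewrite mxE.
rewrite /tanlap laplacian_hess -/H -/(dot G G) -/(dot G (G *m H)) (dotC G (G *m H)).
by field.
Qed.

Lemma tanlapZ f x G (c : R) : c != 0 -> tanlap f x (c *: G) = tanlap f x G.
Proof.
move=> c0; rewrite /tanlap -scalemxAl !dotE; congr (_ - _).
have [->|GG] := eqVneq (dot G G) 0; first by rewrite !mulr0 invr0 !mulr0.
by field; rewrite ?c0 ?GG.
Qed.

(** Let [q] be the part of [g] orthogonal to [G]. The direction [q - del *: G] is admissible for
    every del > 0, and for small [del] its product with [g] would be positive unless [q = 0]. *)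
Lemma collinear_halfspace G (g : E) : G != 0 ->
  (forall w, dot G w < 0 -> dot g w <= 0) ->
  exists2 k : R, 0 <= k & g = k *: G.
Proof.
move=> G0 Hw; have GG := dot_gt0 G0.
pose k := dot g G / dot G G; pose q := g - k *: G.
have qE : q = g - k *: G by [].
clearbody q.
have Gq : dot G q = 0.
  by rewrite qE !dotE /k (dotC G g); field; rewrite gt_eqF.
have gq : dot g q = dot q q.
  have : dot q q = dot g q - k * dot G q by rewrite -dotZl -dotBl -qE.
  by rewrite Gq mulr0 subr0.
have q0 : q = 0.
  apply/eqP; apply/negPn/negP => /dot_gt0 qq.
  pose del := dot q q / (2 * (`|dot g G| + 1)).
  have n0 : 0 < `|dot g G| + 1 by rewrite ltr_wpDl.
  have del0 : 0 < del by rewrite divr_gt0// mulr_gt0.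
  have := Hw (q - del *: G); rewrite !dotE Gq gq add0r oppr_lt0 mulr_gt0//.
  move=> /(_ isT).
  have H1 : del * dot g G <= dot q q / 2.
    have -> : dot q q / 2 = del * (`|dot g G| + 1).
      by rewrite /del; field; rewrite gt_eqF.
    by rewrite ler_pM2l// (le_trans (ler_norm _))// lerDl.
  by move: H1 qq; clear; lra.
exists k; last by apply/eqP; rewrite -subr_eq0 -qE q0.
have := Hw (- G); rewrite !dotE oppr_lt0 GG => /(_ isT) H.
by apply: divr_ge0; [move: H; clear; lra|exact: ltW].
Qed.

Lemma curve_small z v w (d : R) : 0 < d -> exists2 d', 0 < d' &
  forall h, 0 < h < d' -> `|z - (z + h *: v + h ^+ 2 *: w)| < d.
Proof.
move=> d0; pose M := `|v| + `|w| + 1.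
have M1 : 1 <= M by rewrite /M lerDr addr_ge0.
exists (Num.min 1 (d / M)); first by rewrite lt_min ltr01 divr_gt0// (lt_le_trans _ M1).
move=> h /andP[h0]; rewrite lt_min => /andP[h1].
rewrite ltr_pdivlMr ?(lt_le_trans _ M1)// => hM.
rewrite -!addrA opprD addrA subrr sub0r normrN.
apply: le_lt_trans (ler_normD _ _) _; rewrite !normrZ !(gtr0_norm h0).
apply: le_lt_trans hM; rewrite /M !mulrDr mulr1.
have h2h : h ^+ 2 <= h by rewrite expr2 ler_piMl// ltW.
by have := ler_wpM2r (normr_ge0 w) h2h; move: h0; clear; lra.
Qed.

Section OpenDomain.
Variable V : set E.
Hypothesis oV : open V.

Lemma grad_lin f g (c : R) x : Ck V 1 f -> Ck V 1 g -> V x ->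
  grad (fun y => f y + c * g y) x = grad f x + c *: grad g x.
Proof.
move=> Cf Cg Vx; apply/rowP => i; rewrite !mxE.
have := derivableP (Ck_derivable (v := evec R i) Cf Vx).
have := derivableP (Ck_derivable (v := evec R i) Cg Vx) => ? ?.
by rewrite derive_val.
Qed.

Lemma hess_lin f g (c : R) x : Ck V 2 f -> Ck V 2 g -> V x ->
  hess (fun y => f y + c * g y) x = hess f x + c *: hess g x.
Proof.
move=> Cf Cg Vx; apply/matrixP => i j; rewrite !mxE.
have Cf1 : Ck V 1 f by exact: Ck_le Cf.
have Cg1 : Ck V 1 g by exact: Ck_le Cg.
have -> : 'D_(evec R j) ('D_(evec R i) (fun y => f y + c * g y)) x =
    'D_(evec R j) (fun y => 'D_(evec R i) f y + c * 'D_(evec R i) g y) x.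
  apply: near_eq_derive; apply: (near_open oV Vx) => y Vy.
  have := derivableP (Ck_derivable (v := evec R i) Cf1 Vy).
  have := derivableP (Ck_derivable (v := evec R i) Cg1 Vy) => ? ?.
  by rewrite derive_val.
have := derivableP (Ck_derivable (v := evec R j) (Ck_derive (evec R i) Cf) Vx).
have := derivableP (Ck_derivable (v := evec R j) (Ck_derive (evec R i) Cg) Vx) => ? ?.
by rewrite derive_val.
Qed.

Lemma hess_cst (c : R) x : hess (fun _ : E => c) x = 0.
Proof.
apply/matrixP => i j; rewrite !mxE.
have -> : 'D_(evec R i) (fun _ : E => c) = (fun=> 0).
  by apply/funext => y; rewrite derive_cst.
by rewrite derive_cst.
Qed.

Opaque hess.

Lemma tanlap_lin f g (c : R) x G : Ck V 2 f -> Ck V 2 g -> V x ->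
  tanlap (fun y => f y + c * g y) x G = tanlap f x G + c * tanlap g x G.
Proof.
move=> Cf Cg Vx; rewrite /tanlap !laplacian_hess hess_lin// mulmxDr -scalemxAr !dotE.
have E1 i : (hess f x + c *: hess g x) i i = hess f x i i + c * hess g x i i.
  by rewrite mxE; congr (_ + _); rewrite mxE.
under eq_bigr do rewrite E1.
by rewrite big_split/= -mulr_sumr mulrDl opprD addrACA mulrBr mulrA.
Qed.

Lemma curve_gt f z tau w : Ck V 2 f -> V z -> dot (grad f z) tau = 0 ->
  0 < dot (tau *m hess f z) tau / 2 + dot (grad f z) w ->
  exists2 d, 0 < d & forall h, 0 < h < d ->
    f z < f (z + h *: tau + (h ^+ 2) *: w).
Proof.
move=> Cf Vz t0 H.
have C0 n : Ck V n (fun=> 0) by exact: Ck_cst.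
pose g x := (fun=> 0) x + (-1) * f x.
have Cf1 : Ck V 1 f by exact: Ck_le Cf.
have g0 : grad (fun _ : E => 0 : R) z = 0.
  by apply/rowP => i; rewrite !mxE derive_cst.
have h0 : hess (fun _ : E => 0 : R) z = 0 by exact: hess_cst.
have gg : grad g z = - grad f z.
  by rewrite (grad_lin (-1) (C0 1) Cf1 Vz) g0 add0r scaleN1r.
have hg : hess g z = - hess f z.
  by rewrite (hess_lin (-1) (C0 2) Cf Vz) h0 add0r scaleN1r.
have [|||d d0 dP] := @curve_lt _ _ _ oV g z tau w 0 _ Vz.
- exact: (CkD oV (C0 2) (CkZ oV (-1) Cf)).
- by rewrite gg dotNl t0 oppr0.
- by rewrite gg hg mulmxN !dotNl; move: H; clear; lra.
exists d => // h /dP; rewrite /g !add0r !mul0r addr0 !mulN1r.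
by rewrite ltrN2.
Qed.

Lemma ray_gt f z w : Ck V 1 f -> V z -> 0 < dot (grad f z) w ->
  exists2 d, 0 < d & forall h, 0 < h < d -> f z < f (z + h *: w).
Proof.
move=> Cf Vz wc.
pose g x := (fun=> 0) x + (-1) * f x.
have C0 n : Ck V n (fun=> 0) by exact: Ck_cst.
have g0 : grad (fun _ : E => 0 : R) z = 0.
  by apply/rowP => i; rewrite !mxE derive_cst.
have gg : grad g z = - grad f z.
  by rewrite (grad_lin (-1) (C0 1) Cf Vz) g0 add0r scaleN1r.
have [||d d0 dP] := @ray_lt _ _ _ oV g z w 0 _ Vz.
- exact: (CkD oV (C0 1) (CkZ oV (-1) Cf)).
- by rewrite gg dotNl oppr_lt0.
exists d => // h /dP; rewrite /g !add0r !mul0r addr0 !mulN1r.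
by rewrite ltrN2.
Qed.

(** A direction that decreases [f1] and increases [f2] would contradict maximality at [z], so
    [collinear_halfspace] provides the Lagrange multiplier. *)
Lemma contact_grad f1 f2 z : Ck V 1 f1 -> Ck V 1 f2 -> V z -> f1 z <= 0 ->
  (exists2 d, 0 < d & forall y, `|z - y| < d -> f1 y <= 0 -> f2 y <= f2 z) ->
  grad f1 z != 0 -> grad f2 z != 0 ->
  exists2 k, 0 < k & grad f2 z = k *: grad f1 z.
Proof.
move=> C1 C2 Vz f1z [d d0 dP] g1 g2.
have [w w1|k k0 Ek] := @collinear_halfspace _ (grad f2 z) g1.
  rewrite leNgt; apply/negP => w2.
  have [d1 d10 d1P] := ray_lt oV C1 Vz w1.
  have [d2 d20 d2P] := ray_gt C2 Vz w2.
  have [d3 d30 d3P] := @curve_small z w 0 d d0.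
  pose m := Num.min (Num.min d1 d2) d3.
  have m0 : 0 < m by rewrite !lt_min d10 d20 d30.
  have [h0] := half_gt0_lt m0.
  rewrite {2}/m !lt_min => /andP[/andP[h1 h2] h3].
  have := d1P (m / 2); rewrite h0 h1 mul0r addr0 => /(_ isT) A.
  have := d2P (m / 2); rewrite h0 h2 => /(_ isT).
  have := d3P (m / 2); rewrite h0 h3 scaler0 addr0 => /(_ isT) B.
  by rewrite ltNge (dP _ B)// (le_trans (ltW A)).
exists k => //; rewrite lt_neqAle k0 andbT eq_sym.
by apply: contra_neq g2 => k00; rewrite Ek k00 scale0r.
Qed.

(* Compare along curves tangent to the level set of f1. *)
Lemma contact_tanlap f1 f2 z k : Ck V 2 f1 -> Ck V 2 f2 -> V z -> f1 z <= 0 ->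
  (exists2 d, 0 < d & forall y, `|z - y| < d -> f1 y <= 0 -> f2 y <= f2 z) ->
  grad f1 z != 0 -> 0 < k -> grad f2 z = k *: grad f1 z ->
  tanlap f2 z (grad f1 z) <= k * tanlap f1 z (grad f1 z).
Proof.
move=> C1 C2 Vz f1z [d d0 dP] g1 k0 Ek.
set G := grad f1 z in g1 Ek *; have GG := dot_gt0 g1.
suff main tau (q1 q2 : R) : dot G tau = 0 -> q1 = dot (tau *m hess f1 z) tau ->
    q2 = dot (tau *m hess f2 z) tau -> q2 <= k * q1.
  rewrite !tanlap_sum// mulr_sumr; apply: ler_sum => i _; apply: main => //.
  by rewrite !dotE dot_evec; field; rewrite gt_eqF.
move=> Gt e1 e2.
rewrite leNgt; apply/negP => qq.
pose del := (q2 - k * q1) / (4 * k).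
have del0 : 0 < del by rewrite divr_gt0 ?mulr_gt0// subr_gt0.
(* With this bend the second-order coefficient along the parabola is [- del] for [f1] and
   [(q2 - k * q1) / 4], which is positive, for [f2]. *)
pose w := - ((q1 / 2 + del) / dot G G) *: G.
have Gw : dot G w = - (q1 / 2 + del).
  by rewrite /w dotZr; field; rewrite gt_eqF.
have [||d1 d10 d1P] := @curve_lt _ _ _ oV f1 z tau w 0 C1 Vz.
- exact: Gt.
- by rewrite -e1 -/G Gw; move: del0; clear; lra.
have [||d2 d20 d2P] := @curve_gt f2 z tau w C2 Vz.
- by rewrite Ek dotZl Gt mulr0.
- rewrite -e2 Ek dotZl Gw.
  have E2 : k * del = (q2 - k * q1) / 4 by rewrite /del; field; rewrite gt_eqF.
  by rewrite mulrN mulrDr E2; move: qq; clear; lra.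
have [d3 d30 d3P] := @curve_small z tau w d d0.
pose m := Num.min (Num.min d1 d2) d3.
have m0 : 0 < m by rewrite !lt_min d10 d20 d30.
have [h0] := half_gt0_lt m0.
rewrite {2}/m !lt_min => /andP[/andP[h1 h2] h3].
have := d1P (m / 2); rewrite h0 h1 mul0r addr0 => /(_ isT) A.
have := d2P (m / 2); rewrite h0 h2 => /(_ isT).
have := d3P (m / 2); rewrite h0 h3 => /(_ isT) B.
by rewrite ltNge (dP _ B)// (le_trans (ltW A)).
Qed.

End OpenDomain.
End Curvature.

(** * The Gaussian barrier and regularity of the curvature *)

Section Barrier.
Context {R : realType} {N : nat}.
Local Notation E := 'rV[R]_N.
Implicit Types (f g : E -> R) (x y z v w G : E) (V : set E).

Definition sqdist y x : R := dot (x - y) (x - y).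

Lemma is_derive_sqdist y x v : is_derive x v (sqdist y) (2 * dot (x - y) v).
Proof.
apply/line_is_derive0.
have -> : (fun k : R => sqdist y (x + k *: v)) = (fun k => sqdist y x +
    (2 * dot (x - y) v) * k + dot v v * k ^+ 2).
  apply/funext => k; rewrite /sqdist addrAC; move: (x - y) => d.
  by rewrite !dotE (dotC v d); ring.
by apply: is_derive_eq; rewrite /GRing.scale/=; ring.
Qed.

Lemma Ck_dot V n w : open V -> Ck V n (fun x => dot x w).
Proof.
move=> oV; apply: (Ck_sum oV) => i; apply: (CkM oV); first exact: Ck_coord.
exact: Ck_cst.
Qed.

Lemma Ck_sqdist V n y : open V -> Ck V n (sqdist y).
Proof.
move=> oV; have C i : Ck V n (fun x => (x - y) 0 i).
  have -> : (fun x => (x - y) 0 i) = (fun x => x 0 i - y 0 i).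
    by apply/funext => x; rewrite !mxE.
  by apply: (CkB oV); [exact: Ck_coord|exact: Ck_cst].
by apply: (Ck_sum oV) => i; exact: (CkM oV).
Qed.

Definition gauss (a : R) y x : R := expR (- a * sqdist y x).

Lemma Ck_gauss V n a y : open V -> Ck V n (gauss a y).
Proof. by move=> oV; apply/(Ck_expR oV)/(CkZ oV)/Ck_sqdist. Qed.

Lemma is_derive_gauss a y x v :
  is_derive x v (gauss a y) (- (2 * a) * gauss a y x * dot (x - y) v).
Proof.
have D1 := is_derive_sqdist y x v.
have D2 : is_derive x v (fun x => - a * sqdist y x) (- a * (2 * dot (x - y) v)).
  by apply: is_derive_eq; rewrite /GRing.scale/=; ring.
apply: is_derive_eq (is_derive_comp1 (is_derive_expR _) D2) _.
by rewrite /gauss; ring.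
Qed.

Lemma grad_gauss a y x : grad (gauss a y) x = (- (2 * a) * gauss a y x) *: (x - y).
Proof.
apply/rowP => i; rewrite !mxE.
by have [_ ->] := is_derive_gauss a y x (evec R i); rewrite dot_evec !mxE.
Qed.

Lemma derive2_gauss a y x v : 'D_v ('D_v (gauss a y)) x =
  gauss a y x * (4 * a ^+ 2 * dot (x - y) v ^+ 2 - 2 * a * dot v v).
Proof.
have -> : 'D_v (gauss a y) = (fun x => (- (2 * a) * gauss a y x) * dot (x - y) v).
  by apply/funext => z; have [_ ->] := is_derive_gauss a y z v.
have D1 := is_derive_gauss a y x v.
have D3 : is_derive x v (fun x => dot (x - y) v) (dot v v).
  apply/line_is_derive0.
  have -> : (fun k : R => dot (x + k *: v - y) v) = (fun k => dot (x - y) v + k * dot v v).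
    by apply/funext => k; rewrite !dotE; ring.
  by apply: is_derive_eq; rewrite /GRing.scale/=; ring.
have D2 : is_derive x v (fun x => - (2 * a) * gauss a y x)
    (- (2 * a) * (- (2 * a) * gauss a y x * dot (x - y) v)).
  by apply: is_derive_eq; rewrite /GRing.scale/=; ring.
have D := is_deriveM D2 D3.
by have [_ ->] := D; rewrite /GRing.scale/=; ring.
Qed.

(** The factor of [4 * a ^+ 2] is the squared length of the part of [x - y] orthogonal to [G]. Once
    it is bounded below, the term quadratic in [a] beats the linear one for large [a]. *)
Lemma tanlap_gauss a y x G : tanlap (gauss a y) x G =
  gauss a y x * (4 * a ^+ 2 * (dot (x - y) (x - y) - dot (x - y) G ^+ 2 / dot G G)
   - 2 * a * (N%:R - dot G G / dot G G)).
Proof.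
rewrite /tanlap -(derive2_hess openT G (Ck_gauss 2 a y openT) I) derive2_gauss.
rewrite /laplacian.
under eq_bigr do rewrite derive2_gauss !dot_evec.
rewrite -mulr_sumr sumrB -!mulr_sumr.
have -> : \sum_(i < N) (x - y) 0 i ^+ 2 = dot (x - y) (x - y).
  by apply: eq_bigr => i _; rewrite expr2.
have -> : \sum_(i < N) (evec R i) 0 i = N%:R.
  rewrite -[RHS]mulr_natr mul1r -[in RHS](card_ord N) -sumr_const.
  by apply: eq_bigr => i _; rewrite /evec mxE !eqxx.
ring.
Qed.

Definition normcoef G : R := rsqrt (dot G G).

Lemma normcoefE G : normcoef G = (eucl G)^-1.
Proof. by rewrite /normcoef /rsqrt euclE. Qed.

(** Second derivatives of [f] are separated from functions of [G] alone that are smooth away from 0;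
    both the regularity of [curv] and the Lipschitz bound in [G] start from this form. *)
Lemma tanlap_normcoef f x G : G != 0 -> tanlap f x G / eucl G =
  laplacian f x * normcoef G -
  \sum_i \sum_j hess f x i j * (G 0 i * G 0 j * normcoef G ^+ 3).
Proof.
move=> G0; rewrite /tanlap mulrBl -normcoefE; congr (_ - _).
have -> : dot (G *m hess f x) G = \sum_i \sum_j hess f x i j * (G 0 i * G 0 j).
  rewrite /dot; under eq_bigr do rewrite mxE mulr_suml.
  rewrite exchange_big/=; apply: eq_bigr => i _; apply: eq_bigr => j _; ring.
have -> : (dot G G)^-1 = normcoef G ^+ 2 by rewrite normcoefE -eucl_sqr exprVn.
rewrite -mulrA -exprSr mulr_suml; apply: eq_bigr => i _.
by rewrite mulr_suml; apply: eq_bigr => j _; ring.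
Qed.

Lemma open_neq0 : open [set G : E | G != 0].
Proof.
apply: open_normP => x /= x0; exists `|x|; first by rewrite normr_gt0.
by move=> y xy; apply: contraTneq xy => ->; rewrite subr0 ltxx.
Qed.

Lemma Ck_normcoef n : Ck [set G : E | G != 0] n normcoef.
Proof.
apply: (Ck_rsqrt open_neq0); first by move=> x /= /dot_gt0.
have -> : (fun x : E => dot x x) = sqdist 0.
  by apply/funext => x; rewrite /sqdist subr0.
exact/Ck_sqdist/open_neq0.
Qed.

Lemma grad_neq0_open f : Ck setT 1 f -> open [set x | grad f x != 0].
Proof.
move=> Cf; apply: open_normP => x /= gx.
have H (i : 'I_N) : exists2 d, 0 < d & forall y, `|x - y| < d ->
    `|grad f y 0 i - grad f x 0 i| < `|grad f x|.
  have g0 : 0 < `|grad f x| by rewrite normr_gt0.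
  have [d d0 dP] := derive_continuous openT (evec R i) Cf (I : setT x) g0.
  by exists d => // y /dP; rewrite !dot_evec distrC.
have [d d0 dP] := near_forall_fin H.
exists d => // y /dP yP; apply/eqP => gy0.
have [/eqP|/mx_norm_neq0[[i j] E1]] := boolP (mx_norm (grad f x) == 0).
  by move/mx_norm_eq0 => gx0; move: gx; rewrite gx0 eqxx.
have := yP j; rewrite gy0 mxE sub0r normrN.
have -> : `|grad f x| = `|grad f x i j| by exact: E1.
by rewrite (ord1 i) ltxx.
Qed.

Lemma hessE f x i j : hess f x i j = 'D_(evec R j) ('D_(evec R i) f) x.
Proof. Transparent hess. by rewrite /hess mxE. Opaque hess. Qed.

Lemma Ck_hess V n f i j : Ck V n.+2 f -> Ck V n (fun x => hess f x i j).
Proof.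
move=> Cf; have -> : (fun x => hess f x i j) = 'D_(evec R j) ('D_(evec R i) f).
  by apply/funext => x; rewrite hessE.
exact/Ck_derive/Ck_derive.
Qed.

Lemma Ck_grad V n f i : Ck V n.+1 f -> Ck V n (fun x => grad f x 0 i).
Proof.
move=> Cf; have -> : (fun x => grad f x 0 i) = 'D_(evec R i) f.
  by apply/funext => x; rewrite mxE.
exact/Ck_derive.
Qed.

Lemma Ck_laplacian V n f : open V -> Ck V n.+2 f -> Ck V n (laplacian f).
Proof.
by move=> oV Cf; apply: (Ck_sum oV) => i; exact/Ck_derive/Ck_derive.
Qed.

Lemma Ck_dotgrad V n f g : open V -> Ck V n.+1 f -> Ck V n.+1 g ->
  Ck V n (fun x => dot (grad f x) (grad g x)).
Proof.
by move=> oV Cf Cg; apply: (Ck_sum oV) => i; apply: (CkM oV); exact: Ck_grad.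
Qed.

Lemma Ck_curv n f : Ck setT n.+2 f -> Ck [set x | grad f x != 0] n (curv f).
Proof.
move=> Cf; set V := [set x | _].
have oV : open V by apply: grad_neq0_open; exact: Ck_le Cf.
have CV m : (m <= n.+2)%N -> Ck V m f.
  by move=> mn; apply: (@Ck_sub _ _ setT) => //; exact: Ck_le Cf.
have Cn : Ck V n (fun x => normcoef (grad f x)).
  apply: (Ck_rsqrt oV); first by move=> x /= /dot_gt0.
  by apply: (Ck_dotgrad oV); apply: CV.
have : Ck V n (fun x => laplacian f x * normcoef (grad f x) -
  \sum_i \sum_j hess f x i j * (grad f x 0 i * grad f x 0 j *
    (normcoef (grad f x) * (normcoef (grad f x) * normcoef (grad f x))))).
  apply: (CkB oV).
    by apply: (CkM oV) => //; apply: Ck_laplacian => //; exact: CV.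
  apply: (Ck_sum oV) => i; apply: (Ck_sum oV) => j.
  apply: (CkM oV); first exact/Ck_hess/CV.
  by do ?[apply: (CkM oV) => //]; apply: Ck_grad; exact: CV.
apply: (Ck_eq oV) => x Vx; rewrite /curv tanlap_normcoef//; congr (_ - _).
Qed.

End Barrier.

(** * Uniform bounds near a contact point *)

Section HopfPrep.
Context {R : realType} {N : nat}.
Local Notation E := 'rV[R]_N.
Implicit Types (f g : E -> R) (x y z v w G : E) (V : set E).

Lemma norm_near (V : normedZmodType R) (a b : V) (e : R) :
  `|a - b| < e -> `|b| <= `|a| + e.
Proof.
move=> ab; have := ler_normB a (a - b); rewrite opprB addrC subrK.
by move=> /le_trans; apply; rewrite lerD2l ltW.
Qed.

Lemma common_bounds (I : finType) (P : I -> R -> R -> Prop) :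
  (forall i, exists2 d, 0 < d & exists2 L, 0 <= L & P i d L) ->
  (forall i d L d' L', P i d L -> d' <= d -> L <= L' -> P i d' L') ->
  exists2 d, 0 < d & exists2 L, 0 <= L & forall i, P i d L.
Proof.
move=> H Pmon.
have H' i : exists dL : R * R, [/\ 0 < dL.1, 0 <= dL.2 & P i dL.1 dL.2].
  by have [d d0 [L L0 PL]] := H i; exists (d, L).
have [F FP] := choice H'.
exists (\big[Num.min/1]_i (F i).1).
  by apply: (big_ind (fun x : R => 0 < x)) => // [x y x0 y0|i _]; [rewrite lt_min x0|have [] := FP i].
exists (\sum_i (F i).2); first by apply: sumr_ge0 => i _; have [] := FP i.
move=> i; have [_ _ PF] := FP i; apply: Pmon PF _ _.
  exact: bigmin_le_cond.
rewrite (bigD1 i)//= lerDl sumr_ge0// => j _; have [] := FP j => //.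
Qed.

Lemma dot_near a b (e : R) : 0 < e -> exists2 d, 0 < d & forall a' b' : E,
  `|a - a'| < d -> `|b - b'| < d -> `|dot a b - dot a' b'| < e.
Proof.
move=> e0; pose M := N%:R * (`|a| + `|b| + 1) + 1.
have M0 : 0 < M by rewrite ltr_wpDl// mulr_ge0// !addr_ge0.
exists (Num.min 1 (e / M)); first by rewrite lt_min ltr01 divr_gt0.
move=> a' b'; rewrite !lt_min => /andP[a1 aM] /andP[b1 bM].
have -> : dot a b - dot a' b' = dot (a - a') b + dot a' (b - b').
  by rewrite !dotE; ring.
have na : `|a'| <= `|a| + 1.
  exact: norm_near a1.
apply: le_lt_trans (ler_normD _ _) _.
apply: (@le_lt_trans _ _ (N%:R * (e / M * `|b|) + N%:R * ((`|a| + 1) * (e / M)))).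
  apply: lerD; apply: le_trans (dot_le_norm _ _) _; apply: ler_wpM2l => //.
    by apply: ler_wpM2r => //; exact: ltW.
  by apply: ler_pM => //; exact: ltW.
have -> : N%:R * (e / M * `|b|) + N%:R * ((`|a| + 1) * (e / M)) = (e / M) * (M - 1).
  by rewrite /M; ring.
have -> : e / M * (M - 1) = e - e / M by field; rewrite gt_eqF.
by rewrite ltrBlDr ltrDl divr_gt0.
Qed.

(** The expression is [dot G G] times the squared length of the part of [x] orthogonal to [G]. *)
Lemma gram_gt0 x G : G != 0 -> (forall c : R, x != c *: G) ->
  0 < dot x x * dot G G - dot x G ^+ 2.
Proof.
move=> G0 xG; have GG := dot_gt0 G0.
have : 0 < dot (x - (dot x G / dot G G) *: G) (x - (dot x G / dot G G) *: G).
  by apply: dot_gt0; rewrite subr_eq0.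
rewrite !dotE (dotC G x) => H.
have -> : dot x x * dot G G - dot x G ^+ 2 = dot G G * (dot x x +
   - (dot x G / dot G G * dot x G) + - (dot x G / dot G G * (dot x G +
   - (dot x G / dot G G * dot G G)))).
  by field; rewrite gt_eqF.
rewrite mulr_gt0//; apply: lt_le_trans H _; rewrite le_eqVlt; apply/orP; left.
by apply/eqP; field; rewrite gt_eqF.
Qed.

Lemma gram_near x G : G != 0 -> (forall c : R, x != c *: G) ->
  exists2 d, 0 < d & exists2 c, 0 < c & forall x' G',
    `|x - x'| < d -> `|G - G'| < d ->
    c <= dot x' x' * dot G' G' - dot x' G' ^+ 2.
Proof.
move=> G0 xG; have := gram_gt0 G0 xG.
set A := dot x x; set B := dot G G; set C := dot x G => p0.
set p := A * B - C ^+ 2 in p0.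
pose M := `|A| + `|B| + 2 * `|C| + 2.
have M0 : 0 < M by rewrite /M ltr_wpDl// !addr_ge0// mulr_ge0.
pose e := Num.min 1 (p / (2 * M)).
have e0 : 0 < e by rewrite lt_min ltr01 divr_gt0// mulr_gt0.
have e1 : e <= 1 by rewrite ge_min lexx.
have eM : e * M <= p / 2.
  have : e <= p / (2 * M) by rewrite ge_min lexx orbT.
  rewrite -(ler_pM2r M0) => /le_trans; apply.
  by have -> : p / (2 * M) * M = p / 2 by field; rewrite gt_eqF.
have [d1 d10 d1P] := dot_near x x e0.
have [d2 d20 d2P] := dot_near G G e0.
have [d3 d30 d3P] := dot_near x G e0.
exists (Num.min (Num.min d1 d2) d3); first by rewrite !lt_min d10 d20 d30.
exists (p / 2); first by rewrite divr_gt0.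
move=> x' G'; rewrite !lt_min => /andP[/andP[x1 x2] x3] /andP[/andP[g1 g2] g3].
have := d1P _ _ x1 x1; have := d2P _ _ g2 g2; have := d3P _ _ x3 g3.
rewrite -/A -/B -/C.
move: (dot x' x') (dot G' G') (dot x' G') => A' B' C' hC hB hA.
have E1 : A' * B' - C' ^+ 2 = p - (A - A') * B' - A * (B - B') + (C - C') * (C + C').
  by rewrite /p; ring.
have nB : `|B'| <= `|B| + 1.
  by apply: le_trans (norm_near hB) _; rewrite lerD2l.
have nC : `|C + C'| <= 2 * `|C| + 1.
  have := ler_normB (C + C) (C - C').
  have -> : C + C - (C - C') = C + C' by ring.
  by have := ler_normD C C; move: hC e1; clear; lra.
have b1 : (A - A') * B' <= e * (`|B| + 1).
  apply: le_trans (ler_norm _) _; rewrite normrM.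
  by apply: ler_pM => //; exact: ltW.
have b2 : A * (B - B') <= `|A| * e.
  apply: le_trans (ler_norm _) _; rewrite normrM.
  by apply: ler_pM => //; exact: ltW.
have b3 : - (e * (2 * `|C| + 1)) <= (C - C') * (C + C').
  rewrite lerNl; apply: le_trans (ler_norm _) _; rewrite normrN normrM.
  by apply: ler_pM => //; exact: ltW.
rewrite E1; move: b1 b2 b3 eM; rewrite /M; clearbody p e A B C; clear; lra.
Qed.

Lemma grad_near f x (e : R) : Ck setT 1 f -> 0 < e ->
  exists2 d, 0 < d & forall y, `|x - y| < d -> `|grad f x - grad f y| < e.
Proof.
move=> Cf e0; have e20 : 0 < e / 2 by rewrite divr_gt0.
have H (i : 'I_N) : exists2 d, 0 < d & forall y, `|x - y| < d ->
    `|grad f x 0 i - grad f y 0 i| < e / 2.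
  have [d d0 dP] := derive_continuous openT (evec R i) Cf (I : setT x) e20.
  by exists d => // y /dP; rewrite !dot_evec.
have [d d0 dP] := near_forall_fin H.
exists d => // y /dP yP; have [_] := half_gt0_lt e0; apply: le_lt_trans.
apply: norm_le_coord => [|i]; first exact: ltW.
by rewrite !mxE; apply/ltW; have := yP i; rewrite !mxE.
Qed.

(** The functions of [G] in [tanlap_normcoef] are C^1 near [G], and the second derivatives of [f]
    are bounded near [x]. This permits replacing [grad f] by the gradient of a perturbation. *)
Lemma tanlap_lipschitz f x G : Ck setT 2 f -> G != 0 ->
  exists2 d, 0 < d & exists2 L, 0 <= L & forall z G1 G2,
    `|x - z| < d -> `|G - G1| < d -> `|G - G2| < d ->
    `|tanlap f z G1 / eucl G1 - tanlap f z G2 / eucl G2| <= L * `|G1 - G2|.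
Proof.
move=> Cf G0; pose V := [set G : E | G != 0].
have oV : open V by exact: open_neq0.
have [d1 d10 d1P] := open_ball oV (G0 : V G).
have [d2 d20 [L2 L20 L2P]] := Ck_lipschitz oV (Ck_normcoef 1) (G0 : V G).
have H (ij : 'I_N * 'I_N) : exists2 d, 0 < d & exists2 L, 0 <= L &
    forall G1 G2, `|G - G1| < d -> `|G - G2| < d ->
    `|G1 0 ij.1 * G1 0 ij.2 * normcoef G1 ^+ 3
      - G2 0 ij.1 * G2 0 ij.2 * normcoef G2 ^+ 3| <= L * `|G1 - G2|.
  apply: (@Ck_lipschitz _ _ _ oV (fun G => G 0 ij.1 * G 0 ij.2 * normcoef G ^+ 3)) => //.
  have : Ck V 1 (fun G => G 0 ij.1 * G 0 ij.2 * (normcoef G * (normcoef G * normcoef G))).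
    have C1 := Ck_normcoef 1 : Ck V 1 _.
    exact: (CkM oV (CkM oV (Ck_coord oV 1 ij.1) (Ck_coord oV 1 ij.2))
      (CkM oV C1 (CkM oV C1 C1))).
  by apply: (Ck_eq oV) => z _; rewrite !exprS expr0 mulr1.
have [|d3 d30 [L3 L30 L3P]] := common_bounds H.
  move=> ij d L d' L' HdL dd LL G1 G2 h1 h2.
  apply: le_trans (HdL _ _ (lt_le_trans h1 dd) (lt_le_trans h2 dd)) _.
  exact: ler_wpM2r.
have Hh (ij : 'I_N * 'I_N) : exists2 d, 0 < d & forall z, `|x - z| < d ->
    `|hess f z ij.1 ij.2| <= `|hess f x ij.1 ij.2| + 1.
  have Ch : Ck setT 0 (fun z => hess f z ij.1 ij.2) by exact: Ck_hess.
  have /continuous_atP/(_ _ ltr01)[d d0 dP] := Ck_continuous Ch (I : setT x).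
  by exists d => // z /dP/norm_near.
have [d4 d40 d4P] := near_forall_fin Hh.
have Cl : Ck setT 0 (laplacian f) by apply: Ck_laplacian => //; exact: openT.
have /continuous_atP/(_ _ ltr01)[d5 d50 d5P] := Ck_continuous Cl (I : setT x).
exists (Num.min (Num.min d1 d2) (Num.min d3 (Num.min d4 d5))).
  by rewrite !lt_min d10 d20 d30 d40 d50.
exists ((`|laplacian f x| + 1) * L2 +
   \sum_(ij : 'I_N * 'I_N) (`|hess f x ij.1 ij.2| + 1) * L3).
  rewrite addr_ge0// ?mulr_ge0 ?addr_ge0//; apply: sumr_ge0 => ij _.
  by rewrite mulr_ge0// addr_ge0.
move=> z G1 G2; rewrite !lt_min.
move=> /andP[_ /and3P[_ /d4P zh /d5P zl]].
move=> /andP[/andP[a1 a2] /and3P[a3 _ _]] /andP[/andP[b1 b2] /and3P[b3 _ _]].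
rewrite !tanlap_normcoef; [|exact: d1P|exact: d1P].
rewrite !pair_bigA /=.
have -> : laplacian f z * normcoef G1 -
    \sum_p hess f z p.1 p.2 * (G1 0 p.1 * G1 0 p.2 * normcoef G1 ^+ 3) -
  (laplacian f z * normcoef G2 -
    \sum_p hess f z p.1 p.2 * (G2 0 p.1 * G2 0 p.2 * normcoef G2 ^+ 3)) =
  laplacian f z * (normcoef G1 - normcoef G2) -
  \sum_p hess f z p.1 p.2 * (G1 0 p.1 * G1 0 p.2 * normcoef G1 ^+ 3 -
    G2 0 p.1 * G2 0 p.2 * normcoef G2 ^+ 3).
  under [X in _ = _ - X]eq_bigr do rewrite mulrBr.
  rewrite sumrB mulrBr !opprD !opprK.
  move: (\sum_p _) (\sum_p _) => S1 S2; ring.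
apply: le_trans (ler_normB _ _) _; rewrite [leRHS]mulrDl [in leRHS]mulr_suml; apply: lerD.
  by rewrite normrM -mulrA; apply: ler_pM => //; [exact: norm_near zl|exact: L2P].
apply: le_trans (ler_norm_sum _ _ _) _; apply: ler_sum => ij _.
by rewrite normrM -[leRHS]mulrA; apply: ler_pM => //; exact: L3P.
Qed.

End HopfPrep.

(** * The Hopf lemma for two level sets of the same constant curvature *)

Section Hopf.
Context {R : realType} {N : nat}.
Local Notation E := 'rV[R]_N.
Implicit Types (f g : E -> R) (x y z v w G : E) (V : set E).

Lemma sqdist_ge0 y x : 0 <= sqdist y x.
Proof. exact: dot_ge0. Qed.

(** The exponential is 1-Lipschitz on nonpositive arguments. The bound turns an excess of the
    Gaussian over its value on the sphere into room inside the ball. *)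
Lemma gauss_drop (a : R) y x (D : R) : 0 < a -> sqdist y x <= D ->
  gauss a y x - expR (- a * D) <= a * (D - sqdist y x).
Proof.
move=> a0 qD; set q := sqdist y x in qD *; rewrite /gauss -/q.
have -> : expR (- a * D) = expR (- a * q) * expR (- (a * (D - q))).
  by rewrite -expRD; congr expR; ring.
have E1 : expR (- a * q) <= 1.
  by rewrite expR_le1 mulNr oppr_le0; apply: mulr_ge0; [exact: ltW|exact: sqdist_ge0].
have E2 : 1 - expR (- (a * (D - q))) <= a * (D - q).
  have := expR_ge1Dx (- (a * (D - q))); lra.
have E3 : 0 <= 1 - expR (- (a * (D - q))).
  by rewrite subr_ge0 expR_le1 oppr_le0 mulr_ge0 ?subr_ge0// ltW.
have : expR (- a * q) * (1 - expR (- (a * (D - q)))) <= 1 * (a * (D - q)).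
  by apply: ler_pM => //; exact: expR_ge0.
by rewrite mul1r mulrBr mulr1.
Qed.

Lemma gauss_le1 (a : R) y x : 0 < a -> gauss a y x <= 1.
Proof.
move=> a0; rewrite expR_le1 mulNr oppr_le0.
by apply: mulr_ge0; [exact: ltW|exact: sqdist_ge0].
Qed.

Lemma descent_zero f x w (t : R) : Ck setT 1 f -> 0 < t ->
  0 <= f x -> f (x + t *: w) <= 0 ->
  exists2 s, 0 <= s <= t & f (x + s *: w) = 0.
Proof.
move=> Cf t0 fx ft.
have cf : {within `[0, t], continuous (fun s : R => f (x + s *: w))}.
  apply: derivable_within_continuous => s _.
  have /line_is_derive[] := derivableP (Ck_derivable (v := w) Cf (I : setT (x + s *: w))).
  by [].
have [|s st fs] := @IVT R (fun s => f (x + s *: w)) 0 t 0 (ltW t0) cf.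
  by rewrite scale0r addr0 ge_min ft orbT le_max fx.
by exists s => //; move: st; rewrite in_itv.
Qed.

Lemma shift_norm x0 x w (s t r : R) : `|x0 - x| < r -> 0 <= s <= t ->
  t * `|w| <= r -> `|x0 - (x + s *: w)| < 2 * r.
Proof.
move=> xr /andP[s0 st] tr; rewrite opprD addrA.
apply: le_lt_trans (ler_normB _ _) _; rewrite normrZ ger0_norm//.
have := ler_wpM2r (normr_ge0 w) st; move: xr tr; clear; lra.
Qed.

Lemma grad_cst (c : R) x : grad (fun=> c) x = 0.
Proof. by apply/rowP => i; rewrite !mxE derive_cst. Qed.

Lemma tanlap_cst (c : R) x G : tanlap (fun=> c) x G = 0.
Proof.
rewrite /tanlap laplacian_hess hess_cst mulmx0 dot0l mul0r subr0.
by rewrite big1// => i _; rewrite mxE.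
Qed.


Section Perturbation.
Variables (f : E -> R) (y : E) (a c eps : R).
Hypothesis Cf : Ck setT 2 f.

(** The constant stays a separate summand so that linearity of [grad] and [tanlap] applies twice. In
    use [c] is the value of the Gaussian on a sphere around [y], so the perturbation vanishes
    there. *)
Definition perturb x : R := (f x + - eps * gauss a y x) + eps * (fun=> c) x.

Lemma perturbE x : perturb x = f x - eps * (gauss a y x - c).
Proof. by rewrite /perturb; ring. Qed.

Let Cg : Ck setT 2 (gauss a y) := Ck_gauss 2 a y openT.
Let Cfg : Ck setT 2 (fun x => f x + - eps * gauss a y x) :=
  CkD openT Cf (CkZ openT (- eps) Cg).
Let Cc : Ck setT 2 (fun _ : E => c) := Ck_cst openT 2 c.

Lemma Ck_perturb : Ck setT 2 perturb.
Proof. exact: (CkD openT Cfg (CkZ openT eps Cc)). Qed.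

Lemma grad_perturb x : grad perturb x = grad f x - eps *: grad (gauss a y) x.
Proof.
have W : (1 <= 2)%N by [].
have E1 : grad perturb x = grad (fun x => f x + - eps * gauss a y x) x +
    eps *: grad (fun _ : E => c) x := grad_lin eps (Ck_le W Cfg) (Ck_le W Cc) I.
have E2 : grad (fun x => f x + - eps * gauss a y x) x =
    grad f x + (- eps) *: grad (gauss a y) x :=
  grad_lin (- eps) (Ck_le W Cf) (Ck_le W Cg) I.
by rewrite E1 E2 grad_cst scaler0 addr0 scaleNr.
Qed.

Lemma tanlap_perturb x G :
  tanlap perturb x G = tanlap f x G - eps * tanlap (gauss a y) x G.
Proof.
have E1 : tanlap perturb x G = tanlap (fun x => f x + - eps * gauss a y x) x G +
    eps * tanlap (fun _ : E => c) x G := tanlap_lin openT eps G Cfg Cc I.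
have E2 : tanlap (fun x => f x + - eps * gauss a y x) x G =
    tanlap f x G + (- eps) * tanlap (gauss a y) x G :=
  tanlap_lin openT (- eps) G Cf Cg I.
by rewrite E1 E2 tanlap_cst mulr0 addr0 mulNr.
Qed.

End Perturbation.

Lemma norm_sub_le_eucl x y : `|x - y| <= Num.sqrt (sqdist y x).
Proof. by rewrite -euclE norm_le_eucl. Qed.

(* The constants of the Hopf argument: near z0 both curvatures are Lipschitz,
   the level sets are transversal to G0, and the direction z - y stays away
   from the normal. *)
Record hopf_constants (f1 f2 : E -> R) (z0 y : E) (r0 L LT c0 MG : R) : Prop := {
  hc_L : 0 <= L; hc_LT : 0 <= LT; hc_c0 : 0 < c0; hc_MG : 0 < MG;
  hc_desc1 : forall x, `|z0 - x| < r0 -> dot (grad f1 z0) (grad f1 z0) / 2 <=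
     dot (grad f1 x) (grad f1 z0);
  hc_desc2 : forall x, `|z0 - x| < r0 -> 0 < dot (grad f2 x) (grad f1 z0);
  hc_curv1 : forall x x', `|z0 - x| < r0 -> `|z0 - x'| < r0 ->
     `|curv f1 x - curv f1 x'| <= L * `|x - x'|;
  hc_curv2 : forall x x', `|z0 - x| < r0 -> `|z0 - x'| < r0 ->
     `|curv f2 x - curv f2 x'| <= L * `|x - x'|;
  hc_G : forall x G, `|z0 - x| < r0 -> `|grad f1 x - G| < r0 ->
     [/\ G != 0, dot G G <= MG, c0 <= dot (x - y) (x - y) * dot G G - dot (x - y) G ^+ 2 &
      `|tanlap f1 x G / eucl G - curv f1 x| <= LT * `|grad f1 x - G| ] }.

Lemma hopf_constants_exist f1 f2 z0 y (k0 d : R) :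
  Ck setT 3 f1 -> Ck setT 3 f2 -> grad f1 z0 != 0 -> 0 < k0 ->
  grad f2 z0 = k0 *: grad f1 z0 -> (forall c : R, z0 - y != c *: grad f1 z0) ->
  0 < d -> exists r0 L LT c0 MG, [/\ 0 < r0, r0 <= d &
    hopf_constants f1 f2 z0 y r0 L LT c0 MG].
Proof.
move=> C1 C2 g1 k00 g2 nt d0.
set G0 := grad f1 z0 in g1 g2 nt *; have GG := dot_gt0 g1.
have C11 : Ck setT 1 f1 by exact: Ck_le C1.
have C21 : Ck setT 1 f2 by exact: Ck_le C2.
have C12 : Ck setT 2 f1 by exact: Ck_le C1.
have g2n : grad f2 z0 != 0 by rewrite g2 scaler_eq0 negb_or gt_eqF.
have [d1 d10 [L1 L10 L1P]] :=
  Ck_lipschitz (grad_neq0_open C11) (Ck_curv C1) (g1 : [set x | grad f1 x != 0] z0).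
have [d2 d20 [L2 L20 L2P]] :=
  Ck_lipschitz (grad_neq0_open C21) (Ck_curv C2) (g2n : [set x | grad f2 x != 0] z0).
have [d3 d30 [LT LT0 LTP]] := tanlap_lipschitz z0 C12 g1.
have [d4 d40 [c0 c00 c0P]] := gram_near g1 nt.
have e5 : 0 < dot G0 G0 / 2 by rewrite divr_gt0.
have [d5 d50 d5P] := derive_continuous openT G0 C11 (I : setT z0) e5.
have e6 : 0 < dot (grad f2 z0) G0 by rewrite g2 dotZl mulr_gt0.
have [d6 d60 d6P] := derive_continuous openT G0 C21 (I : setT z0) e6.
(* [G] has to lie within [m] of [G0]: one half is spent between [G0] and [grad f1 x], the other
   between [grad f1 x] and [G]. *)
pose m := Num.min d3 d4; have m0 : 0 < m by rewrite lt_min d30.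
have [m20 _] := half_gt0_lt m0.
have [d7 d70 d7P] := grad_near z0 C11 m20.
pose r0 := Num.min (Num.min (Num.min d (m / 2)) (Num.min d1 d2))
  (Num.min (Num.min d5 d6) d7).
have r00 : 0 < r0 by rewrite !lt_min d0 m20 d10 d20 d50 d60 d70.
have rle : [/\ r0 <= d, r0 <= m / 2, r0 <= d1 & r0 <= d2] /\
   [/\ r0 <= d5, r0 <= d6 & r0 <= d7].
  by split; split; rewrite /r0 !ge_min lexx ?orbT.
clearbody r0; case: rle => -[rd rm r1 r2] [r5 r6 r7].
exists r0, (L1 + L2), LT, c0, (N%:R * ((`|G0| + m) * (`|G0| + m)) + 1).
split=> //; split=> //.
- exact: addr_ge0.
- by rewrite ltr_wpDl// mulr_ge0// mulr_ge0// addr_ge0// ltW.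
- move=> x xr; have := d5P x (lt_le_trans xr r5).
  rewrite -/G0 ltr_norml => /andP[_ H]; move: H; clear; lra.
- move=> x xr; have := d6P x (lt_le_trans xr r6).
  rewrite ltr_norml => /andP[_ H]; move: H; clear; lra.
- move=> x x' xr xr'; apply: le_trans (L1P _ _ (lt_le_trans xr r1) (lt_le_trans xr' r1)) _.
  by apply: ler_wpM2r => //; rewrite lerDl.
- move=> x x' xr xr'; apply: le_trans (L2P _ _ (lt_le_trans xr r2) (lt_le_trans xr' r2)) _.
  by apply: ler_wpM2r => //; rewrite lerDr.
move=> x G xr Gr.
have gm : `|G0 - grad f1 x| < m / 2 by apply: d7P; exact: lt_le_trans xr r7.
have [_ mm] := half_gt0_lt m0.
have Gm : `|G0 - G| < m.
  have -> : G0 - G = (G0 - grad f1 x) + (grad f1 x - G) by rewrite addrA subrK.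
  apply: le_lt_trans (ler_normD _ _) _.
  by have := lt_le_trans Gr rm; move: gm; clear; lra.
have m3 : m <= d3 by rewrite ge_min lexx.
have m4 : m <= d4 by rewrite ge_min lexx orbT.
have gram : c0 <= dot (x - y) (x - y) * dot G G - dot (x - y) G ^+ 2.
  apply: c0P; last exact: lt_le_trans Gm m4.
  rewrite opprB addrA subrK; apply: lt_le_trans xr _.
  by apply: le_trans rm _; apply: le_trans (ltW mm) m4.
split=> //.
- apply: contraTneq gram => ->; rewrite !dot0r mulr0 expr0n subr0 -ltNge.
  exact: c00.
- apply: le_trans (ler_norm _) _; apply: le_trans (dot_le_norm _ _) _.
  rewrite ler_wpDr//; apply: ler_wpM2l => //.
  by apply: ler_pM => //; exact: norm_near Gm.
- rewrite /curv (distrC (grad f1 x)); apply: (LTP x).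
  + apply: lt_le_trans xr _; apply: le_trans rm _.
    exact: le_trans (ltW mm) m3.
  + exact: lt_le_trans Gm m3.
  + by apply: lt_le_trans gm _; apply: le_trans (ltW mm) m3.
Qed.

End Hopf.

Section Hopf2.
Context {R : realType} {N : nat}.
Local Notation E := 'rV[R]_N.
Implicit Types (f g : E -> R) (x y z v w G : E) (V : set E).

Lemma contact_arith (k x1 A eps T e cu LT n Y : R) :
  k - x1 <= (A - eps * T) / e -> A / e - cu <= LT * (eps * n) ->
  cu <= k + x1 -> x1 * 2 <= eps * Y -> eps * (T / e) <= eps * (Y + LT * n).
Proof. lra. Qed.

(** The gradients are positive multiples of each other: [tanlap] does not see the factor in its last
    argument, and the factor in [contact_tanlap] cancels against the one in [eucl]. *)
Lemma curv_contact f1 f2 z k : Ck setT 2 f1 -> Ck setT 2 f2 -> f1 z <= 0 ->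
  (exists2 d, 0 < d & forall x, `|z - x| < d -> f1 x <= 0 -> f2 x <= f2 z) ->
  grad f1 z != 0 -> grad f2 z != 0 -> k <= curv f2 z ->
  k <= tanlap f1 z (grad f1 z) / eucl (grad f1 z).
Proof.
move=> C1 C2 f1z H g1 g2 kc.
have [c c0 Ec] := contact_grad openT (Ck_le (isT : (1 <= 2)%N) C1)
  (Ck_le (isT : (1 <= 2)%N) C2) I f1z H g1 g2.
have := contact_tanlap openT C1 C2 I f1z H g1 c0 Ec.
rewrite /curv Ec tanlapZ ?gt_eqF// in kc.
have e0 := eucl_gt0 g1.
have ec : eucl (c *: grad f1 z) = c * eucl (grad f1 z).
  rewrite !euclE !dotE mulrA -expr2 sqrtrM ?sqr_ge0//.
  by rewrite sqrtr_sqr gtr0_norm.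
rewrite ec ler_pdivlMr ?mulr_gt0// in kc.
move=> /(le_trans kc); rewrite mulrCA ler_pM2l// => H2.
by rewrite ler_pdivlMr.
Qed.

(** Sliding from [z] along [- G0] reaches both zero sets within length O(eps eta), so both
    curvatures at [z] equal [k] up to that error. The perturbation lowers the normalised tangential
    Laplacian of [f1] by eps tanlap(gauss) / |G|, up to an error of order eps a gauss from the
    change of gradient. Since [eta <= gauss a y z], comparison at the contact point and division by
    eps gauss bound a quantity quadratic in [a] by one at most linear in [a], against the assumed
    inequality on [a]. *)
Lemma hopf_contact f1 f2 z0 y (a eps k D r0 L LT c0 MG : R) z :
  let G0 := grad f1 z0 in let g := dot G0 G0 in let S := Num.sqrt D in
  let eta := gauss a y z - expR (- a * D) in
  Ck setT 3 f1 -> Ck setT 3 f2 -> G0 != 0 -> 0 < r0 ->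
  hopf_constants f1 f2 z0 y r0 L LT c0 MG ->
  0 < a -> 0 < eps ->
  (MG + 1) * (4 * L * `|G0| / g + LT * (2 * a * S)) <
    4 * a ^+ 2 * (c0 / MG) - 2 * a * N%:R ->
  2 * eps <= g -> 2 * eps / g * `|G0| <= r0 / 2 ->
  2 * eps * a * (2 * (N%:R * (S * `|G0|)) + g) <= g ->
  eps * (2 * a * S) < r0 ->
  (forall x, `|z0 - x| < r0 -> sqdist y x <= D -> f1 x <= 0 -> f2 x <= 0) ->
  (forall x, `|z0 - x| < r0 -> f1 x = 0 -> curv f1 x = k) ->
  (forall x, `|z0 - x| < r0 -> f2 x = 0 -> curv f2 x = k) ->
  `|z0 - z| < r0 / 2 -> sqdist y z < D -> 0 < f2 z ->
  0 < f1 z <= eps * eta ->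
  (exists2 d, 0 < d & forall x, `|z - x| < d ->
     f1 x <= eps * (gauss a y x - expR (- a * D)) -> f2 x <= f2 z) -> False.
Proof.
move=> G0 g S eta C1 C2 G0n r00 hc a0 e0 ha he1 he2 he3 he4 incl cv1 cv2 zr qD.
move=> f2z /andP[f1z f1e] cont.
have g0 : 0 < g by exact: dot_gt0.
have D0 : 0 < D by apply: le_lt_trans qD; exact: sqdist_ge0.
have S0 : 0 < S by rewrite sqrtr_gt0.
have zr0 : `|z0 - z| < r0 by have [_] := half_gt0_lt r00; exact: lt_trans.
have C11 : Ck setT 1 f1 by exact: Ck_le C1.
have C21 : Ck setT 1 f2 by exact: Ck_le C2.
have C12 : Ck setT 2 f1 by exact: Ck_le C1.
have C22 : Ck setT 2 f2 by exact: Ck_le C2.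
have eta0 : 0 < eta by rewrite -(pmulr_rgt0 _ e0); exact: lt_le_trans f1z f1e.
have E0 : 0 < gauss a y z by exact: expR_gt0.
have etaE : eta <= gauss a y z by rewrite /eta gerBl expR_ge0.
have eta1 : eta <= 1 by apply: le_trans etaE (gauss_le1 _ _ a0).
have dS : `|z - y| <= S.
  apply: le_trans (norm_sub_le_eucl _ _) _; rewrite ler_psqrt ?nnegrE ?sqdist_ge0//.
    exact: ltW.
  exact: ltW.
(* The slope of [f1] along [- G0] is at most [- g / 2] by [hc_desc1], so this time suffices to reach
   [f1 <= 0]. *)
pose t := 2 * f1 z / g.
have t0 : 0 < t by rewrite divr_gt0// mulr_gt0.
have te : t <= 2 * eps / g * eta.
  have -> : 2 * eps / g * eta = 2 * (eps * eta) / g by field; rewrite gt_eqF.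
  by rewrite ler_pM2r ?invr_gt0// ler_pM2l.
have te1 : t <= 2 * eps / g.
  apply: le_trans te _; apply: ler_piMr => //.
  by apply/ltW/divr_gt0 => //; exact: mulr_gt0.
have t1 : t <= 1 by apply: le_trans te1 _; rewrite ler_pdivrMr// mul1r.
have tG : t * `|- G0| <= r0 / 2.
  by rewrite normrN; apply: le_trans he2; apply: ler_wpM2r.
have near s : 0 <= s <= t -> `|z0 - (z + s *: - G0)| < r0.
  move=> st; have := shift_norm zr st tG.
  by have -> : 2 * (r0 / 2) = r0 by field.
have lo1 : f1 (z + t *: - G0) <= 0.
  have [|s /andP[s0 st] E1] := @line_mvt R N f1 z (- G0) t t0.
    by move=> s _; exact: (Ck_derivable C11).
  have st' : 0 <= s <= t by rewrite (ltW s0) (ltW st).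
  have H1 : g / 2 <= dot (grad f1 (z + s *: - G0)) G0 := hc_desc1 hc (near s st').
  rewrite (derive_dot openT) ?dotNr// in E1.
  have H2 : t * (g / 2) <= t * dot (grad f1 (z + s *: - G0)) G0 by rewrite ler_pM2l.
  have H3 : t * (g / 2) = f1 z by rewrite /t; field; rewrite gt_eqF.
  move: E1 H2 H3; rewrite mulrN; clear; lra.
(* The slide must stay in the ball where the inclusion is known: [gauss_drop] leaves room [eta / a],
   while [t] is at most [2 * eps / g * eta], and [eps] is small. *)
have lo2 : f2 (z + t *: - G0) <= 0.
  apply: incl => //; first by apply: near; rewrite lexx ltW.
  have drop := gauss_drop a0 (ltW qD).
  have -> : sqdist y (z + t *: - G0) = sqdist y z - 2 * t * dot (z - y) G0 + t * (t * g).
    rewrite /sqdist addrAC; move: (z - y) => u.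
    by rewrite !dotE (dotC G0 u) /g; ring.
  have B1 : - (N%:R * (S * `|G0|)) <= dot (z - y) G0.
    rewrite lerNl; apply: le_trans (ler_norm _) _; rewrite normrN.
    apply: le_trans (dot_le_norm _ _) _; apply: ler_wpM2l => //.
    by apply: ler_wpM2r.
  have B2 : t * (t * g) <= t * g.
    by rewrite ler_pM2l// ler_piMl// ltW.
  have B3 : - (2 * t * dot (z - y) G0) <= t * (2 * (N%:R * (S * `|G0|))).
    by have := ler_wpM2l (ltW t0) B1; clear; lra.
  set B := 2 * (N%:R * (S * `|G0|)) + g in he3.
  have B4 : a * (t * B) <= eta.
    have Bge0 : 0 <= a * B.
      apply: mulr_ge0; first exact: ltW.
      by apply: addr_ge0; [do !apply: mulr_ge0 => //|]; exact: ltW.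
    have := ler_wpM2r Bge0 te.
    have -> : 2 * eps / g * eta * (a * B) = (2 * eps * a * B) / g * eta.
      by field; rewrite gt_eqF.
    have : (2 * eps * a * B) / g * eta <= 1 * eta.
      by rewrite ler_pM2r// ler_pdivrMr// mul1r.
    by clear; lra.
  have B5 : t * B <= D - sqdist y z.
    by rewrite -(ler_pM2l a0); exact: le_trans B4 drop.
  by move: B2 B3 B5; rewrite /B; clear; lra.
have [s1 s1t z1] := descent_zero C11 t0 (ltW f1z) lo1.
have [s2 s2t z2] := descent_zero C21 t0 (ltW f2z) lo2.
have c1 : curv f1 z <= k + L * (t * `|G0|).
  have := hc_curv1 hc zr0 (near s1 s1t); rewrite (cv1 _ (near s1 s1t) z1).
  have -> : z - (z + s1 *: - G0) = s1 *: G0 by rewrite opprD addrA subrr sub0r scalerN opprK.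
  case/andP: s1t => s10 s1t; rewrite normrZ ger0_norm// => H1.
  have H2 : L * (s1 * `|G0|) <= L * (t * `|G0|).
    by apply: ler_wpM2l; [exact: hc_L hc|apply: ler_wpM2r].
  by have := ler_norm (curv f1 z - k); move: H1 H2; clear; lra.
have c2 : k - L * (t * `|G0|) <= curv f2 z.
  have := hc_curv2 hc zr0 (near s2 s2t); rewrite (cv2 _ (near s2 s2t) z2).
  have -> : z - (z + s2 *: - G0) = s2 *: G0 by rewrite opprD addrA subrr sub0r scalerN opprK.
  case/andP: s2t => s20 s2t; rewrite normrZ ger0_norm// distrC => H1.
  have H2 : L * (s2 * `|G0|) <= L * (t * `|G0|).
    by apply: ler_wpM2l; [exact: hc_L hc|apply: ler_wpM2r].
  by have := ler_norm (k - curv f2 z); move: H1 H2; clear; lra.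
pose p := perturb f1 y a (expR (- a * D)) eps.
have gp : grad p z = grad f1 z - eps *: grad (gauss a y) z by exact: grad_perturb.
have ng : `|grad (gauss a y) z| <= 2 * a * S * gauss a y z.
  rewrite grad_gauss normrZ normrM normrN (gtr0_norm E0) gtr0_norm ?mulr_gt0//.
  rewrite -!mulrA ler_pM2l// ler_pM2l// mulrC.
  by apply: ler_wpM2r => //; exact: ltW.
have dG : `|grad f1 z - grad p z| = eps * `|grad (gauss a y) z|.
  by rewrite gp opprB addrC subrK normrZ gtr0_norm.
have dG1 : `|grad f1 z - grad p z| < r0.
  rewrite dG; apply: le_lt_trans he4; rewrite ler_pM2l//.
  apply: le_trans ng _; rewrite ler_piMr ?gauss_le1//.
  by rewrite mulr_ge0 ?mulr_ge0// ltW.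
have [Gn GM gram TL] := hc_G hc zr0 dG1.
have g2n : grad f2 z != 0.
  by have := hc_desc2 hc zr0; apply: contraTneq => ->; rewrite dot0l ltxx.
have pz : p z <= 0 by rewrite /p perturbE subr_le0.
have contp : exists2 d, 0 < d & forall x, `|z - x| < d -> p x <= 0 -> f2 x <= f2 z.
  have [d d0 dP] := cont; exists d => // x /dP H; rewrite /p perturbE subr_le0.
  exact: H.
have main := curv_contact (Ck_perturb y a (expR (- a * D)) eps C12) C22 pz contp Gn g2n c2.
rewrite -/p [tanlap p z _]tanlap_perturb// in main.
move: TL; rewrite dG => TL.
set G := grad p z in Gn GM gram TL main.
have eG := eucl_gt0 Gn.
have eGM : eucl G <= MG + 1.
  have : eucl G ^+ 2 <= MG by rewrite eucl_sqr.
  have [e1|e1] := leP (eucl G) 1.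
    by have := hc_MG hc; move: e1; clear; lra.
  have : eucl G <= eucl G ^+ 2 by rewrite expr2 ler_peMr// ltW.
  by clear; lra.
set T := tanlap (gauss a y) z G in main.
have upT : T <= (MG + 1) * (4 * L * `|G0| / g * eta + LT * `|grad (gauss a y) z|).
  have H1 : eps * (T / eucl G) <= eps * (4 * L * `|G0| / g * eta + LT * `|grad (gauss a y) z|).
    have H2 : L * (t * `|G0|) * 2 <= eps * (4 * L * `|G0| / g * eta).
      have -> : eps * (4 * L * `|G0| / g * eta) = L * ((2 * eps / g * eta) * `|G0|) * 2.
        by field; rewrite gt_eqF.
      by rewrite ler_pM2r// ler_wpM2l ?(hc_L hc)// ler_wpM2r.
    exact: contact_arith main (le_trans (ler_norm _) TL) c1 H2.
  rewrite ler_pM2l// ler_pdivrMr// mulrC in H1; apply: le_trans H1 _.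
  apply: ler_wpM2r => //; rewrite addr_ge0//.
    by do !apply: mulr_ge0 => //; rewrite ?invr_ge0; [exact: hc_L hc|exact: ltW|exact: ltW].
  by rewrite mulr_ge0// (hc_LT hc).
have GG0 := dot_gt0 Gn.
have loT : gauss a y z * (4 * a ^+ 2 * (c0 / MG) - 2 * a * N%:R) <= T.
  rewrite /T tanlap_gauss divff ?gt_eqF// ler_pM2l//.
  have H1 : c0 / MG <= dot (z - y) (z - y) - dot (z - y) G ^+ 2 / dot G G.
    apply: (@le_trans _ _ (c0 / dot G G)).
      by rewrite ler_pM2l ?(hc_c0 hc)// lef_pV2 ?posrE// (hc_MG hc).
    rewrite ler_pdivrMr// mulrBl divfK ?gt_eqF//.
  have a20 : 0 <= 4 * a ^+ 2 by rewrite mulr_ge0// sqr_ge0.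
  have := ler_wpM2l a20 H1; move: a0; clear; lra.
have : T <= gauss a y z * ((MG + 1) * (4 * L * `|G0| / g + LT * (2 * a * S))).
  apply: le_trans upT _; rewrite mulrCA; apply: ler_wpM2l.
    by have := hc_MG hc; clear; lra.
  rewrite [leRHS]mulrDr; apply: lerD.
    rewrite mulrC; apply: ler_wpM2r => //.
    by do !apply: mulr_ge0 => //; rewrite ?invr_ge0; [exact: hc_L hc|exact: ltW].
  by rewrite mulrCA; apply: ler_wpM2l; [exact: hc_LT hc|rewrite mulrC].
move=> /(le_trans loT); rewrite ler_pM2l// leNgt ha.
by [].
Qed.

End Hopf2.

(** * Closed sets, compactness and suprema *)

Section Topology.
Context {R : realType} {N : nat}.
Local Notation E := 'rV[R]_N.
Implicit Types (x y z : E) (A : set E) (F : E -> R).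

Lemma closureP A x :
  closure A x <-> forall d, 0 < d -> exists2 y, A y & `|x - y| < d.
Proof.
split=> [cx d d0|H B /(@near_normP R E x B)[d d0 dP]].
  have [|y [Ay yd]] := cx [set y | `|x - y| < d].
    by apply: (iffRL (@near_normP R E x _)); exists d.
  by exists y.
by have [y Ay /dP By] := H d d0; exists y.
Qed.

Lemma closed_normP A :
  (forall x, ~ A x -> exists2 d, 0 < d & forall y, `|x - y| < d -> ~ A y) ->
  closed A.
Proof.
move=> H x /closureP cx; apply: contrapT => /H[d d0 dP].
by have [y Ay /dP] := cx d d0.
Qed.

Lemma closed_sublevel F (c : R) : (forall x, {for x, continuous F}) ->
  closed [set x | F x <= c].
Proof.
move=> cF; apply: closed_normP => x /= /negP; rewrite -ltNge -subr_gt0 => Fx.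
have /continuous_atP/(_ _ Fx)[d d0 dP] := cF x.
exists d => // y /dP; rewrite ltr_norml => /andP[_ H]; apply/negP.
by rewrite -ltNge; move: H; clear; lra.
Qed.

Lemma closed_bounded_compact A (M : R) : closed A ->
  (forall x, A x -> `|x| <= M) -> compact A.
Proof.
move=> cA AM; apply: bounded_closed_compact => //.
exists M; split; first exact: num_real.
by move=> r Mr x /AM xM; apply: le_trans xM (ltW Mr).
Qed.

Lemma compact_max A F : A !=set0 -> compact A ->
  (forall x, {for x, continuous F}) ->
  exists2 z, A z & forall x, A x -> F x <= F z.
Proof.
move=> A0 cA cF; have [|z zA zP] := @EVT_max_rV R N F A A0 cA.
  by apply: continuous_subspaceT => x; exact: cF.
by exists z => [|x Ax]; [rewrite inE in zA|apply: zP; rewrite inE].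
Qed.

Lemma compact_min A F : A !=set0 -> compact A ->
  (forall x, {for x, continuous F}) ->
  exists2 z, A z & forall x, A x -> F z <= F x.
Proof.
move=> A0 cA cF; have [|z zA zP] := @EVT_min_rV R N F A A0 cA.
  by apply: continuous_subspaceT => x; exact: cF.
by exists z => [|x Ax]; [rewrite inE in zA|apply: zP; rewrite inE].
Qed.

Lemma norm_sub_continuous x0 x : {for x, continuous (fun x => `|x0 - x|)}.
Proof.
apply/continuous_atP => e e0; exists e => // y yx.
apply: le_lt_trans (ler_dist_dist _ _) _.
have -> : x0 - x - (x0 - y) = y - x by rewrite opprB addrC addrA subrK.
by rewrite distrC.
Qed.

(** Tube lemma in the parameter [m]. *)
Lemma compact_uniform A (m : R) (P : E -> R -> Prop) : compact A ->
  (forall x, A x -> exists2 d, 0 < d & forall x' m',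
    `|x - x'| < d -> `|m - m'| < d -> P x' m') ->
  exists2 d, 0 < d & forall m', `|m - m'| < d -> forall x, A x -> P x m'.
Proof.
move=> /compact_near_coveringP cA H.
have := cA R (nbhs m) (fun m' x => P x m') _.
have {}H x : A x -> \forall x' \near x & i \near nbhs m, P x' i.
  move=> /H[d d0 dP].
  exists ([set y | `|x - y| < d], [set r | `|m - r| < d]).
    split => /=; first by apply: (iffRL (@near_normP R E x _)); exists d.
    by apply: (iffRL (@near_normP R R m _)); exists d.
  by move=> [y r] [/= yd rd]; exact: dP.
by move=> /(_ _ H)/(@near_normP R R m _).
Qed.

Lemma sup_exists (A : set R) (a M : R) : A a -> (forall r : R, A r -> r <= M) ->
  exists2 s, (forall r : R, A r -> r <= s) &
    forall e, 0 < e -> exists2 r, A r & s - e < r.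
Proof.
move=> Aa AM; have hs : has_sup A by split; [exists a|exists M].
exists (sup A) => [x Ax|e e0]; first exact: (ub_le_sup (proj2 hs)).
by have [x Ax xe] := sup_adherent e0 hs; exists x.
Qed.

End Topology.

(** * Assembly of the Hopf lemma *)

Section Hopf3.
Context {R : realType} {N : nat}.
Local Notation E := 'rV[R]_N.
Implicit Types (f g : E -> R) (x y z v w G : E) (V : set E).

Lemma small_mul (c b : R) : 0 < b ->
  exists2 e0, 0 < e0 & forall e, 0 < e <= e0 -> e * c < b.
Proof.
move=> b0; have c0 : 0 < `|c| + 1 by rewrite ltr_wpDl.
exists (b / (2 * (`|c| + 1))); first by rewrite divr_gt0// mulr_gt0.
move=> e /andP[e0 ee]; apply: (@le_lt_trans _ _ (e * (`|c| + 1))).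
  by rewrite ler_pM2l// (le_trans (ler_norm c))// lerDl.
apply: (@le_lt_trans _ _ (b / 2)); last by have [] := half_gt0_lt b0.
have -> : b / 2 = b / (2 * (`|c| + 1)) * (`|c| + 1) by field; rewrite gt_eqF.
by rewrite ler_pM2r.
Qed.

Lemma Ck_cont n f x : Ck setT n f -> {for x, continuous f}.
Proof. by move=> Cf; exact: (Ck_continuous Cf I). Qed.

(* If f2 <= 0 holds on the perturbed sublevel set, then moving from z0 in a
   nearly tangential direction into the ball contradicts tangency. *)
Lemma hopf_ray f1 f2 z0 y (k0 a eps r : R) :
  Ck setT 2 f1 -> Ck setT 1 f2 -> f1 z0 = 0 -> f2 z0 = 0 ->
  grad f1 z0 != 0 -> 0 < k0 -> grad f2 z0 = k0 *: grad f1 z0 ->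
  (forall c : R, z0 - y != c *: grad f1 z0) -> 0 < a -> 0 < eps -> 0 < r ->
  (forall x, `|z0 - x| < r -> sqdist y x < sqdist y z0 ->
     f1 x <= eps * (gauss a y x - gauss a y z0) -> f2 x <= 0) -> False.
Proof.
move=> C1 C2 f1z f2z g1 k00 g2 nt a0 e0 r0 H.
set G0 := grad f1 z0 in g1 g2 nt.
have g0 : 0 < dot G0 G0 by exact: dot_gt0.
have gram := gram_gt0 g1 nt.
set v := z0 - y in nt gram.
have vE : v = z0 - y by [].
clearbody v.
pose P := dot v v - dot v G0 ^+ 2 / dot G0 G0.
have P0 : 0 < P.
  rewrite -(pmulr_rgt0 _ g0) /P mulrBr mulrCA divff ?gt_eqF// mulr1 mulrC.
  exact: gram.
have E0 : 0 < gauss a y z0 by exact: expR_gt0.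
have P20 : 0 < P / 2 by rewrite divr_gt0.
have [e1 e10 e1P] := small_mul (dot v G0) P20.
have q0 : 0 < eps * a * gauss a y z0 * P by do !apply: mulr_gt0 => //.
have [e2 e20 e2P] := small_mul (dot G0 G0) q0.
pose del := Num.min e1 e2.
have del0 : 0 < del by rewrite lt_min e10.
have d1 : del * dot v G0 < P / 2 by apply: e1P; rewrite del0 ge_min lexx.
have d2 : del * dot G0 G0 < eps * a * gauss a y z0 * P.
  by apply: e2P; rewrite del0 ge_min lexx orbT.
clearbody del.
(* Minus the tangential part of [v], plus a small normal component [del *: G0]. The tangential part
   enters the ball at first order, where the barrier grows, and the normal one increases [f2] at the
   rate [k0 * del * dot G0 G0]. *)
pose w := (del + dot v G0 / dot G0 G0) *: G0 - v.
have Gw : dot G0 w = del * dot G0 G0.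
  by rewrite /w !dotE (dotC G0 v); field; rewrite gt_eqF.
have vw : dot v w = del * dot v G0 - P.
  by rewrite /w !dotE /P; field; rewrite gt_eqF.
have W : (1 <= 2)%N by [].
pose p := perturb f1 y a (gauss a y z0) eps.
have Cp : Ck setT 1 p by exact/(Ck_le W)/Ck_perturb.
have pw : dot (grad p z0) w < 0.
  rewrite grad_perturb// grad_gauss -/G0 -vE !dotBl !dotZl Gw vw.
  have H1 : eps * a * gauss a y z0 * (del * dot v G0) <=
     eps * a * gauss a y z0 * (P / 2).
    by rewrite ler_pM2l ?ltW//; do !apply: mulr_gt0 => //.
  by move: d2 H1; clear; lra.
have Cs : Ck setT 1 (sqdist y) by exact: Ck_sqdist _ _ openT.
have sw : dot (grad (sqdist y) z0) w < 0.
  rewrite -(derive_dot openT _ Cs I).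
  have [_ ->] := is_derive_sqdist y z0 w; rewrite -vE vw.
  by move: d1 P0; clear; lra.
have fw : 0 < dot (grad f2 z0) w.
  by rewrite g2 dotZl Gw !mulr_gt0.
have [t1 t10 t1P] := ray_lt openT Cp I pw.
have [t2 t20 t2P] := ray_lt openT Cs I sw.
have [t3 t30 t3P] := ray_gt openT C2 I fw.
have [t4 t40 t4P] := curve_small z0 w 0 r0.
pose m := Num.min (Num.min t1 t2) (Num.min t3 t4).
have m0 : 0 < m by rewrite !lt_min t10 t20 t30 t40.
have [h0] := half_gt0_lt m0.
rewrite {2}/m !lt_min => /andP[/andP[h1 h2] /andP[h3 h4]].
have := t1P (m / 2); rewrite h0 h1 mul0r addr0 /p !perturbE subrr mulr0 subr0 f1z.
move=> /(_ isT) A1.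
have := t2P (m / 2); rewrite h0 h2 mul0r addr0 => /(_ isT) A2.
have := t3P (m / 2); rewrite h0 h3 => /(_ isT).
have := t4P (m / 2); rewrite h0 h4 scaler0 addr0 => /(_ isT) A4.
rewrite f2z ltNge H//.
by move: A1; clear; lra.
Qed.

(** The sphere around [y] through [z0] is not tangent to the surface, so some tangential direction
    enters the ball. Take the maximum of [f2] over the perturbed sublevel set in the ball near [z0].
    If it is nonpositive, [hopf_ray] applies. If it is positive, it is not on the sphere, where the
    perturbation vanishes and the inclusion holds, nor on the outer shell, by strictness and small
    [eps]; then [hopf_contact] applies. *)
Lemma surface_hopf f1 f2 z0 y (k0 k d : R) :
  Ck setT 3 f1 -> Ck setT 3 f2 -> f1 z0 = 0 -> f2 z0 = 0 ->
  grad f1 z0 != 0 -> 0 < k0 -> grad f2 z0 = k0 *: grad f1 z0 ->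
  (forall c : R, z0 - y != c *: grad f1 z0) -> 0 < d ->
  (forall x, `|z0 - x| < d -> sqdist y x <= sqdist y z0 -> f1 x <= 0 -> f2 x <= 0) ->
  (forall x, `|z0 - x| < d -> sqdist y x <= sqdist y z0 -> f1 x = 0 -> x != z0 ->
     f2 x < 0) ->
  (forall x, `|z0 - x| < d -> f1 x = 0 -> curv f1 x = k) ->
  (forall x, `|z0 - x| < d -> f2 x = 0 -> curv f2 x = k) -> False.
Proof.
move=> C1 C2 f1z f2z g1 k00 g2 nt d0 incl strict cv1 cv2.
have [r0 [L [LT [c0 [MG [r00 rd hc]]]]]] := hopf_constants_exist C1 C2 g1 k00 g2 nt d0.
pose D := sqdist y z0; pose S := Num.sqrt D.
have D0 : 0 < D.
  apply: dot_gt0; have := nt 0; by rewrite scale0r.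
have S0 : 0 < S by rewrite sqrtr_gt0.
pose G0 := grad f1 z0; pose g := dot G0 G0.
have g0 : 0 < g by exact: dot_gt0.
have L0 := hc_L hc; have LT0 := hc_LT hc.
have c00 := hc_c0 hc; have MG0 := hc_MG hc.
have X0 : 0 <= 4 * L * `|G0| / g.
  by apply: divr_ge0; [do !apply: mulr_ge0 => //|exact: ltW].
set X := 4 * L * `|G0| / g in X0.
(* Chosen so that [a * (4 * (c0 / MG))] is the bracket plus [4 * (c0 / MG)]; the final [+ 1] gives
   [1 <= a]. *)
pose a := MG / (4 * c0) * (2 * N%:R + (MG + 1) * X + (MG + 1) * LT * (2 * S) + 1) + 1.
have a1 : 1 <= a.
  rewrite /a lerDr; apply: mulr_ge0; first by apply: divr_ge0; rewrite ltW ?mulr_gt0.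
  have MG1 : 0 <= MG + 1 by rewrite addr_ge0// ltW.
  by do !apply: addr_ge0 => //; do ?apply: mulr_ge0 => //; do ?apply: mulr_ge0 => //; exact: ltW.
have a0 : 0 < a by exact: lt_le_trans a1.
have ha : (MG + 1) * (X + LT * (2 * a * S)) < 4 * a ^+ 2 * (c0 / MG) - 2 * a * N%:R.
  have -> : 4 * a ^+ 2 * (c0 / MG) = a * (2 * N%:R + (MG + 1) * X + (MG + 1) * LT * (2 * S) + 1
     + 4 * (c0 / MG)).
    have -> : 4 * a ^+ 2 * (c0 / MG) = a * (4 * (c0 / MG) * a) by ring.
    congr (_ * _); rewrite /a; field.
    by rewrite !gt_eqF.
  have MX : (MG + 1) * X <= a * ((MG + 1) * X).
    by rewrite ler_peMl// mulr_ge0// addr_ge0// ltW.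
  have : 0 < a * (4 * (c0 / MG)) by do !apply: mulr_gt0 => //; rewrite invr_gt0.
  by move: MX a0; clearbody a X; clear; lra.
clearbody a.
pose K1 := [set x : E | `|z0 - x| <= r0 / 4] `&` [set x | sqdist y x <= D].
have q0 : 0 < r0 / 4 by rewrite divr_gt0.
have cs : forall x, {for x, continuous (sqdist y)}.
  by move=> x; exact/Ck_cont/(Ck_sqdist 0 y openT).
have K1closed : closed K1.
  apply: closedI; last exact: closed_sublevel.
  by apply: closed_sublevel => x; exact: norm_sub_continuous.
have cpt A : A `<=` K1 -> closed A -> compact A.
  move=> AK cA; apply: (@closed_bounded_compact _ _ _ (`|z0| + r0 / 4)) => //.
  move=> x /AK[/= xr _]; have := ler_normB z0 (z0 - x).
  rewrite opprB addrC subrK => /le_trans; apply.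
  by rewrite lerD2l.
(* The part of the outer shell where [f1] and [f2] are nonnegative. There [f1 = 0] would force
   [f2 < 0] by [strict], so [f1] has a positive minimum [del], and [eps < del] keeps the maximiser
   off the shell. *)
pose Sset := [set x : E | - `|z0 - x| <= - (r0 / 4)] `&`
  ([set x | - f1 x <= 0] `&` ([set x | - f2 x <= 0] `&` K1)).
have cf1 x : {for x, continuous f1} by exact: Ck_cont C1.
have cf2 x : {for x, continuous f2} by exact: Ck_cont C2.
have Sclosed : closed Sset.
  do !apply: closedI => //; apply: closed_sublevel => x; apply: continuousN => //.
  exact: norm_sub_continuous.
have rr0 : r0 / 4 < r0 by move: r00; clear; lra.
have [del del0 delP] : exists2 del, 0 < del & forall x, Sset x -> del <= f1 x.
  have [S0n|Sn] := pselect (Sset !=set0); last first.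
    by exists 1 => // x Sx; case: Sn; exists x.
  have [|z Sz zP] := compact_min S0n _ cf1.
    by apply: cpt => // x [_ [_ []]].
  exists (f1 z) => //.
  have [/= zr [+ [z2 [/= z3 z4]]]] := Sz.
  rewrite /= oppr_le0 le_eqVlt => /orP[/eqP z1|//]; exfalso.
  have : f2 z < 0.
    apply: strict => //; first exact: lt_le_trans (le_lt_trans z3 rr0) rd.
    apply: contraTneq zr => ->; rewrite subrr normr0 oppr0 -ltNge.
    by rewrite oppr_lt0.
  by move: z2 => /=; rewrite oppr_le0 => /le_lt_trans h /h; rewrite ltxx.
have [e1 e10 e1P] := small_mul 2 g0.
have r2 : 0 < r0 / 2 by rewrite divr_gt0.
have [e2 e20 e2P] := small_mul (2 / g * `|G0|) r2.
have [e3 e30 e3P] := small_mul (2 * a * (2 * (N%:R * (S * `|G0|)) + g)) g0.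
have [e4 e40 e4P] := small_mul (2 * a * S) r00.
have [e5 e50 e5P] := small_mul 1 del0.
pose eps := Num.min (Num.min (Num.min e1 e2) (Num.min e3 e4)) e5.
have eps0 : 0 < eps by rewrite !lt_min e10 e20 e30 e40 e50.
have [h1 h2 h3] : [/\ 0 < eps <= e1, 0 < eps <= e2 & 0 < eps <= e3].
  by split; rewrite eps0 /eps !ge_min lexx ?orbT.
have [h4 h5] : 0 < eps <= e4 /\ 0 < eps <= e5.
  by split; rewrite eps0 /eps !ge_min lexx ?orbT.
clearbody eps.
have f1e x : sqdist y x <= D -> f1 x <= eps * (gauss a y x - expR (- a * D)) ->
    f1 x < del.
  move=> _ /le_lt_trans; apply; apply: le_lt_trans (e5P _ h5); rewrite ler_pM2l//.
  apply: le_trans (gauss_le1 y x a0); rewrite gerBl; exact: expR_ge0.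
pose p := perturb f1 y a (expR (- a * D)) eps.
have Cp : Ck setT 2 p by apply: Ck_perturb; exact: Ck_le C1.
pose K := [set x | p x <= 0] `&` K1.
have Kz0 : K z0.
  split; first by rewrite /= /p perturbE f1z /gauss -/D subrr mulr0 subr0.
  by split=> /=; [rewrite subrr normr0 ltW|].
have Kclosed : closed K.
  apply: closedI => //; apply: closed_sublevel => x; exact: Ck_cont Cp.
have KK1 : K `<=` K1 by move=> x [].
have [|z Kz zmax] := compact_max _ (cpt K KK1 Kclosed) cf2; first by exists z0.
have [f2z0|f2z0] := leP (f2 z) 0.
  have HH x : `|z0 - x| < r0 / 4 -> sqdist y x < sqdist y z0 ->
      f1 x <= eps * (gauss a y x - gauss a y z0) -> f2 x <= 0.
    move=> xr xD xf; apply: le_trans f2z0; apply: zmax; split.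
      by rewrite /= /p perturbE subr_le0.
    by split; apply/ltW.
  exact: (hopf_ray (Ck_le (isT : (2 <= 3)%N) C1) (Ck_le (isT : (1 <= 3)%N) C2)
    f1z f2z g1 k00 g2 nt a0 eps0 q0 HH).
have [/= pz [/= zr zD]] := Kz.
have pz' : f1 z <= eps * (gauss a y z - expR (- a * D)).
  by move: pz; rewrite /p perturbE subr_le0.
have zd : `|z0 - z| < d by exact: lt_le_trans (le_lt_trans zr rr0) rd.
have f1z0 : 0 < f1 z.
  rewrite ltNge; apply/negP => f1n.
  by have := incl z zd zD f1n; rewrite leNgt f2z0.
have zD' : sqdist y z < D.
  rewrite lt_neqAle zD andbT; apply/eqP => E1.
  by move: pz'; rewrite /gauss E1 subrr mulr0 leNgt f1z0.
have zr' : `|z0 - z| < r0 / 4.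
  rewrite ltNge; apply/negP => E1.
  have : Sset z by split=> /=; [rewrite lerN2|rewrite !oppr_le0 !ltW].
  move=> /delP; rewrite leNgt; apply/negP; rewrite negbK.
  exact: (f1e z).
have he1 : 2 * eps <= g by rewrite mulrC ltW// e1P.
have he2 : 2 * eps / g * `|G0| <= r0 / 2.
  have -> : 2 * eps / g * `|G0| = eps * (2 / g * `|G0|) by ring.
  by rewrite ltW// e2P.
have he3 : 2 * eps * a * (2 * (N%:R * (S * `|G0|)) + g) <= g.
  have -> : 2 * eps * a * (2 * (N%:R * (S * `|G0|)) + g) =
    eps * (2 * a * (2 * (N%:R * (S * `|G0|)) + g)) by ring.
  by rewrite ltW// e3P.
have inc x : `|z0 - x| < r0 -> sqdist y x <= D -> f1 x <= 0 -> f2 x <= 0.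
  by move=> xr; apply: incl; exact: lt_le_trans rd.
have c1 x : `|z0 - x| < r0 -> f1 x = 0 -> curv f1 x = k.
  by move=> xr; apply: cv1; exact: lt_le_trans rd.
have c2 x : `|z0 - x| < r0 -> f2 x = 0 -> curv f2 x = k.
  by move=> xr; apply: cv2; exact: lt_le_trans rd.
have zr2 : `|z0 - z| < r0 / 2.
  by apply: lt_trans zr' _; move: r00; clear; lra.
have f1zz : 0 < f1 z <= eps * (gauss a y z - expR (- a * D)) by rewrite f1z0.
apply: (hopf_contact C1 C2 g1 r00 hc a0 eps0 ha he1 he2 he3 (e4P _ h4) inc c1 c2
  zr2 zD' f2z0 f1zz).
have s1 : 0 < r0 / 4 - `|z0 - z| by rewrite subr_gt0.
have s2 : 0 < D - sqdist y z by rewrite subr_gt0.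
have /continuous_atP/(_ _ s2)[d2 d20 d2P] := cs z.
exists (Num.min (r0 / 4 - `|z0 - z|) d2); first by rewrite lt_min s1.
move=> x; rewrite lt_min => /andP[x1 /d2P x2] xf.
apply: zmax; split; first by rewrite /= /p perturbE subr_le0.
split=> /=.
  rewrite -(subrK z z0) -addrA (le_trans (ler_normD _ _))//.
  by move: x1; clear; lra.
by move: x2; rewrite ltr_norml => /andP[H _]; move: H; clear; lra.
Qed.

End Hopf3.

(** * Reflections and moving planes *)

Section Reflection.
Context {R : realType} {N : nat}.
Local Notation E := 'rV[R]_N.
Implicit Types (f g : E -> R) (x y z v w : E) (V : set E).
Variable e : E.
Hypothesis e1 : dot e e = 1.

(** Mirror image in the hyperplane [dot x e = mu]; [refl 0] is also the linear part, acting on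
    directions and gradients. *)
Definition refl (mu : R) x : E := x - (2 * (dot x e - mu)) *: e.

Lemma refl_lin mu x (h : R) v : refl mu (x + h *: v) = refl mu x + h *: refl 0 v.
Proof.
rewrite /refl subr0 !dotE scalerBr addrACA -opprD scalerA -scalerDl.
by congr (_ - _ *: _); ring.
Qed.

Lemma dot_refl_e mu x : dot (refl mu x) e = 2 * mu - dot x e.
Proof. by rewrite /refl !dotE e1; ring. Qed.

Lemma reflK mu : involutive (refl mu).
Proof.
move=> x; rewrite {1}/refl dot_refl_e /refl -addrA -opprD -scalerDl.
have -> : 2 * (dot x e - mu) + 2 * (2 * mu - dot x e - mu) = 0 by ring.
by rewrite scale0r subr0.
Qed.

Lemma dot_refl0 v w : dot (refl 0 v) w = dot v (refl 0 w).
Proof. by rewrite /refl !subr0 !dotE (dotC e w); ring. Qed.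

Lemma dot_refl00 v w : dot (refl 0 v) (refl 0 w) = dot v w.
Proof. by rewrite dot_refl0 reflK. Qed.

Lemma refl_sub mu x y : refl mu x - refl mu y = refl 0 (x - y).
Proof.
have := refl_lin mu y 1 (x - y); rewrite !scale1r addrC subrK => ->.
by rewrite addrC addKr.
Qed.

Lemma refl_fix mu x : dot x e = mu -> refl mu x = x.
Proof. by move=> xe; rewrite /refl xe subrr mulr0 scale0r subr0. Qed.

Lemma refl0_eq0 v : (refl 0 v == 0) = (v == 0).
Proof.
have r0 : refl 0 0 = 0 by rewrite /refl dot0l subrr mulr0 scale0r subr0.
by apply/eqP/eqP => [H|->//]; rewrite -(reflK 0 v) H.
Qed.

Lemma norm_refl_sub mu x y : `|refl mu x - refl mu y| <= eucl (x - y).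
Proof.
by apply: le_trans (norm_le_eucl _) _; rewrite refl_sub !euclE dot_refl00.
Qed.

Lemma eucl_le_norm v : eucl v <= (N%:R + 1) * `|v|.
Proof.
have H : dot v v <= ((N%:R + 1) * `|v|) ^+ 2.
  apply: le_trans (ler_norm _) _; apply: le_trans (dot_le_norm _ _) _.
  rewrite exprMn -expr2; apply: ler_wpM2r; first exact: sqr_ge0.
  apply: (@le_trans _ _ (N%:R + 1)); first by rewrite lerDl.
  by rewrite expr2; apply: ler_peMr; rewrite ?lerDr ?addr_ge0.
have M0 : 0 <= (N%:R + 1) * `|v| by rewrite mulr_ge0// addr_ge0.
by rewrite -(ler_pXn2r (n := 2)) ?nnegrE ?eucl_ge0// eucl_sqr.
Qed.

(** A reflection does not preserve the max norm; the detour through the Euclidean norm costs the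
    factor. *)
Lemma refl_lipschitz mu x y : `|refl mu x - refl mu y| <= (N%:R + 1) * `|x - y|.
Proof. exact: le_trans (norm_refl_sub _ _ _) (eucl_le_norm _). Qed.

Lemma refl_near mu x (d : R) : 0 < d -> exists2 d', 0 < d' &
  forall y, `|x - y| < d' -> `|refl mu x - refl mu y| < d.
Proof.
move=> d0; have N0 : 0 < (N%:R + 1 : R) by rewrite ltr_wpDl.
exists (d / (N%:R + 1)) => [|y]; first by rewrite divr_gt0.
rewrite ltr_pdivlMr// mulrC; apply: le_lt_trans; exact: refl_lipschitz.
Qed.

Lemma is_derive_refl f mu x v : derivable f (refl mu x) (refl 0 v) ->
  is_derive x v (f \o refl mu) ('D_(refl 0 v) f (refl mu x)).
Proof.
move=> /derivableP/line_is_derive0 D; apply/line_is_derive0.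
by under eq_fun do rewrite /= refl_lin.
Qed.

Lemma Ck_refl n f mu : Ck setT n f -> Ck setT n (f \o refl mu).
Proof.
have cont g : (forall x, {for x, continuous g}) ->
    forall x, {for x, continuous (g \o refl mu)}.
  move=> cg x; apply/continuous_atP => d d0.
  have /continuous_atP/(_ _ d0)[d1 d10 d1P] := cg (refl mu x).
  have [d2 d20 d2P] := refl_near mu x d10.
  by exists d2 => // y /d2P/d1P.
elim: n f => [|n IH] f Cf.
  by apply: Ck0P => x _; apply: cont => y; exact: (Ck_continuous Cf I).
apply: (@Ck_deriveP _ _ _ openT n _ (fun v => 'D_(refl 0 v) f \o refl mu)).
- by move=> x _; apply: cont => y; exact: (Ck_continuous Cf I).
- move=> x v _; exact/is_derive_refl/(Ck_derivable Cf I).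
- by move=> v; apply/IH/Ck_derive.
Qed.

Lemma grad_refl f mu x : Ck setT 1 f ->
  grad (f \o refl mu) x = refl 0 (grad f (refl mu x)).
Proof.
move=> Cf; apply/rowP => i.
rewrite -!dot_evec -(derive_dot openT _ (Ck_refl mu Cf) I) dot_refl0.
rewrite -(derive_dot openT _ Cf I).
by have [_ ->] := is_derive_refl (Ck_derivable (v := refl 0 (evec R i)) Cf (I : setT (refl mu x))).
Qed.

Lemma derive2_refl f mu x v : Ck setT 2 f -> 'D_v ('D_v (f \o refl mu)) x =
  'D_(refl 0 v) ('D_(refl 0 v) f) (refl mu x).
Proof.
move=> Cf; have -> : 'D_v (f \o refl mu) = 'D_(refl 0 v) f \o refl mu.
  apply/funext => y.
  by have [_ ->] := is_derive_refl (Ck_derivable (v := refl 0 v)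
    (Ck_le (isT : (1 <= 2)%N) Cf) (I : setT (refl mu y))).
by have [_ ->] := is_derive_refl (Ck_derivable (v := refl 0 v)
    (Ck_derive (refl 0 v) Cf) (I : setT (refl mu x))).
Qed.

Lemma laplacian_refl f mu x : Ck setT 2 f ->
  laplacian (f \o refl mu) x = laplacian f (refl mu x).
Proof.
move=> Cf; rewrite [LHS]/laplacian.
under eq_bigr do rewrite derive2_refl// (derive2_hess openT _ Cf I).
rewrite laplacian_hess; set H := hess f _.
have E1 i : dot (refl 0 (evec R i) *m H) (refl 0 (evec R i)) =
    H i i - 2 * (e 0 i * dot (evec R i *m H) e)
    - 2 * (e 0 i * (e *m H) 0 i) + 4 * dot (e *m H) e * (e 0 i * e 0 i).
  rewrite /refl subr0 (dotC _ e) dot_evec mulmxDl mulNmx -scalemxAl !dotE.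
  by rewrite !dot_evec evec_mul; ring.
under eq_bigr do rewrite E1.
rewrite !big_split/= !sumrN -!mulr_sumr dot_mulmx_sum//.
have -> : \row_i e 0 i = e by apply/rowP => i; rewrite mxE.
rewrite -/(dot e e) -/(dot e (e *m H)) (dotC e (e *m H)) e1.
by move: (\sum_i _) => A; ring.
Qed.

(** The Laplacian, the Hessian form on the gradient and the length of the gradient are each
    invariant under the isometry; [quot] records how [curv] is built from them, so that the
    invariances are substituted together. *)
Lemma curv_refl f mu x : Ck setT 2 f -> curv (f \o refl mu) x = curv f (refl mu x).
Proof.
move=> Cf; have Cf1 : Ck setT 1 f by exact: Ck_le Cf.
have Eg := grad_refl mu x Cf1.
pose quot (a b c d : R) := (a - b / c) / d.
have Er := etrans (congr1 (refl 0) Eg) (reflK 0 _).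
have Ed := etrans (congr1 (fun u => dot u u) Eg) (dot_refl00 _ _).
apply: (f_equal4 quot).
- exact: (laplacian_refl mu x Cf).
- apply: etrans (esym (derive2_hess openT (grad (f \o refl mu) x) (Ck_refl mu Cf) I)) _.
  apply: etrans (derive2_refl mu x (grad (f \o refl mu) x) Cf) _.
  rewrite Er; exact: (derive2_hess openT _ Cf I).
- exact: Ed.
- apply: etrans (euclE _) _; apply: etrans (congr1 Num.sqrt Ed) _.
  exact: esym (euclE _).
Qed.

End Reflection.

(** * Sublevel domains and good positions of the plane *)

Section Domain.
Context {R : realType} {N : nat}.
Local Notation E := 'rV[R]_N.
Implicit Types (x y z p q v w : E).

Record regular_domain (O : set E) (rho : E -> R) (M : R) : Prop := {
  rd_open : open O;
  rd_bound : forall x, O x -> `|x| <= M;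
  rd_Ck : forall n, Ck setT n rho;
  rd_def : forall x, O x <-> rho x < 0;
  rd_grad : forall p, bdry O p -> grad rho p != 0 }.

Variables (O : set E) (rho : E -> R) (M : R).
Hypothesis H : regular_domain O rho M.

Let C1 : Ck setT 1 rho := rd_Ck H 1.

Lemma rho_cont x : {for x, continuous rho}.
Proof. exact: Ck_cont C1. Qed.

Lemma closure_rho_le0 x : closure O x -> rho x <= 0.
Proof.
have : closed [set x | rho x <= 0] by apply: closed_sublevel => y; exact: rho_cont.
move=> /closure_id cE Ox; suff : [set x | rho x <= 0] x by [].
by rewrite cE; apply: closureS Ox => y /(rd_def H)/ltW.
Qed.

Lemma bdry_rho p : bdry O p -> rho p = 0.
Proof.
move=> [/closure_rho_le0 p1 /(rd_def H)/negP]; rewrite -leNgt => p2.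
by apply/eqP; rewrite eq_le p1.
Qed.

Lemma closure_cases x : closure O x -> O x \/ bdry O x.
Proof. by move=> cx; have [|] := pselect (O x); [left|right]. Qed.

Lemma O_closure x : O x -> closure O x.
Proof. exact: subset_closure. Qed.

Lemma closure_norm x : closure O x -> `|x| <= M.
Proof.
have : closed [set x : E | `|x| <= M].
  by apply: closed_sublevel => y; exact: norm_continuous.
move=> /closure_id cE Ox; suff : [set x : E | `|x| <= M] x by [].
by rewrite cE; apply: closureS Ox => y /(rd_bound H).
Qed.

Lemma compact_closure : compact (closure O).
Proof.
by apply: closed_bounded_compact closure_norm; exact: closed_closure.
Qed.

Lemma ray_in p w : rho p <= 0 -> dot (grad rho p) w < 0 ->
  exists2 d, 0 < d & forall h, 0 < h < d -> O (p + h *: w).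
Proof.
move=> p0 pw; have [d d0 dP] := ray_lt openT C1 I pw.
exists d => // h /dP; rewrite mul0r addr0 => /lt_le_trans hp.
by apply/(rd_def H)/hp.
Qed.

Lemma ray_out p w : 0 <= rho p -> 0 < dot (grad rho p) w ->
  exists2 d, 0 < d & forall h, 0 < h < d -> 0 < rho (p + h *: w).
Proof.
move=> p0 pw; have [d d0 dP] := ray_gt openT C1 I pw.
by exists d => // h /dP; exact: le_lt_trans.
Qed.

Lemma curve_line_small p w (d : R) : 0 < d -> exists2 d', 0 < d' &
  forall h, 0 < h < d' -> `|p - (p + h *: w)| < d.
Proof.
move=> d0; have [d' d'0 d'P] := curve_small p w 0 d0.
by exists d' => // h /d'P; rewrite scaler0 addr0.
Qed.

(** Moving against a nonzero gradient enters [rho < 0] at once. *)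
Lemma rho_le0_closure x : rho x <= 0 -> grad rho x != 0 -> closure O x.
Proof.
move=> x0 gx; apply/closureP => d d0.
have gg : dot (grad rho x) (- grad rho x) < 0 by rewrite dotNr oppr_lt0 dot_gt0.
have [d1 d10 d1P] := ray_in x0 gg.
have [d2 d20 d2P] := curve_line_small x (- grad rho x) d0.
have m0 : 0 < Num.min d1 d2 by rewrite lt_min d10.
have [h0] := half_gt0_lt m0; rewrite lt_min => /andP[h1 h2].
exists (x + (Num.min d1 d2 / 2) *: - grad rho x); first by apply: d1P; rewrite h0.
by apply: d2P; rewrite h0.
Qed.

Lemma bdry_near p : bdry O p -> exists2 d, 0 < d & forall x, `|p - x| < d ->
  grad rho x != 0.
Proof.
move=> /(rd_grad H) gp.
exact: (open_ball (grad_neq0_open C1) (gp : [set x | grad rho x != 0] p)).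
Qed.

Lemma rho0_bdry x : rho x = 0 -> grad rho x != 0 -> bdry O x.
Proof.
move=> x0 gx; split; first by apply: rho_le0_closure; rewrite ?x0.
by move=> /(rd_def H); rewrite x0 ltxx.
Qed.

(** From a boundary point the ray along [grad rho] leaves the closure immediately. *)
Lemma closure_interior x (d : R) : 0 < d ->
  (forall y, `|x - y| < d -> closure O y) -> O x.
Proof.
move=> d0 dP; have : closure O x by apply: dP; rewrite subrr normr0.
case/closure_cases => // bx; exfalso.
have gx := rd_grad H bx.
have gg : 0 < dot (grad rho x) (grad rho x) by exact: dot_gt0.
have [|d1 d10 d1P] := ray_out _ gg; first by rewrite (bdry_rho bx).
have [d2 d20 d2P] := curve_line_small x (grad rho x) d0.
have m0 : 0 < Num.min d1 d2 by rewrite lt_min d10.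
have [h0] := half_gt0_lt m0; rewrite lt_min => /andP[h1 h2].
have := d1P (Num.min d1 d2 / 2); rewrite h0 h1 => /(_ isT).
rewrite ltNge closure_rho_le0//; apply: dP; apply: d2P; by rewrite h0.
Qed.

Lemma bdry_closed : closed (bdry O).
Proof.
have -> : bdry O = closure O `&` ~` O by [].
by apply: closedI; [exact: closed_closure|exact/open_closedC/(rd_open H)].
Qed.

Lemma not_closure_near x : ~ closure O x ->
  exists2 d, 0 < d & forall y, `|x - y| < d -> ~ closure O y.
Proof.
move=> nx; apply: (@open_ball R N (~` closure O)) => //.
exact/closed_openC/closed_closure.
Qed.

Lemma O_near x : O x -> exists2 d, 0 < d & forall y, `|x - y| < d -> O y.
Proof. exact/open_ball/(rd_open H). Qed.

Lemma not_bdry_near x : ~ bdry O x ->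
  exists2 d, 0 < d & forall y, `|x - y| < d -> ~ bdry O y.
Proof.
move=> nx; apply: (@open_ball R N (~` bdry O)) => //.
exact/closed_openC/bdry_closed.
Qed.

Section Direction.
Variable e : E.
Hypothesis e1 : dot e e = 1.

(** Both conditions are strict, which makes being good an open condition on [mu]. *)
Definition good (mu : R) : Prop :=
  (forall x, closure O x -> mu < dot x e -> O (refl e mu x)) /\
  (forall x, bdry O x -> dot x e = mu -> 0 < dot (grad rho x) e).

Lemma dot_cont (w x : E) : {for x, continuous (fun x => dot x w)}.
Proof. exact: Ck_cont (Ck_dot 0 w openT). Qed.

Lemma dot_near_e x (d : R) : 0 < d -> exists2 d', 0 < d' &
  forall y, `|x - y| < d' -> `|dot x e - dot y e| < d.
Proof. by move=> d0; have /continuous_atP/(_ _ d0) := @dot_cont e x. Qed.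

Lemma refl_near2 mu x (d : R) : 0 < d -> exists2 d', 0 < d' &
  forall y nu, `|x - y| < d' -> `|mu - nu| < d' ->
    `|refl e mu x - refl e nu y| < d.
Proof.
move=> d0; have [d20 d2l] := half_gt0_lt d0.
have [d1 d10 d1P] := refl_near e1 mu x d20.
have e0 : 0 < `|e| + 1 by rewrite ltr_wpDl.
exists (Num.min d1 (d / 2 / (2 * (`|e| + 1)))) => [|y nu].
  by rewrite lt_min d10 divr_gt0// mulr_gt0.
rewrite !lt_min => /andP[/d1P A _] /andP[_ B].
have -> : refl e mu x - refl e nu y =
   (refl e mu x - refl e mu y) + (2 * (mu - nu)) *: e.
  by apply/rowP => i; rewrite /refl !mxE; ring.
apply: le_lt_trans (ler_normD _ _) _.
have : `|(2 * (mu - nu)) *: e| <= d / 2.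
  rewrite normrZ normrM gtr0_norm//.
  have : 2 * `|mu - nu| * `|e| <= 2 * (`|e| + 1) * `|mu - nu|.
    have : 0 <= `|mu - nu| by []. lra.
  move/le_trans; apply.
  by rewrite mulrC -ler_pdivlMr ?mulr_gt0// ltW.
by move: A; lra.
Qed.

(** Compactness of the closure reduces the claim to neighbourhoods of single points. The delicate
    ones are boundary points on the plane: near them [rho] strictly decreases along [- e], and the
    mirror image of a nearby point is reached by moving along [- e]. *)
Lemma good_open mu : good mu ->
  exists2 d, 0 < d & forall nu, `|mu - nu| < d -> good nu.
Proof.
move=> [gA gB].
pose P x nu := (nu < dot x e -> closure O x -> O (refl e nu x)) /\
  (bdry O x -> dot x e = nu -> 0 < dot (grad rho x) e).
have [|d d0 dP] := @compact_uniform R N (closure O) mu P compact_closure; last first.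
  exists d => // nu /dP PN; split=> x; first by move=> cx lt; exact: ((PN x cx).1 lt cx).
  by move=> bx xe; exact: ((PN x bx.1).2 bx xe).
move=> x cx; have [lt|gt|eq] := ltgtP mu (dot x e).
- have Oy := gA x cx lt.
  have [d1 d10 d1P] := O_near Oy.
  have [d2 d20 d2P] := refl_near2 mu x d10.
  have s0 : 0 < (dot x e - mu) / 2 by rewrite divr_gt0// subr_gt0.
  have [d3 d30 d3P] := dot_near_e x s0.
  exists (Num.min (Num.min d2 d3) ((dot x e - mu) / 2)).
    by rewrite !lt_min d20 d30.
  move=> x' nu; rewrite !lt_min => /andP[/andP[a1 a2] a3] /andP[/andP[b1 b2] b3].
  split=> [_ _|_ xe]; first exact/d1P/d2P.
  have := d3P _ a2; move: b3; rewrite xe !ltr_norml.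
  by move: lt; lra.
- have s0 : 0 < (mu - dot x e) / 2 by rewrite divr_gt0// subr_gt0.
  have [d3 d30 d3P] := dot_near_e x s0.
  exists (Num.min d3 ((mu - dot x e) / 2)); first by rewrite lt_min d30.
  move=> x' nu; rewrite !lt_min => /andP[/d3P a2 _] /andP[_ b3].
  by move: a2 b3; rewrite !ltr_norml => a2 b3; split=> [lt _|_ xe]; exfalso;
    [move: a2 b3 gt lt|move: a2 b3 gt xe]; lra.
case: (closure_cases cx) => [Ox|bx].
  have [d1 d10 d1P] := O_near Ox.
  have [d2 d20 d2P] := refl_near2 mu x d10.
  exists (Num.min d1 d2); first by rewrite lt_min d10.
  move=> x' nu; rewrite !lt_min => /andP[a1 a2] /andP[b1 b2]; split=> [_ _|[_]].
    by apply: d1P; rewrite -{1}(refl_fix (esym eq)); exact: d2P.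
  by have := d1P _ a1.
have g0 := gB x bx (esym eq).
have [d1 d10 d1P] := derive_continuous openT e C1 (I : setT x) g0.
have gpos y : `|x - y| < d1 -> 0 < dot (grad rho y) e.
  by move=> /d1P; rewrite ltr_norml => /andP[_ h]; move: h; lra.
have [d10' d1l] := half_gt0_lt d10.
have [d2 d20 d2P] := refl_near2 mu x d10.
exists (Num.min d1 d2); first by rewrite lt_min d10.
move=> x' nu; rewrite !lt_min => /andP[a1 a2] /andP[b1 b2].
split=> [lt cx'|_ _]; last exact: gpos.
have t0 : 0 < 2 * (dot x' e - nu) by rewrite mulr_gt0// subr_gt0.
have E1 : refl e nu x' = x' + (2 * (dot x' e - nu)) *: - e.
  by rewrite /refl scalerN.
have n1 : `|x - refl e nu x'| < d1.
  by rewrite -{1}(refl_fix (esym eq)); exact: d2P.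
apply/(rd_def H).
have [|s /andP[s0 st] Es] := @line_mvt R N rho x' (- e) _ t0.
  by move=> s _; exact: (Ck_derivable C1).
have nb : `|x - (x' + s *: - e)| < d1.
  pose l := s / (2 * (dot x' e - nu)).
  have l0 : 0 < l by rewrite divr_gt0.
  have l1 : l < 1 by rewrite ltr_pdivrMr// mul1r.
  have sl : s = l * (2 * (dot x' e - nu)) by rewrite /l divfK// gt_eqF.
  clearbody l.
  have -> : x - (x' + s *: - e) = (1 - l) *: (x - x') + l *: (x - refl e nu x').
    by rewrite E1 sl; apply/rowP => i; rewrite !mxE; ring.
  apply: le_lt_trans (ler_normD _ _) _; rewrite !normrZ (gtr0_norm l0).
  rewrite gtr0_norm ?subr_gt0//.
  have A : (1 - l) * `|x - x'| < (1 - l) * d1 by rewrite ltr_pM2l// subr_gt0.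
  have B : l * `|x - refl e nu x'| < l * d1 by rewrite ltr_pM2l.
  by move: A B; lra.
have := gpos _ nb; rewrite E1 => gp.
move: Es; rewrite (derive_dot openT _ C1 I) dotNr mulrN => Es.
have P0 : 0 < 2 * (dot x' e - nu) * dot (grad rho (x' + s *: - e)) e by exact: mulr_gt0.
have := closure_rho_le0 cx'; move: Es P0; lra.
Qed.

(** [L] is the maximum of [dot x e] on the closure. At a maximum point [e] is a positive multiple of
    the gradient. *)
Lemma good_large : O !=set0 -> exists L, forall mu, L <= mu -> good mu.
Proof.
move=> [w0 Oo].
have [||z cz zP] := @compact_max R N (closure O) (fun x => dot x e) _ compact_closure.
- by exists w0; exact: O_closure.
- by move=> x; exact: dot_cont.
exists (dot z e) => mu zmu; split=> x cx.
  by move=> /(le_lt_trans zmu); rewrite ltNge zP.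
move=> xmu; have cx' := cx.1.
have xz : dot x e = dot z e.
  by apply/eqP; rewrite eq_le zP// xmu zmu.
have gx := rd_grad H cx.
have [|k k0 ek] := @collinear_halfspace R N (grad rho x) e gx.
  move=> w gw; rewrite leNgt; apply/negP => ew.
  have [|d d0 dP] := ray_in _ gw; first by rewrite (bdry_rho cx).
  have [h0 hd] := half_gt0_lt d0.
  have := dP (d / 2); rewrite h0 hd => /(_ isT)/O_closure/zP.
  rewrite -xz !dotE (dotC w e) leNgt => /negP; apply.
  by rewrite ltrDl mulr_gt0.
have kn : k != 0.
  by apply: contraPneq e1 => k00; rewrite ek k00 scale0r dot0l => /esym/eqP; rewrite oner_eq0.
rewrite ek dotZr mulr_gt0//; first by rewrite lt_neqAle eq_sym kn.
exact: dot_gt0.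
Qed.

Lemma good_lower : O !=set0 -> exists B, forall mu, good mu -> B <= mu.
Proof.
move=> [w0 Oo]; pose B := - (N%:R * (M * `|e|)).
have lo x : O x -> B <= dot x e.
  move=> Ox; rewrite /B lerNl; apply: le_trans (ler_norm _) _; rewrite normrN.
  apply: le_trans (dot_le_norm _ _) _; apply: ler_wpM2l => //.
  by apply: ler_wpM2r => //; exact: rd_bound H _ Ox.
exists B => mu [gA _]; have [|lt] := leP (dot w0 e) mu.
  exact/le_trans/lo.
have := lo _ (gA w0 (O_closure Oo) lt); rewrite dot_refl_e//.
by have := lo _ Oo; move: lt; lra.
Qed.

(** [lam] is the infimum of the positions above which everything is good, and [good_open] prevents
    it from being good itself. The set [A] collects negatives, so that a supremum can be taken. *)
Lemma critical_position : O !=set0 ->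
  exists2 lam, (forall mu, lam < mu -> good mu) & ~ good lam.
Proof.
move=> O0; have [L LP] := good_large O0; have [B BP] := good_lower O0.
pose A := [set s : R | forall mu, - s <= mu -> good mu].
have [|x Ax|s sA sP] := @sup_exists R A (- L) (- B).
- by move=> mu; rewrite opprK; exact: LP.
- by rewrite lerNr; apply: BP; exact: Ax.
exists (- s) => [mu smu|gs].
  have d0 : 0 < mu + s by rewrite -(opprK s) subr_gt0.
  have [x Ax xs] := sP _ d0; apply: Ax; rewrite lerNl.
  by move: xs; lra.
have [d d0 dP] := good_open gs.
have [h0 hd] := half_gt0_lt d0.
have : A (s + d / 2).
  move=> mu smu; have [mu1|mu1] := leP mu (- s).
    by apply: dP; rewrite ger0_norm ?subr_ge0//; move: smu hd; lra.
  have d0' : 0 < mu + s by rewrite -(opprK s) subr_gt0.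
  have [x Ax xs] := sP _ d0'; apply: Ax; rewrite lerNl.
  by move: xs; lra.
by move=> /sA; rewrite gerDl leNgt h0.
Qed.

End Direction.
End Domain.

(** * Contact at the critical position *)

Section Symmetry.
Context {R : realType} {N : nat}.
Local Notation E := 'rV[R]_N.
Implicit Types (x y z p q v w : E).
Variables (O : set E) (rho : E -> R) (M k : R).
Hypothesis H : regular_domain O rho M.
Hypothesis curvk : forall p, bdry O p -> curv rho p = k.
Variables (e : E) (lam : R).
Hypothesis e1 : dot e e = 1.
Hypothesis good_gt : forall mu, lam < mu -> good O rho e mu.

Let C1 : Ck setT 1 rho := rd_Ck H 1.
Local Notation Rl := (refl e lam).

(** A point beyond the plane is reflected into [O] by all planes slightly beyond it; let [mu]
    decrease to [lam]. *)
Lemma cap_closure x : closure O x -> lam <= dot x e -> closure O (Rl x).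
Proof.
move=> cx; rewrite le_eqVlt => /orP[/eqP/esym/refl_fix -> //|lt].
apply/closureP => d d0.
have [d1 d10 d1P] := refl_near2 e1 lam x d0.
pose m := Num.min d1 (dot x e - lam).
have m0 : 0 < m by rewrite lt_min d10 subr_gt0.
have [h0] := half_gt0_lt m0; rewrite {2}/m lt_min => /andP[h1 h2].
exists (refl e (lam + m / 2) x).
  have lm : lam < lam + m / 2 by rewrite ltrDl.
  have [gA _] := good_gt lm; apply: gA => //.
  by move: h2; lra.
apply: d1P; first by rewrite subrr normr0.
by rewrite opprD addrA subrr sub0r normrN gtr0_norm.
Qed.

Lemma cap_bdry x : bdry O x -> lam < dot x e -> 0 < dot (grad rho x) e.
Proof. by move=> bx /good_gt[_ gB]; exact: gB. Qed.

Lemma cap_near x : lam < dot x e ->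
  exists2 d, 0 < d & forall y, `|x - y| < d -> lam < dot y e.
Proof.
rewrite -subr_gt0 => s0; have [d d0 dP] := dot_near_e e x s0.
by exists d => // y /dP; rewrite ltr_norml => /andP[_]; lra.
Qed.

(** The reflection maps a ball around [x] onto a neighbourhood of [Rl x] inside the closure, and
    [closure_interior] concludes. *)
Lemma cap_O x : O x -> lam < dot x e -> O (Rl x).
Proof.
move=> Ox xl; have [d1 d10 d1P] := O_near H Ox.
have [d2 d20 d2P] := cap_near xl.
have m0 : 0 < Num.min d1 d2 by rewrite lt_min d10.
have [d3 d30 d3P] := refl_near e1 lam (Rl x) m0.
apply: (closure_interior H d30) => y /d3P; rewrite reflK// lt_min => /andP[y1 y2].
rewrite -(reflK e1 lam y); apply: cap_closure; last exact/ltW/d2P.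
exact/O_closure/d1P.
Qed.

Definition touching p : Prop := [/\ bdry O p, lam < dot p e & bdry O (Rl p)].

Lemma bdry_curv_near p : bdry O p -> exists2 d, 0 < d & forall x, `|p - x| < d ->
  [/\ rho x <= 0 -> closure O x, rho x = 0 -> bdry O x & rho x = 0 -> curv rho x = k].
Proof.
move=> bp; have [d d0 dP] := bdry_near H bp; exists d => // x /dP gx; split.
- by move=> x0; exact: (rho_le0_closure H).
- by move=> x0; exact: (rho0_bdry H).
- by move=> x0; exact/curvk/(rho0_bdry H).
Qed.

(** This is [surface_hopf] for [rho] and [rho \o Rl]: the reflected cap gives the inclusion, the
    absence of other contact points in the ball gives strictness, and reflection preserves
    curvature. *)
Lemma touching_hopf z0 y (k0 d : R) : bdry O z0 -> bdry O (Rl z0) -> 0 < k0 ->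
  refl e 0 (grad rho (Rl z0)) = k0 *: grad rho z0 ->
  (forall c : R, z0 - y != c *: grad rho z0) -> 0 < d ->
  (forall x, `|z0 - x| < d -> sqdist y x <= sqdist y z0 -> lam <= dot x e) ->
  (forall x, `|z0 - x| < d -> sqdist y x <= sqdist y z0 -> bdry O x -> x != z0 ->
    ~ bdry O (Rl x)) -> False.
Proof.
move=> bz bRz k00 gz nt d0 cap noZ.
have [d1 d10 d1P] := bdry_curv_near bz.
have [d2 d20 d2P] := bdry_curv_near bRz.
have [d3 d30 d3P] := refl_near e1 lam z0 d20.
pose m := Num.min (Num.min d d1) d3.
have m0 : 0 < m by rewrite !lt_min d0 d10 d30.
have ml x : `|z0 - x| < m -> [/\ `|z0 - x| < d, `|z0 - x| < d1 & `|Rl z0 - Rl x| < d2].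
  by rewrite !lt_min => /andP[/andP[a b] /d3P].
have C2 : Ck setT 2 rho := rd_Ck H 2.
have cap2 x : `|z0 - x| < m -> sqdist y x <= sqdist y z0 -> rho x <= 0 ->
    closure O (Rl x).
  move=> /ml[a b c] xD x0; apply: cap_closure; last exact: cap.
  by have [/(_ x0)] := d1P x b.
have Eg : grad (rho \o Rl) z0 = k0 *: grad rho z0 by rewrite grad_refl.
have incl x : `|z0 - x| < m -> sqdist y x <= sqdist y z0 -> rho x <= 0 ->
    (rho \o Rl) x <= 0.
  by move=> xm xD x0; exact/(closure_rho_le0 H)/cap2.
have strict x : `|z0 - x| < m -> sqdist y x <= sqdist y z0 -> rho x = 0 ->
    x != z0 -> (rho \o Rl) x < 0.
  move=> xm xD x0 xz; have [a b c] := ml _ xm.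
  have bx : bdry O x by have [_ /(_ x0)] := d1P x b.
  have : closure O (Rl x) by apply: cap2 => //; rewrite x0.
  move=> /closure_cases[/(rd_def H)//|bRx].
  by exfalso; exact: (noZ x a xD bx xz bRx).
have c1 x : `|z0 - x| < m -> rho x = 0 -> curv rho x = k.
  by move=> /ml[_ b _] x0; have [_ _ /(_ x0)] := d1P x b.
have c2 x : `|z0 - x| < m -> (rho \o Rl) x = 0 -> curv (rho \o Rl) x = k.
  move=> /ml[_ _ c] x0; apply: etrans (curv_refl e1 lam x C2) _.
  by have [_ _ /(_ x0)] := d2P _ c.
exact: (surface_hopf (rd_Ck H 3) (Ck_refl e1 lam (rd_Ck H 3)) (bdry_rho H bz)
  (bdry_rho H bRz) (rd_grad H bz) k00 Eg nt m0 incl strict c1 c2).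
Qed.

Lemma touching_grad z : touching z ->
  exists2 k0, 0 < k0 & refl e 0 (grad rho (Rl z)) = k0 *: grad rho z.
Proof.
move=> [bz zl bRz]; rewrite -grad_refl//.
apply: (contact_grad openT C1 (Ck_refl e1 lam C1) I).
- by rewrite (bdry_rho H bz).
- have [d1 d10 d1P] := bdry_curv_near bz.
  have [d2 d20 d2P] := cap_near zl.
  exists (Num.min d1 d2); first by rewrite lt_min d10.
  move=> y; rewrite lt_min => /andP[/d1P[+ _ _] /d2P yl] y0.
  move=> /(_ y0) cy; rewrite /= (bdry_rho H bRz).
  by apply: (closure_rho_le0 H); apply: cap_closure => //; exact: ltW.
- exact: rd_grad H _ bz.
- by rewrite grad_refl// refl0_eq0//; exact: rd_grad H _ bRz.
Qed.

Lemma gradients_near p : bdry O p -> exists2 d, 0 < d & forall x y,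
  `|p - x| < d -> `|p - y| < d -> 0 < dot (grad rho x) (grad rho y).
Proof.
move=> bp; have gg := dot_gt0 (rd_grad H bp).
have [d1 d10 d1P] := dot_near (grad rho p) (grad rho p) gg.
have [d2 d20 d2P] := grad_near p C1 d10.
exists d2 => // x y /d2P xp /d2P yp.
have := d1P _ _ xp yp; rewrite ltr_norml => /andP[_].
by rewrite ltrBlDr -ltrBlDl subrr.
Qed.

(** Strong maximum principle. If a boundary point [x] near [p] were not touching, let [z0] be a
    contact point near [p] nearest to [x] in Euclidean distance. A ball between them, with [z0] on
    its sphere, contains no other contact point near [z0], against [touching_hopf]. *)
Lemma touching_open p : touching p -> exists2 d, 0 < d & forall x,
  bdry O x -> `|p - x| < d -> touching x.
Proof.
move=> [bp pl bRp].
have [d1 d10 d1P] := gradients_near bp.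
have [d2 d20 d2P] := cap_near pl.
pose r := Num.min d1 d2 / 2.
have m0 : 0 < Num.min d1 d2 by rewrite lt_min d10.
have [r0] := half_gt0_lt m0; rewrite -/r lt_min => /andP[r1 r2].
have M0 : 0 < (N%:R + 3 : R) by rewrite ltr_wpDl.
exists (r / (N%:R + 3)) => [|x bx]; first by rewrite divr_gt0.
rewrite ltr_pdivlMr// => px.
have pxr : `|p - x| < r.
  have : 0 <= `|p - x| by []. have : 0 <= (N%:R : R) by [].
  by move=> n0 a0; have := mulr_ge0 a0 n0; move: px; lra.
have [//|nx] := pselect (touching x); exfalso.
have xl : lam < dot x e by apply: d2P; exact: lt_trans r2.
have nRx : ~ bdry O (Rl x) by move=> bRx; exact: nx.
pose K := [set z | bdry O z] `&` [set z | bdry O (Rl z)] `&` [set z | `|p - z| <= r].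
have cK : closed K.
  apply: closedI; last by apply: closed_sublevel => z; exact: norm_sub_continuous.
  apply: closedI; first exact: bdry_closed H.
  apply: closed_normP => z /= nz; have [c c0 cP] := not_bdry_near H nz.
  by have [c' c'0 c'P] := refl_near e1 lam z c0; exists c' => // y /c'P/cP.
have Kp : K p by split; [split|rewrite /= subrr normr0 ltW].
have [|||z0 Kz zmin] := @compact_min R N K (sqdist x).
- by exists p.
- apply: (@closed_bounded_compact _ _ _ M) => // z [[[cz _] _] _].
  exact: closure_norm H _ cz.
- by move=> z; exact: Ck_cont (Ck_sqdist 0 x openT).
have [[/= bz bRz] pz] := Kz.
have zl : lam < dot z0 e by apply: d2P; exact: le_lt_trans r2.
have Tz : touching z0 by [].
have xz : x != z0 by apply: contra_notN nRx => /eqP ->.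
have dxz : `|p - z0| < r.
  have A : `|x - z0| <= (N%:R + 1) * `|p - x|.
    rewrite distrC; apply: le_trans (norm_le_eucl _) _.
    apply: le_trans (eucl_le_norm _); rewrite !euclE ler_wsqrtr//.
    exact: zmin.
  have -> : p - z0 = (p - x) + (x - z0) by rewrite addrA subrK.
  apply: le_lt_trans (ler_normD _ _) _.
  by have : 0 <= `|p - x| by []; move: A px; lra.
have [k0 k00 gz] := touching_grad Tz.
(* The ball with diameter from [z0] to [x] is internally tangent at [z0] to the ball around [x],
   whose interior is free of points of [K]. *)
pose y := z0 + (2^-1 : R) *: (x - z0).
have [d3 d30 d3P] := cap_near zl.
have s0 : 0 < r - `|p - z0| by rewrite subr_gt0.
apply: (@touching_hopf z0 y k0 (Num.min d3 (r - `|p - z0|))) => //.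
(* If [x - z0] were normal to the surface at [z0], then [rho] would vanish at both ends of a segment
   along [grad rho z0], and the mean value theorem would give two orthogonal gradients near [p]. *)
- move=> c; apply/eqP => Ec.
  have Ex : x = z0 + (- 2 * c) *: grad rho z0.
    have : (-2) *: (z0 - y) = (- 2 * c) *: grad rho z0 by rewrite Ec scalerA.
    by move=> <-; rewrite /y; apply/rowP => i; rewrite !mxE; field.
  pose t := - 2 * c.
  have t0 : t != 0.
    by apply: contra_neq xz => t0; rewrite Ex -/t t0 scale0r addr0.
  have seg (s : R) : 0 <= s <= 1 -> `|p - (z0 + s *: (t *: grad rho z0))| < d1.
    move=> /andP[s0' s1].
    have -> : p - (z0 + s *: (t *: grad rho z0)) = (1 - s) *: (p - z0) + s *: (p - x).
      by rewrite Ex -/t; apply/rowP => i; rewrite !mxE; ring.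
    apply: le_lt_trans (ler_normD _ _) _; rewrite !normrZ (ger0_norm s0').
    rewrite ger0_norm ?subr_ge0//; apply: le_lt_trans r1.
    have A : (1 - s) * `|p - z0| <= (1 - s) * r by rewrite ler_wpM2l ?subr_ge0// ltW.
    have B : s * `|p - x| <= s * r by rewrite ler_wpM2l// ltW.
    by move: A B; lra.
  have [|s /andP[s0' s1]] := @segment_mvt R N setT openT rho z0 (t *: grad rho z0) C1.
    by [].
  rewrite /t -Ex (bdry_rho H bx) (bdry_rho H bz) subrr dotZr => /esym/eqP.
  rewrite mulf_eq0 -/t (negbTE t0)/= gt_eqF//; apply: d1P.
    by apply: seg; rewrite !ltW.
  exact: lt_trans r1.
- by rewrite lt_min d30.
- by move=> w; rewrite lt_min => /andP[/d3P/ltW].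
move=> w; rewrite lt_min => /andP[_ wz] wD bw wz0 bRw.
have : sqdist x z0 <= sqdist x w.
  apply: zmin; split=> //=.
  rewrite -(subrK z0 p) -addrA (le_trans (ler_normD _ _))//.
  by move: wz; lra.
rewrite leNgt => /negP; apply.
have wz1 : 0 < dot (w - z0) (w - z0) by apply: dot_gt0; rewrite subr_eq0.
have E1 : sqdist y w - sqdist y z0 = dot (w - z0) (w - z0) - dot (w - z0) (x - z0).
  rewrite /sqdist; have -> : w - y = (w - z0) - (2^-1 : R) *: (x - z0).
    by rewrite /y opprD addrA.
  have -> : z0 - y = - ((2^-1 : R) *: (x - z0)) by rewrite /y opprD addrA subrr sub0r.
  by move: (w - z0) (x - z0) => a b; rewrite !dotE (dotC b a); field.
have E2 : sqdist x w - sqdist x z0 = dot (w - z0) (w - z0) - 2 * dot (w - z0) (x - z0).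
  rewrite /sqdist; have -> : w - x = (w - z0) - (x - z0) by rewrite opprB addrA subrK.
  have -> : z0 - x = - (x - z0) by rewrite opprB.
  move: (w - z0) (x - z0) => a b; rewrite !dotE (dotC b a); ring.
by move: wD wz1 E1 E2; lra.
Qed.

(** The reflection fixes [q] and its gradient, so first-order contact is automatic. The unit ball
    around [q + e] touches the plane only at [q], hence any other contact point in it lies beyond
    the plane; its radius at [q] is orthogonal to the gradient. *)
Lemma corner_touching q : bdry O q -> dot q e = lam -> dot (grad rho q) e = 0 ->
  exists p, touching p.
Proof.
move=> bq ql ge0; have [//|nZ] := pselect (exists p, touching p); exfalso.
have Rq : Rl q = q by exact: refl_fix.
have gR : refl e 0 (grad rho q) = grad rho q by exact: refl_fix.
have y1 : sqdist (q + e) q = 1.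
  by rewrite /sqdist opprD addrA subrr sub0r dotNl dotNr opprK.
have lo x : sqdist (q + e) x <= 1 -> - 1 <= dot (x - (q + e)) e.
  rewrite /sqdist; move: (x - (q + e)) => a a1; rewrite leNgt; apply/negP => a2.
  have := dot_ge0 (a + e); rewrite !dotE (dotC e a) e1; lra.
apply: (@touching_hopf q (q + e) 1 1) => //.
- by rewrite Rq.
- by rewrite Rq gR scale1r.
- move=> c; rewrite opprD addrA subrr sub0r; apply/eqP => Ec.
  have : dot (- e) e = 0 by rewrite Ec dotZl ge0 mulr0.
  by rewrite dotNl e1; lra.
- by move=> x _; rewrite y1 => /lo; rewrite !dotE e1 ql; lra.
move=> x _; rewrite y1 => xD bx xq bRx; apply: nZ; exists x; split=> //.
have xlo := lo _ xD; rewrite !dotE e1 ql in xlo.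
rewrite lt_neqAle; apply/andP; split; last by move: xlo; lra.
apply: contra_neq xq => xl; apply/eqP; rewrite -subr_eq0; apply/eqP; apply: dot_eq0.
apply/eqP; rewrite eq_le dot_ge0 andbT.
have -> : x - q = (x - (q + e)) + e by rewrite opprD addrA subrK.
move: xD; rewrite /sqdist.
have : dot (x - (q + e)) e = - 1 by rewrite !dotE e1 ql -xl; ring.
move: (x - (q + e)) => a ae a1; rewrite !dotE (dotC e a) e1 ae; lra.
Qed.

(** The first condition of [good] can only fail at a touching point. The second fails either with
    zero slope, the corner case, or with negative slope; then points of [O] just beyond the plane
    would have mirror images outside the closure. *)
Lemma touching_exists : ~ good O rho e lam -> exists p, touching p.
Proof.
move=> ng; have [//|nZ] := pselect (exists p, touching p); exfalso.
apply: ng; split=> x.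
  move=> cx xl; have cRx := cap_closure cx (ltW xl).
  have [//|bRx] := closure_cases cRx; exfalso; apply: nZ; exists x; split=> //.
  have [Ox|//] := closure_cases cx.
  by have := cap_O Ox xl; case: bRx.
move=> bx xl; rewrite lt_neqAle; apply/andP; split.
  by apply/negP => /eqP /esym ge0; exact: nZ (corner_touching bx xl ge0).
rewrite leNgt; apply/negP => ge0.
have [|d d0 dP] := ray_in H _ ge0; first by rewrite (bdry_rho H bx).
have gm : 0 < dot (grad rho x) (- e) by rewrite dotNr oppr_gt0.
have [|d' d'0 d'P] := ray_out H _ gm; first by rewrite (bdry_rho H bx).
have m0 : 0 < Num.min d d' by rewrite lt_min d0.
have [h0] := half_gt0_lt m0; rewrite lt_min => /andP[h1 h2].
set h := Num.min d d' / 2 in h0 h1 h2.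
have := dP h; rewrite h0 h1 => /(_ isT)/O_closure/cap_closure.
rewrite !dotE e1 xl mulr1 lerDl ltW// => /(_ isT)/(closure_rho_le0 H).
have -> : Rl (x + h *: e) = x + h *: - e.
  rewrite refl_lin refl_fix//; congr (_ + _ *: _).
  by rewrite /refl e1 subr0 mulr1 scaler_nat mulr2n opprD addrA subrr sub0r.
by rewrite leNgt d'P// h0.
Qed.

End Symmetry.

(** * From one contact point to symmetry of the whole domain *)

Section Fold.
Context {R : realType} {N : nat}.
Local Notation E := 'rV[R]_N.
Implicit Types (x y z p q v w : E).
Variables (O : set E) (rho : E -> R) (M k : R).
Hypothesis H : regular_domain O rho M.
Hypothesis curvk : forall p, bdry O p -> curv rho p = k.
Hypothesis connO : connected O.
Variables (e : E) (lam : R).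
Hypothesis e1 : dot e e = 1.
Hypothesis good_gt : forall mu, lam < mu -> good O rho e mu.

Let C1 : Ck setT 1 rho := rd_Ck H 1.
Local Notation Rl := (refl e lam).
Local Notation touch := (touching O e lam).

(** Folding is nonexpansive for the Euclidean distance, so arguments by nearby points work across
    the plane. *)
Definition fold x : E := if lam <= dot x e then x else Rl x.

Lemma fold_ge x : lam <= dot (fold x) e.
Proof.
by rewrite /fold; case: (leP lam (dot x e)) => // xl; rewrite dot_refl_e//; move: xl; lra.
Qed.

Lemma fold_near x (d : R) : 0 < d -> exists2 d', 0 < d' &
  forall y, `|x - y| < d' -> `|fold x - fold y| < d.
Proof.
move=> d0; have N0 : 0 < (N%:R + 1 : R) by rewrite ltr_wpDl.
exists (d / (N%:R + 1)) => [|y]; first by rewrite divr_gt0.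
rewrite ltr_pdivlMr// mulrC; apply: le_lt_trans.
apply: le_trans (norm_le_eucl _) _; apply: le_trans (eucl_le_norm _).
rewrite !euclE ler_wsqrtr// /fold.
have cross u v : lam <= dot u e -> dot v e <= lam ->
    dot (u - Rl v) (u - Rl v) <= dot (u - v) (u - v).
  move=> ul vl; have -> : u - Rl v = (u - v) + (2 * (dot v e - lam)) *: e.
    by apply/rowP => i; rewrite /refl !mxE; ring.
  have P : 0 <= (dot u e - lam) * (lam - dot v e) by rewrite mulr_ge0 ?subr_ge0.
  have : dot u e - dot v e = dot (u - v) e by rewrite dotBl.
  move: (u - v) => a ae; rewrite !dotE e1 (dotC e a) -ae.
  by move: P; lra.
case: (leP lam (dot x e)) => xl; case: (leP lam (dot y e)) => yl //.
- by apply: cross => //; exact: ltW.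
- have -> : Rl x - y = - (y - Rl x) by rewrite opprB.
  have -> : x - y = - (y - x) by rewrite opprB.
  by rewrite !dotNl !dotNr !opprK; apply: cross => //; exact: ltW.
- by rewrite refl_sub// dot_refl00.
Qed.

(* Behind an interior point of the cap there are only interior points. *)
Lemma cap_below q (t : R) : O q -> 0 < t -> ~ O (q + t *: - e) ->
  lam < dot (q + t *: - e) e -> False.
Proof.
move=> Oq t0 nO pl.
(* [r] is the height above the lower end of the segment, so the supremum [s] marks the highest point
   outside [O]. That point is on the boundary with [O] just above it, although [rho] increases along
   [e] there. *)
pose B := [set r : R | 0 <= r <= t /\ ~ O (q + (t - r) *: - e)].
have [||s sB sP] := @sup_exists R B 0 t.
- by split; rewrite ?lexx ?ltW// subr0.
- by move=> r [/andP[]].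
have s0 : 0 <= s by apply: sB; split; rewrite ?lexx ?ltW// subr0.
have st : s <= t.
  rewrite leNgt; apply/negP => ts; have [|r [/andP[_ rt] _]] := sP (s - t).
    by rewrite subr_gt0.
  by move: rt; lra.
pose p := q + (t - s) *: - e.
have line r : q + (t - r) *: - e = p + (r - s) *: e.
  by rewrite /p; apply/rowP => i; rewrite !mxE; ring.
have nOp : ~ O p.
  move=> /(O_near H)[d d0 dP].
  have [d' d'0 d'P] := curve_line_small p (- e) d0.
  have [r [rt nOr] rs] := sP d' d'0.
  have [rs'|rs'] := leP s r.
    have rs2 : r = s by apply/eqP; rewrite eq_le rs' sB.
    apply: nOr; rewrite line rs2 subrr scale0r addr0; apply: dP.
    by rewrite subrr normr0.
  apply: nOr; rewrite line; apply: dP.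
  have -> : (r - s) *: e = (s - r) *: - e by rewrite scalerN -scaleNr opprB.
  apply: d'P; rewrite subr_gt0 rs'/=; move: rs; lra.
have st' : s < t.
  rewrite lt_neqAle st andbT; apply/eqP => stE; apply: nOp.
  by rewrite /p stE subrr scale0r addr0.
have Or r : s < r <= t -> O (p + (r - s) *: e).
  move=> /andP[sr rt]; rewrite -line; apply: contrapT => nOr.
  have : r <= s by apply: sB; split => //; rewrite rt (le_trans s0 (ltW sr)).
  by rewrite leNgt sr.
have cp : closure O p.
  apply/closureP => d d0; have [d' d'0 d'P] := curve_line_small p e d0.
  have m0 : 0 < Num.min d' (t - s) by rewrite lt_min d'0 subr_gt0.
  have [h0] := half_gt0_lt m0; rewrite lt_min => /andP[h1 h2].
  set h := Num.min d' (t - s) / 2 in h0 h1 h2.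
  exists (p + h *: e); last by apply: d'P; rewrite h0.
  have -> : h = (s + h) - s by ring.
  by apply: Or; rewrite ltrDl h0/=; move: h2; lra.
have bp : bdry O p by split.
have pl' : lam < dot p e.
  by move: pl; rewrite /p !dotE e1; move: s0; lra.
have ge0 := cap_bdry good_gt bp pl'.
have [|d d0 dP] := ray_out H _ ge0; first by rewrite (bdry_rho H bp).
have m0 : 0 < Num.min d (t - s) by rewrite lt_min d0 subr_gt0.
have [h0] := half_gt0_lt m0; rewrite lt_min => /andP[h1 h2].
set h := Num.min d (t - s) / 2 in h0 h1 h2.
have := dP h; rewrite h0 h1 => /(_ isT).
have -> : h = (s + h) - s by ring.
rewrite ltNge ltW//; apply/(rd_def H)/Or.
by rewrite ltrDl h0/=; move: h2; lra.
Qed.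

(** Just below the upper boundary point lies a point of [O], and [cap_below] forbids leaving [O]
    again beneath it while beyond the plane. *)
Lemma cap_exit_unique p (s : R) : bdry O p -> bdry O (p + s *: e) ->
  lam < dot p e -> 0 < s -> False.
Proof.
move=> bp bq pl s0.
have ql : lam < dot (p + s *: e) e by rewrite !dotE e1; move: pl s0; lra.
have ge0 := cap_bdry good_gt bq ql.
have gm : dot (grad rho (p + s *: e)) (- e) < 0 by rewrite dotNr oppr_lt0.
have [|d d0 dP] := ray_in H _ gm; first by rewrite (bdry_rho H bq).
have m0 : 0 < Num.min d s by rewrite lt_min d0.
have [h0] := half_gt0_lt m0; rewrite lt_min => /andP[h1 h2].
set h := Num.min d s / 2 in h0 h1 h2.
have Oq := dP h; rewrite h0 h1 in Oq; have {}Oq := Oq isT.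
have pE : (p + s *: e + h *: - e) + (s - h) *: - e = p.
  by apply/rowP => i; rewrite !mxE; ring.
apply: (@cap_below (p + s *: e + h *: - e) (s - h)) => //.
- by rewrite subr_gt0.
- by rewrite pE; case: bp.
- by rewrite pE.
Qed.

Lemma exit_exists y : O y -> exists2 s, 0 < s & bdry O (y + s *: e).
Proof.
move=> Oy; pose B := [set r : R | 0 <= r /\ O (y + r *: e)].
have B0 : B 0 by split; rewrite ?lexx// scale0r addr0.
have en : 0 < `|e|.
  rewrite normr_gt0; apply: contraPneq e1 => -> /esym/eqP.
  by rewrite dot0l oner_eq0.
have [|s sB sP] := @sup_exists R B 0 ((M + `|y|) / `|e|) B0.
  move=> r [r0 /(rd_bound H) yr]; rewrite ler_pdivlMr//.
  have := ler_normB (y + r *: e) y; rewrite addrC addKr normrZ ger0_norm//.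
  by move: yr; lra.
have s0 := sB 0 B0.
have nO : ~ O (y + s *: e).
  move=> /(O_near H)[d d0 dP].
  have [d' d'0 d'P] := curve_line_small (y + s *: e) e d0.
  have [h0 hd] := half_gt0_lt d'0.
  have : B (s + d' / 2).
    split; first by rewrite addr_ge0// ltW.
    rewrite scalerDl addrA; apply/dP/d'P; by rewrite h0.
  by move=> /sB; rewrite gerDl leNgt h0.
have sn : s != 0 by apply: contra_notN nO => /eqP ->; rewrite scale0r addr0.
exists s; first by rewrite lt_neqAle eq_sym sn.
split=> //; apply/closureP => d d0.
have [d' d'0 d'P] := curve_line_small (y + s *: e) (- e) d0.
have [r [r0 Or] rs] := sP d' d'0.
exists (y + r *: e) => //.
have rs' : r <= s by apply: sB.
have -> : y + r *: e = y + s *: e + (s - r) *: - e.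
  by apply/rowP => i; rewrite !mxE; ring.
have [->|rsn] := eqVneq r s; first by rewrite subrr scale0r addr0 subrr normr0.
by apply: d'P; rewrite subr_gt0 lt_neqAle rsn rs'/=; move: rs; lra.
Qed.

(** Beyond the plane [e] is transversal to the boundary, so along every nearby parallel line [rho]
    changes sign within a short interval whose zeros are boundary points close to [p]. *)
Lemma exit_near p (r h0 : R) : bdry O p -> lam < dot p e -> 0 < r -> 0 < h0 ->
  exists2 h, 0 < h < h0 & exists2 d, 0 < d & forall w, `|p - w| < d ->
    (0 < rho (w + h *: e)) /\ (rho (w - h *: e) < 0) /\
    (forall t, - h <= t <= h -> rho (w + t *: e) = 0 ->
      bdry O (w + t *: e) /\ `|p - (w + t *: e)| < r).
Proof.
move=> bp pl r0 h00; have ge0 := cap_bdry good_gt bp pl.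
have [|d1 d10 d1P] := ray_out H _ ge0; first by rewrite (bdry_rho H bp).
have gm : dot (grad rho p) (- e) < 0 by rewrite dotNr oppr_lt0.
have [|d2 d20 d2P] := ray_in H _ gm; first by rewrite (bdry_rho H bp).
have [d3 d30 d3P] := bdry_near H bp.
have en : 0 < `|e| + 1 by rewrite ltr_wpDl.
pose r' := Num.min r d3.
have r'0 : 0 < r' by rewrite lt_min r0.
pose m := Num.min (Num.min d1 d2) (Num.min h0 (r' / 2 / (`|e| + 1))).
have m0 : 0 < m by rewrite !lt_min d10 d20 h00 !divr_gt0.
have [hp] := half_gt0_lt m0; rewrite {2}/m !lt_min => /andP[/andP[a1 a2] /andP[a3 a4]].
set h := m / 2 in hp a1 a2 a3 a4.
exists h; first by rewrite hp.
have pos : 0 < rho (p + h *: e) by apply: d1P; rewrite hp.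
have neg : 0 < - rho (p + h *: - e).
  by rewrite oppr_gt0; apply/(rd_def H)/d2P; rewrite hp.
have /continuous_atP/(_ _ pos)[d4 d40 d4P] := @rho_cont R N O rho M H (p + h *: e).
have /continuous_atP/(_ _ neg)[d5 d50 d5P] := @rho_cont R N O rho M H (p + h *: - e).
exists (Num.min (Num.min d4 d5) (r' / 2)).
  by rewrite !lt_min d40 d50 divr_gt0.
move=> w; rewrite !lt_min => /andP[/andP[w4 w5] wr]; split.
  have := d4P (w + h *: e); rewrite opprD addrACA subrr addr0 => /(_ w4).
  by rewrite ltr_norml => /andP[_]; lra.
split.
  have := d5P (w + h *: - e); rewrite opprD addrACA subrr addr0 => /(_ w5).
  by rewrite scalerN ltr_norml => /andP[]; lra.
move=> t tt wt0.
have pr : `|p - (w + t *: e)| < r'.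
  rewrite opprD addrA; apply: le_lt_trans (ler_normB _ _) _; rewrite normrZ.
  have A : `|t| * `|e| <= h * (`|e| + 1).
    by apply: ler_pM => //; rewrite ?ler_norml// lerDl.
  have B : h * (`|e| + 1) < r' / 2 by rewrite -ltr_pdivlMr.
  by move: A B wr; lra.
move: pr; rewrite lt_min => /andP[pr p3]; split=> //.
by apply: (rho0_bdry H) => //; exact: d3P.
Qed.

(** Stability of exit points. The case [s = 0], where the starting point itself is on the boundary,
    is included: nearby starting points in [O] leave close to it. *)
Lemma exit_close p (r s : R) y : bdry O p -> lam < dot p e -> 0 < r -> 0 <= s ->
  p = y + s *: e -> exists2 d, 0 < d & forall y', `|y - y'| < d -> O y' ->
  exists2 t, 0 < t & bdry O (y' + t *: e) /\ `|p - (y' + t *: e)| < r.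
Proof.
move=> bp pl r0 s0 pE.
(* For s > 0, [h < s] keeps the new exit parameter [s + (h - t)] positive; for [s = 0] the value 1
   is a placeholder. *)
have hh0 : 0 < (if s == 0 then 1 else s).
  by case: eqVneq => // sn; rewrite lt_neqAle eq_sym sn.
have [h /andP[h0 hs] [d d0 dP]] := exit_near bp pl r0 hh0.
exists d => // y' yd Oy'.
have wd : `|p - (y' + s *: e)| < d by rewrite pE opprD addrACA subrr addr0.
have [pos [neg zero]] := dP _ wd.
have [sz|sn] := eqVneq s 0.
  move: pos neg zero; rewrite sz scale0r addr0 => pos neg zero.
  have hy : rho (y' + h *: e + h *: - e) <= 0.
    by rewrite scalerN addrK; apply/ltW/(rd_def H).
  have [t /andP[t0 th] tz] := descent_zero C1 h0 (ltW pos) hy.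
  have E1 : y' + h *: e + t *: - e = y' + (h - t) *: e.
    by rewrite scalerN -addrA -scalerBl.
  rewrite E1 in tz.
  exists (h - t); last by apply: zero => //; move: t0 th; lra.
  rewrite subr_gt0 lt_neqAle th andbT; apply/eqP => tE.
  move: tz; rewrite tE subrr scale0r addr0 => tz.
  by have /(rd_def H) := Oy'; rewrite tz ltxx.
have h2 : 0 < 2 * h by rewrite mulr_gt0.
have hy : rho (y' + s *: e + h *: e + (2 * h) *: - e) <= 0.
  have -> : y' + s *: e + h *: e + (2 * h) *: - e = y' + s *: e - h *: e.
    by apply/rowP => i; rewrite !mxE; ring.
  exact: ltW.
have [t /andP[t0 th] tz] := descent_zero C1 h2 (ltW pos) hy.
have E1 : y' + s *: e + h *: e + t *: - e = y' + s *: e + (h - t) *: e.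
  by apply/rowP => i; rewrite !mxE; ring.
rewrite E1 in tz.
have [|b1 b2] := zero (h - t) _ tz; first by apply/andP; split; move: t0 th; lra.
exists (s + (h - t)); last by rewrite scalerDl addrA.
by move: hs th; rewrite (negbTE sn); lra.
Qed.

Lemma not_touching_open p : bdry O p -> lam < dot p e -> ~ touch p ->
  exists2 d, 0 < d & forall x, bdry O x -> `|p - x| < d -> ~ touch x.
Proof.
move=> bp pl nZ; have nR : ~ bdry O (Rl p) by move=> bR; apply: nZ.
have [d d0 dP] := not_bdry_near H nR.
have [d' d'0 d'P] := refl_near e1 lam p d0.
by exists d' => // x bx /d'P/dP nb [].
Qed.

(** [O (fold x)] is demanded because only the reflection from beyond the plane is known to stay in
    [O]: a point below the plane might have its mirror image outside. *)
Definition touch_exit x : Prop :=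
  O x /\ O (fold x) /\ exists2 s, 0 < s & touch (fold x + s *: e).

Lemma touch_exit_open x : touch_exit x -> exists2 d, 0 < d &
  forall y, `|x - y| < d -> touch_exit y.
Proof.
move=> [Ox [Of [s s0 Zp]]]; have [bp pl _] := Zp.
have [r r0 rP] := touching_open H curvk e1 good_gt Zp.
have [d1 d10 d1P] := exit_close bp pl r0 (ltW s0) erefl.
have [d2 d20 d2P] := O_near H Of.
have [d3 d30 d3P] := O_near H Ox.
have m0 : 0 < Num.min d1 d2 by rewrite lt_min d10.
have [d4 d40 d4P] := fold_near x m0.
exists (Num.min d3 d4); first by rewrite lt_min d30.
move=> y; rewrite lt_min => /andP[y3 /d4P]; rewrite lt_min => /andP[y1 /d2P Oy].
have [t t0 [bt tr]] := d1P _ y1 Oy.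
split; first exact: d3P.
by split=> //; exists t => //; exact: rP.
Qed.

(** If [fold x] is outside the closure, so are the nearby folds. If it is in [O], its exit does not
    touch, and by stability and uniqueness neither do the nearby exits. If it is on the boundary,
    [x] is below the plane and is the mirror image of [fold x], so [fold x] is an exit at distance 0
    that does not touch. *)
Lemma touch_exit_closed x : O x -> ~ touch_exit x -> exists2 d, 0 < d &
  forall y, `|x - y| < d -> ~ touch_exit y.
Proof.
move=> Ox nA.
have close p s : bdry O p -> lam < dot p e -> ~ touch p -> 0 <= s ->
    p = fold x + s *: e -> exists2 d, 0 < d & forall y, `|x - y| < d -> ~ touch_exit y.
  move=> bp pl nZ s0 pE.
  have [r r0 rP] := not_touching_open bp pl nZ.
  have [d1 d10 d1P] := exit_close bp pl r0 s0 pE.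
  have [d4 d40 d4P] := fold_near x d10.
  exists d4; first exact: d40.
  move=> y /d4P y1 [_ [Oy [s' s'0 Z']]].
  have [t t0 [bt tr]] := d1P _ y1 Oy.
  have nZt := rP _ bt tr.
  have [b' l' _] := Z'.
  have [tl|tl|tl] := ltgtP t s'.
  - have lt : lam < dot (fold y + t *: e) e.
      by have := fold_ge y; rewrite !dotE e1; move: t0; lra.
    apply: (@cap_exit_unique (fold y + t *: e) (s' - t)) => //.
      by rewrite -addrA -scalerDl [t + _]addrC subrK.
    by rewrite subr_gt0.
  - apply: (@cap_exit_unique (fold y + s' *: e) (t - s')) => //.
      by rewrite -addrA -scalerDl [s' + _]addrC subrK.
    by rewrite subr_gt0.
  - by apply: nZt; rewrite tl.
have [cf|ncf] := pselect (closure O (fold x)); last first.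
  have [d d0 dP] := not_closure_near ncf.
  have [d4 d40 d4P] := fold_near x d0.
  exists d4; first exact: d40.
  by move=> y /d4P/dP nc [_ [Oy _]]; apply: nc; exact: O_closure.
have [Of|bf] := closure_cases cf.
  have [s s0 bs] := exit_exists Of.
  apply: (close (fold x + s *: e) s) => //; last exact: ltW.
    by have := fold_ge x; rewrite !dotE e1; move: s0; lra.
  by move=> Z; apply: nA; split=> //; split=> //; exists s.
have xl : dot x e < lam.
  by move: bf; rewrite /fold; case: (leP lam (dot x e)) => // _ [].
have fE : fold x = Rl x by rewrite /fold leNgt xl.
apply: (close (fold x) 0) => //; last by rewrite scale0r addr0.
- by rewrite fE dot_refl_e//; move: xl; lra.
- by move=> [_ _]; rewrite fE reflK// => -[].
Qed.

(** Points just below [p] have a touching exit, so by connectedness all points of [O] do. For points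
    below the plane the clause [O (fold x)] is the claimed symmetry. *)
Lemma symmetric_of_touching p : touch p -> forall x, O x -> O (Rl x).
Proof.
move=> Zp; have [bp pl _] := Zp.
pose A := [set x | touch_exit x].
have oA : open A by apply: open_normP => x; exact: touch_exit_open.
have oB : open [set x | O x /\ ~ touch_exit x].
  apply: open_normP => x [Ox nA].
  have [d d0 dP] := touch_exit_closed Ox nA; have [d' d'0 d'P] := O_near H Ox.
  exists (Num.min d d') => [|y]; first by rewrite lt_min d0.
  by rewrite lt_min => /andP[/dP ny /d'P].
have AO : A = O.
  apply: connO.
  - have ge0 := cap_bdry good_gt bp pl.
    have gm : dot (grad rho p) (- e) < 0 by rewrite dotNr oppr_lt0.
    have [|d d0 dP] := ray_in H _ gm; first by rewrite (bdry_rho H bp).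
    have s0 : 0 < dot p e - lam by rewrite subr_gt0.
    have m0 : 0 < Num.min d (dot p e - lam) by rewrite lt_min d0.
    have [h0] := half_gt0_lt m0; rewrite lt_min => /andP[h1 h2].
    set h := Num.min d (dot p e - lam) / 2 in h0 h1 h2.
    have Oh : O (p + h *: - e) by apply: dP; rewrite h0.
    have fE : fold (p + h *: - e) = p + h *: - e.
      by rewrite /fold ifT// !dotE e1; move: h2; lra.
    exists (p + h *: - e); split=> //; rewrite fE; split=> //; exists h => //.
    by rewrite scalerN subrK.
  - by exists A => //; apply/seteqP; split=> [x Ax|x []//]; split=> //; case: Ax.
  - exists (~` [set x | O x /\ ~ touch_exit x]); first exact/open_closedC.
    apply/seteqP; split=> [x Ax|x [Ox /= nB]].
      by split; [case: Ax|move=> []].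
    by apply: contrapT => nA; exact: nB.
move=> x Ox; have [xl|xl|xl] := ltgtP lam (dot x e).
- exact: (cap_O H e1 good_gt).
- have : A x by rewrite AO.
  by move=> [_ []]; rewrite /fold leNgt xl.
- by rewrite refl_fix.
Qed.

End Fold.

(** * Symmetry in all directions gives a ball *)

Section Ball.
Context {R : realType} {N : nat}.
Local Notation E := 'rV[R]_N.
Implicit Types (x y z p q v w : E).
Variables (O : set E) (rho : E -> R) (M k : R).
Hypothesis H : regular_domain O rho M.
Hypothesis curvk : forall p, bdry O p -> curv rho p = k.
Hypothesis connO : connected O.
Hypothesis O0 : O !=set0.
Variable i0 : 'I_N.

Lemma symmetric_direction (e : E) : dot e e = 1 -> exists lam : R,
  (forall x, O x -> O (refl e lam x)) /\
  (forall mu x, lam < mu -> O x -> mu < dot x e -> O (refl e mu x)).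
Proof.
move=> e1; have [lam gl ng] := critical_position H e1 O0.
exists lam; split.
  have [p Zp] := touching_exists H curvk e1 gl ng.
  exact: (symmetric_of_touching H curvk connO e1 gl Zp).
by move=> mu x /gl[gA _] Ox xm; apply: gA => //; exact: O_closure.
Qed.

Lemma evec_unit (i : 'I_N) : dot (evec R i) (evec R i) = 1 :> R.
Proof. by rewrite dot_evec /evec mxE !eqxx. Qed.

(** The composition of the reflections in the coordinate directions is the point reflection at
    [c]. *)
Lemma center_exists : exists c : E, forall x, O x -> O (2 *: c - x).
Proof.
have [lam lamP] := choice (fun i : 'I_N => symmetric_direction (evec_unit i)).
pose c : E := \row_i lam i; exists c.
have step (s : seq 'I_N) : uniq s -> forall x, O x ->
    O (\row_i (if i \in s then 2 * c 0 i - x 0 i else x 0 i)).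
  elim: s => [|j s IH] /=.
    by move=> _ x Ox; congr (O _): Ox; apply/rowP => i; rewrite !mxE.
  move=> /andP[js us] x Ox; have := (lamP j).1 _ (IH us x Ox).
  congr (O _); apply/rowP => i; rewrite /refl dot_evec !mxE (negbTE js) in_cons.
  rewrite eqxx /=; have [->|ij] := eqVneq i j.
    by rewrite (negbTE js) /=; ring.
  by rewrite /= mulr0 subr0.
move=> x Ox; have := step (enum 'I_N) (enum_uniq _) x Ox.
by congr (O _); apply/rowP => i; rewrite !mxE mem_enum.
Qed.

Theorem constant_curvature_ball : is_euclidean_ball O.
Proof.
have [c cP] := center_exists.
have B x : O x -> eucl (x - c) <= (N%:R + 1) * (M + `|c|).
  move=> /(rd_bound H) xM; apply: le_trans (eucl_le_norm _) _.
  apply: ler_wpM2l; first by rewrite addr_ge0.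
  by apply: le_trans (ler_normB _ _) _; rewrite lerD2r.
(* Composing the point reflection at [c] with the reflection at [lam] shifts [dot x e] by twice the
   difference of [lam] and [dot c e], which a bounded invariant set does not allow unless they
   agree. *)
have half (e : E) lam : dot e e = 1 -> (forall x, O x -> O (refl e lam x)) ->
    lam = dot c e.
  move=> e1 sym; have [w0 Ow] := O0.
  pose A := [set r : R | exists2 x, O x & r = dot x e].
  have [||s sA sP] := @sup_exists R A (dot w0 e) (N%:R * (M * `|e|)).
  - by exists w0.
  - move=> _ [x Ox ->]; apply: le_trans (ler_norm _) _.
    apply: le_trans (dot_le_norm _ _) _; apply: ler_wpM2l => //.
    by apply: ler_wpM2r => //; exact: rd_bound H _ Ox.
  apply/eqP; rewrite eq_le; apply/andP; split; rewrite leNgt; apply/negP => lt.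
    have d0 : 0 < lam - dot c e by rewrite subr_gt0.
    have [_ [x Ox ->] xs] := sP _ d0.
    have : dot (refl e lam (2 *: c - x)) e <= s.
      by apply: sA; exists (refl e lam (2 *: c - x)) => //; exact/sym/cP.
    by rewrite dot_refl_e// !dotE; move: xs; lra.
  have d0 : 0 < dot c e - lam by rewrite subr_gt0.
  have [_ [x Ox ->] xs] := sP _ d0.
  have : dot (2 *: c - refl e lam x) e <= s.
    by apply: sA; exists (2 *: c - refl e lam x) => //; exact/cP/sym.
  by rewrite dotBl dotZl dot_refl_e//; move: xs; lra.
(* [y] is the mirror image of [x] in their perpendicular bisector. As [y] is nearer to [c], this
   plane lies strictly beyond the symmetry plane through [c]. *)
have inner x y : O x -> eucl (y - c) < eucl (x - c) -> O y.
  move=> Ox yx; have xy : x - y != 0.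
    by apply: contraTneq yx => /eqP; rewrite subr_eq0 => /eqP ->; rewrite ltxx.
  have r0 := eucl_gt0 xy; pose r := eucl (x - y).
  pose e := r^-1 *: (x - y).
  have eE : e = r^-1 *: (x - y) by [].
  clearbody e.
  have e1 : dot e e = 1.
    by rewrite eE dotZl dotZr -eucl_sqr -/r; field; rewrite gt_eqF.
  have [lam [sym mono]] := symmetric_direction e1.
  have lamE := half e lam e1 sym.
  pose mu := (dot x e + dot y e) / 2.
  have rd : dot x e - dot y e = r.
    by rewrite -dotBl eE dotZr -eucl_sqr -/r; field; rewrite gt_eqF.
  have Ey : refl e mu x = y.
    rewrite /refl; have -> : 2 * (dot x e - mu) = r by rewrite -rd /mu; field.
    by rewrite eE scalerA divff ?gt_eqF// scale1r opprB addrC subrK.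
  rewrite -Ey; apply: mono => //.
    have sq : dot (y - c) (y - c) < dot (x - c) (x - c).
      by rewrite -!eucl_sqr ltr_pXn2r// nnegrE eucl_ge0.
    have E2 : dot (x - c) (x - c) - dot (y - c) (y - c) = 2 * r * (mu - dot c e).
      have -> : dot (x - c) (x - c) - dot (y - c) (y - c) =
          dot (x - y) (x + y - 2 *: c) by rewrite !dotE (dotC y x) (dotC c x) (dotC c y); ring.
      have {1}-> : x - y = r *: e by rewrite eE scalerA divff ?gt_eqF// scale1r.
      by rewrite dotZl dotC !dotE /mu; field.
    have : 0 < 2 * r * (mu - dot c e) by rewrite -E2 subr_gt0.
    by rewrite pmulr_rgt0 ?mulr_gt0// subr_gt0 lamE.
  by rewrite /mu; have : 0 < r by []; move: rd; lra.
have [w0 Ow] := O0.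
pose A := [set r : R | exists2 x, O x & r = eucl (x - c)].
have [||s sA sP] := @sup_exists R A (eucl (w0 - c)) ((N%:R + 1) * (M + `|c|)).
- by exists w0.
- by move=> _ [x Ox ->]; exact: B.
(* Openness allows a small step away from [c], so the supremum is not attained; at [x = c] the step
   uses the axis [i0]. *)
have lt_s x : O x -> eucl (x - c) < s.
  move=> Ox.
  have [w wn xw] : exists2 w : E, w != 0 & 0 <= dot (x - c) w.
    have [z0|zn] := eqVneq (x - c) 0; last by exists (x - c); rewrite ?dot_ge0.
    exists (evec R i0); last by rewrite z0 dot0l.
    by apply: contraPneq (evec_unit i0) => -> /esym/eqP; rewrite dot0l oner_eq0.
  have [d d0 dP] := O_near H Ox.
  have [d' d'0 d'P] := curve_line_small x w d0.
  have [h0 hd] := half_gt0_lt d'0.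
  have Oh : O (x + (d' / 2) *: w) by apply/dP/d'P; rewrite h0.
  apply: (@lt_le_trans _ _ (eucl (x + (d' / 2) *: w - c))); last first.
    by apply: sA; exists (x + (d' / 2) *: w).
  rewrite -(ltr_pXn2r (n := 2)) ?nnegrE ?eucl_ge0// !eucl_sqr addrAC.
  move: (d' / 2) h0 (x - c) xw => h h0 a xw.
  rewrite !dotDl !dotDr !dotZl !dotZr (dotC w a).
  have P1 : 0 <= h * dot a w by rewrite mulr_ge0// ltW.
  have P2 : 0 < h * (h * dot w w) by rewrite !mulr_gt0// dot_gt0.
  by move: P1 P2; lra.
exists c, s; split.
  by apply: le_lt_trans (lt_s w0 Ow); exact: eucl_ge0.
apply/seteqP; split=> x /=; first exact: lt_s.
move=> xs; have s0 : 0 < s - eucl (x - c) by rewrite subr_gt0.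
have [_ [y Oy ->] ys] := sP _ s0.
by apply: (inner y x Oy); move: ys; lra.
Qed.

End Ball.

(** * Heat equation and boundary layer expansion *)

Section Profile.
Context {R : realType}.

Lemma expR_ge_pow (x : R) n : 0 <= x -> x ^+ n <= n`!%:R * expR x.
Proof.
case: n => [|n] x0; first by rewrite expr0 fact0 mul1r -expR0 ler_expR.
have H : x ^+ n.+1 / n.+1`!%:R <= expR x.
  by apply: le_trans (expR_ge1Dxn n x0); rewrite lerDr.
by move: H; rewrite ler_pdivrMr ?ltr0n ?fact_gt0// mulrC.
Qed.

Lemma gauss_moment_bound (z : R) n : 0 <= z ->
  z ^+ n * expR (- z ^+ 2 / 4) <= 1 + 4 ^+ n * n`!%:R.
Proof.
move=> z0; have E0 : 0 <= expR (- z ^+ 2 / 4) by exact: expR_ge0.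
have zz : z ^+ n <= 1 + (z ^+ 2) ^+ n.
  rewrite exprAC expr2; have : 0 <= z ^+ n by exact: exprn_ge0.
  by move: (z ^+ n) => y; nra.
have E1 : expR (- z ^+ 2 / 4) <= 1.
  by rewrite expR_le1 mulNr oppr_le0 divr_ge0// sqr_ge0.
have E2 : (z ^+ 2) ^+ n * expR (- z ^+ 2 / 4) <= 4 ^+ n * n`!%:R.
  have z4 : 0 <= z ^+ 2 / 4 by rewrite divr_ge0// sqr_ge0.
  have H := expR_ge_pow n z4.
  have -> : (z ^+ 2) ^+ n = 4 ^+ n * (z ^+ 2 / 4) ^+ n.
    by rewrite -exprMn mulrCA divff ?mulr1.
  rewrite -mulrA ler_pM2l ?exprn_gt0//.
  have -> : expR (- z ^+ 2 / 4) = (expR (z ^+ 2 / 4))^-1 by rewrite mulNr expRN.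
  by rewrite ler_pdivrMr ?expR_gt0.
apply: le_trans (ler_wpM2r E0 zz) _; rewrite mulrDl mul1r; exact: lerD.
Qed.

(** Integrating from -1 makes 0 an interior point, so the profile has a two-sided derivative at 0,
    the value of z on the boundary. *)
Lemma antiderivative_exists (f : R -> R) : continuous f ->
  exists F : R -> R, forall x : R, - 1 < x -> is_derive x 1 F (f x).
Proof.
move=> cf; exists (fun x => (\int[lebesgue_measure]_(t in [set` `[-1, x]]) (f t))%R).
move=> x x1; have xu : x < x + 1 by rewrite ltrDl.
have intf : lebesgue_measure.-integrable `[-1, x + 1] (EFin \o f).
  apply: continuous_compact_integrable; first exact: segment_compact.
  by apply: continuous_subspaceT => y; exact: cf.
have [d v] := continuous_FTC1_closed xu intf x1 (cf x).
by apply: DeriveDef; [exact: d|rewrite -derive1E; exact: v].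
Qed.

Lemma mono_of_derive (F f : R -> R) (a b : R) : a <= b ->
  (forall x : R, a <= x -> is_derive x 1 F (f x)) ->
  (forall x, a <= x -> 0 <= f x) -> F a <= F b.
Proof.
rewrite le_eqVlt => /orP[/eqP -> //|ab] FD f0.
have [||c] := @MVT R F f a b ab.
- by move=> x; rewrite in_itv/= => /andP[/ltW /FD].
- apply: derivable_within_continuous => x; rewrite in_itv/= => /andP[/FD[]].
  by [].
rewrite in_itv/= => /andP[ac cb] E1.
have := mulr_ge0 (f0 c (ltW ac)) (ltW (_ : 0 < b - a)).
by rewrite subr_gt0 -E1 => /(_ ab); rewrite subr_ge0.
Qed.

(** [Phi] is the similarity solution on a half-line, Phi'' + (z / 2) Phi' = 0, with value 0 at 0 and
    limit 1, together with an exponential tail bound. *)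
Definition is_profile (Phi : R -> R) (c0 C1 : R) : Prop :=
  [/\ 0 < c0, 0 <= C1, Phi 0 = 0,
    forall z : R, - 1 < z -> is_derive z 1 Phi (c0 * expR (- z ^+ 2 / 4)) &
    forall z, 0 <= z -> 0 <= 1 - Phi z <= C1 * expR (- z)].

(* Phi is the error function normalised by its own limit, so that the value of
   the Gaussian integral is never needed. *)
Lemma profile_exists : exists Phi c0 C1, is_profile Phi c0 C1.
Proof.
pose f (z : R) := expR (- z ^+ 2 / 4).
have cf : continuous f.
  move=> z; apply: (@continuous_comp _ _ _ (fun z : R => - z ^+ 2 / 4) expR).
    apply: cvgM; last exact: cvg_cst.
    apply: cvgN; exact: exprn_continuous.
  exact: continuous_expR.
have [F FD] := antiderivative_exists cf.
have x1 (x : R) : 0 <= x -> - 1 < x by move=> x0; rewrite (lt_le_trans _ x0)// oppr_lt0.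
(* The exponents compare as z - 1 <= z^2 / 4, which is (z / 2 - 1)^2 >= 0. *)
have f_le (z : R) : f z <= expR (1 - z).
  by rewrite ler_expR; have := sqr_ge0 (z / 2 - 1); nra.
have tail (a b : R) : 0 <= a -> a <= b -> F b - F a <= expR (1 - a) - expR (1 - b).
  move=> a0 ab.
  have D (z : R) : a <= z ->
      is_derive z 1 (fun z => - expR (1 - z) - F z) (expR (1 - z) - f z).
    move=> za; have ? := FD z (x1 _ (le_trans a0 za)).
    have D1 : is_derive z 1 (fun z : R => expR (1 - z)) (- expR (1 - z)).
      have D0 : is_derive z 1 (fun z : R => 1 - z) (- 1).
        by apply: is_derive_eq; rewrite /GRing.scale/=; ring.
      have := @is_derive1_comp R expR (fun z : R => 1 - z) z _ _ (is_derive_expR _) D0.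
      by rewrite mulrN1.
    by apply: is_derive_eq; ring.
  have P z : a <= z -> 0 <= expR (1 - z) - f z by rewrite subr_ge0.
  by have := mono_of_derive ab D P; lra.
have mono (a b : R) : 0 <= a -> a <= b -> F a <= F b.
  move=> a0 ab; apply: (@mono_of_derive F f a b ab) => z za.
    exact: FD (x1 _ (le_trans a0 za)).
  exact: expR_ge0.
pose A := [set r : R | exists2 z, 0 <= z & r = F z - F 0].
have [||L LA LP] := @sup_exists R A 0 (expR 1).
- by exists 0; rewrite ?subrr.
- move=> _ [z z0 ->]; have := tail 0 z (lexx _) z0; rewrite subr0.
  by have := expR_ge0 (1 - z); lra.
have f1 : 0 < F 1 - F 0.
  have [||c] := @MVT R F f 0 1 ltr01.
  - by move=> z; rewrite in_itv/= => /andP[/ltW z0 _]; exact: FD (x1 _ z0).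
  - apply: derivable_within_continuous => z; rewrite in_itv/= => /andP[z0 _].
    by have [] := FD z (x1 _ z0).
  by move=> _ ->; rewrite subr0 mulr1 expR_gt0.
have L0 : 0 < L by apply: lt_le_trans f1 (LA _ _); exists 1.
exists (fun z => (F z - F 0) / L), (L^-1), (expR 1 / L); split.
- by rewrite invr_gt0.
- by rewrite divr_ge0 ?expR_ge0// ltW.
- by rewrite subrr mul0r.
- move=> z z1; have ? := FD z z1.
  by apply: is_derive_eq; rewrite /GRing.scale/= /f; ring.
move=> z z0; have Az : A (F z - F 0) by exists z.
rewrite subr_ge0 ler_pdivrMr// mul1r LA//=.
have -> : 1 - (F z - F 0) / L = (L - (F z - F 0)) / L by field; rewrite gt_eqF.
have -> : expR 1 / L * expR (- z) = expR (1 - z) / L by rewrite expRD; ring.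
rewrite ler_pM2r ?invr_gt0// leNgt; apply/negP => lt.
have d0 : 0 < L - (F z - F 0) - expR (1 - z) by rewrite subr_gt0.
have [_ [y y0 ->] yL] := LP _ d0.
have [zy|/ltW yz] := leP z y.
  by have := tail z y z0 zy; have := expR_ge0 (1 - y); move: yL; lra.
by have := mono y z y0 yz; have := expR_ge0 (1 - z); move: yL; lra.
Qed.

End Profile.

(** * Heat residuals and the maximum principle *)

Section HeatOperator.
Context {R : realType} {N : nat}.
Local Notation E := 'rV[R]_N.
Variable O : set E.
Hypothesis oO : open O.
Implicit Types (w : E -> R -> R) (x y : E) (t h : R).

(* (d/dt - Laplacian) w = h at (x, t), as a relation: it can be combined without
   differentiability side conditions on 'D. *)
Definition heat_res w x t h : Prop := exists wt, exists D : 'I_N -> E -> R,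
  exists S : 'I_N -> R, [/\ is_derive t 1 (w x) wt,
    forall i y, O y -> is_derive y (evec R i) (w^~ t) (D i y),
    forall i, is_derive x (evec R i) (D i) (S i) & h = wt - \sum_i S i].

Lemma heat_resD w1 w2 x t h1 h2 : heat_res w1 x t h1 -> heat_res w2 x t h2 ->
  heat_res (fun y s => w1 y s + w2 y s) x t (h1 + h2).
Proof.
move=> [a1 [D1 [S1 [da1 dD1 dS1 ->]]]] [a2 [D2 [S2 [da2 dD2 dS2 ->]]]].
exists (a1 + a2), (fun i y => D1 i y + D2 i y), (fun i => S1 i + S2 i); split.
- exact: is_deriveD.
- by move=> i y Oy; have := dD1 i y Oy; have := dD2 i y Oy => ? ?; exact: is_deriveD.
- by move=> i; exact: is_deriveD.
- by rewrite big_split/=; ring.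
Qed.

Lemma heat_resZ w x t h (c : R) : heat_res w x t h ->
  heat_res (fun y s => c * w y s) x t (c * h).
Proof.
move=> [a1 [D1 [S1 [da1 dD1 dS1 ->]]]].
exists (c * a1), (fun i y => c * D1 i y), (fun i => c * S1 i); split.
- exact: (is_deriveZ c da1).
- by move=> i y Oy; exact: (is_deriveZ c (dD1 i y Oy)).
- by move=> i; exact: (is_deriveZ c (dS1 i)).
- by rewrite -mulr_sumr; ring.
Qed.

Lemma heat_res_cst (c : R) x t : heat_res (fun _ _ => c) x t 0.
Proof.
exists 0, (fun _ _ => 0), (fun _ => 0); split.
- exact: is_derive_cst.
- by move=> i y _; exact: is_derive_cst.
- by move=> i; exact: is_derive_cst.
- by rewrite big1// subr0.
Qed.

(** The maximum is over a neighbourhood in space but only over the past in time: pure second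
    derivatives are nonpositive and the time derivative is nonnegative, by a backward difference. *)
Lemma heat_res_max w x t t0 h (r : R) : 0 < r -> O x -> t0 < t -> heat_res w x t h ->
  (forall y, O y -> `|x - y| < r -> w y t <= w x t) ->
  (forall s, t0 <= s <= t -> w x s <= w x t) -> 0 <= h.
Proof.
move=> r0 Ox t0t [a [D [S [da dD dS ->]]]] mx mt.
have S0 i : S i <= 0.
  have [d1 d10 d1P] := open_line (evec R i) oO Ox.
  have [d2 d20 d2P] : exists2 d, 0 < d & forall k : R, `|k| < d ->
      `|x - (x + k *: evec R i)| < r.
    exists (r / (`|evec R i| + 1)) => [|k kd]; first by rewrite divr_gt0// ltr_wpDl.
    rewrite opprD addrA subrr sub0r normrN normrZ.
    rewrite (@le_lt_trans _ _ (`|k| * (`|evec R i| + 1)))//.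
      by rewrite ler_wpM2l// lerDl.
    by rewrite -ltr_pdivlMr// ltr_wpDl.
  pose d := Num.min d1 d2; have d0 : 0 < d by rewrite lt_min d10.
  apply: (@second_derivative_test R (fun k => w (x + k *: evec R i) t)
    (fun k => D i (x + k *: evec R i)) (S i) d d0).
  - move=> k; rewrite lt_min => /andP[k1 _].
    exact: (iffLR (@line_is_derive R N (w^~ t) x _ k _) (dD i _ (d1P k k1))).
  - exact: (iffLR (@line_is_derive0 R N (D i) x _ _) (dS i)).
  move=> k; rewrite lt_min => /andP[k1 k2]; rewrite scale0r addr0.
  by apply: mx; [exact: d1P|exact: d2P].
have a0 : 0 <= a.
  rewrite leNgt; apply/negP => a0.
  have D1 : is_derive (0 : R) 1 (fun k => - w x (t - k)) a.
    have D0 : is_derive (0 : R) 1 (fun k : R => t - k) (- 1).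
      by apply: is_derive_eq; rewrite /GRing.scale/=; ring.
    have D2 : is_derive (t - 0) 1 (w x) a by rewrite subr0.
    have D3 := @is_derive1_comp R (w x) (fun k : R => t - k) 0 a (- 1) D2 D0.
    by apply: is_derive_eq (is_deriveN D3) _; ring.
  have [d d0 dP] := right_growth_lt D1 a0.
  have m0 : 0 < Num.min d (t - t0) by rewrite lt_min d0 subr_gt0.
  have [k0] := half_gt0_lt m0; rewrite lt_min => /andP[k1 k2].
  have := dP (Num.min d (t - t0) / 2); rewrite k0 k1 => /(_ isT).
  rewrite mul0r addr0 subr0 ltrN2 ltNge mt//.
  by move: k0 k2; set k := _ / 2 => k0 k2; apply/andP; split; move: k0 k2; lra.
rewrite subr_ge0; apply: le_trans a0; rewrite -oppr_ge0 -sumrN.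
by apply: sumr_ge0 => i _; rewrite oppr_ge0.
Qed.

(** Starting at a positive time [t0] gives a compact cylinder on which [w] is continuous. A maximum
    inside [O] after [t0] contradicts the strictly negative residual. *)
Lemma max_principle w (t0 t1 : R) : compact (closure O) -> 0 < t0 ->
  {within closure O `*` `]0, +oo[, continuous (fun z : E * R => w z.1 z.2)} ->
  (forall x t, O x -> t0 < t <= t1 -> exists2 h, h < 0 & heat_res w x t h) ->
  (forall x t, bdry O x -> t0 <= t <= t1 -> w x t <= 0) ->
  (forall x, O x -> w x t0 <= 0) ->
  forall x t, O x -> t0 <= t <= t1 -> w x t <= 0.
Proof.
move=> cO t00 cw wres wb w0 x t Ox tt.
pose K := closure O `*` `[t0, t1]%classic.
have cK : compact K by apply: compact_setX => //; exact: segment_compact.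
have [||[z s]] := @compact_EVT_max (E * R)%type R (fun z : E * R => w z.1 z.2) K _ cK.
- by exists (x, t); split=> /=; [exact: subset_closure|rewrite in_itv].
- have sub : K `<=` closure O `*` `]0, +oo[.
    move=> [y r] [/= cy]; rewrite in_itv/= => /andP[tr _]; split => //=.
    by rewrite in_itv/= andbT (lt_le_trans t00).
  exact: (continuous_subspaceW sub cw).
rewrite inE => -[/= cz]; rewrite in_itv/= => /andP[ts st] smax.
have xz : w x t <= w z s.
  by apply: (smax (x, t)); rewrite inE; split=> /=; [exact: subset_closure|rewrite in_itv].
apply: le_trans xz _.
have [Oz|nOz] := pselect (O z); last by apply: wb => //; rewrite ts st.
have [s0|s0] := leP s t0.
  have -> : s = t0 by apply/eqP; rewrite eq_le s0 ts.
  exact: w0.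
have [|h hneg wh] := wres z s Oz; first by rewrite s0 st.
exfalso; move: hneg; rewrite ltNge => /negP; apply.
apply: (heat_res_max ltr01 Oz s0 wh) => [y Oy _|r /andP[r0 rs]].
  apply: (smax (y, s)); rewrite inE; split=> /=; first exact: subset_closure.
  by rewrite in_itv/= ts st.
apply: (smax (z, r)); rewrite inE; split=> //=.
by rewrite in_itv/= r0 (le_trans rs).
Qed.

End HeatOperator.

(** * Residuals of separated and self-similar terms *)

Section SimilarityTerm.
Context {R : realType} {N : nat}.
Local Notation E := 'rV[R]_N.
Variables (O V : set E).
Hypothesis oV : open V.
Hypothesis OV : O `<=` V.

(** Common shape of the comparison functions: the ansatz and the corrector use [q] = 1 / sqrt t, the
    initial layer uses 1 / sqrt (t + d). *)
Definition septerm (A s : E -> R) (P q f : R -> R) (x : E) (t : R) : R :=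
  A x * (P t * f (s x * q t)).

Lemma sum_second_order (p q m n : 'I_N -> R) (c1 c2 c3 c4 c r : R) :
  \sum_i (p i * c1 + 2 * (q i * (c2 * (c3 * (m i * r)))) +
    c * (c2 * (c4 * (m i * r) ^+ 2)) + c * (c2 * (c3 * (n i * r)))) =
  (\sum_i p i) * c1 + 2 * c2 * c3 * r * (\sum_i q i * m i) +
    c * c2 * c4 * r ^+ 2 * (\sum_i m i * m i) + c * c2 * c3 * r * (\sum_i n i).
Proof.
rewrite mulr_suml !mulr_sumr -!big_split/=; apply: eq_bigr => i _; ring.
Qed.

Lemma septerm_res A s (P q f f1 f2 : R -> R) (P' q' : R) x t :
  Ck V 2 A -> Ck V 2 s -> O x -> 0 < q t ->
  is_derive t 1 P P' -> is_derive t 1 q q' ->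
  (forall y, O y -> 0 < s y) ->
  (forall z : R, 0 < z -> is_derive z 1 f (f1 z)) ->
  (forall z : R, 0 < z -> is_derive z 1 f1 (f2 z)) ->
  let z := s x * q t in
  heat_res O (septerm A s P q f) x t
   (A x * (P' * f z + P t * (f1 z * (s x * q')))
    - (laplacian A x * (P t * f z) + 2 * P t * f1 z * q t * dot (grad A x) (grad s x)
      + A x * P t * f2 z * q t ^+ 2 * dot (grad s x) (grad s x)
      + A x * P t * f1 z * q t * laplacian s x)).
Proof.
move=> CA Cs Ox q0 PD qD spos fD f1D z.
have CA1 : Ck V 1 A by exact: Ck_le CA.
have Cs1 : Ck V 1 s by exact: Ck_le Cs.
have z0 y : O y -> 0 < s y * q t by move=> Oy; rewrite mulr_gt0// spos.
pose e i := evec R i : E.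
exists (A x * (P' * f z + P t * (f1 z * (s x * q')))).
exists (fun i y => 'D_(e i) A y * (P t * f (s y * q t)) +
   A y * (P t * (f1 (s y * q t) * ('D_(e i) s y * q t)))).
exists (fun i => 'D_(e i) ('D_(e i) A) x * (P t * f z) +
   2 * ('D_(e i) A x * (P t * (f1 z * ('D_(e i) s x * q t)))) +
   A x * (P t * (f2 z * ('D_(e i) s x * q t) ^+ 2)) +
   A x * (P t * (f1 z * ('D_(e i) ('D_(e i) s) x * q t)))).
have scal (g : E -> R) y (v : E) (dg : R) : is_derive y v g dg ->
    is_derive y v (fun y => g y * q t) (dg * q t).
  move=> D; have -> : (fun y => g y * q t) = (fun y => q t * g y).
    by apply/funext => u; rewrite mulrC.
  by rewrite mulrC; exact: (is_deriveZ (q t) D).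
have dz i y : O y -> is_derive y (e i) (fun y => s y * q t) ('D_(e i) s y * q t).
  by move=> Oy; apply: scal; exact: derivableP (Ck_derivable (v := e i) Cs1 (OV Oy)).
split.
- have D3 := @is_derive1_comp R f (fun t => s x * q t) t _ _ (fD _ (z0 x Ox))
    (is_deriveZ (s x) qD).
  have D4 := is_deriveM PD D3.
  apply: is_derive_eq (is_deriveZ (A x) D4) _.
  rewrite /GRing.scale/= -/z; ring.
- move=> i y Oy.
  have DA := derivableP (Ck_derivable (v := e i) CA1 (OV Oy)).
  have Df := is_derive_comp1 (fD _ (z0 y Oy)) (dz i y Oy).
  have D4 := is_deriveM DA (is_deriveZ (P t) Df).
  apply: is_derive_eq D4 _.
  rewrite /= /GRing.scale/=.
  by move: ('D_(e i) A y) ('D_(e i) s y) => a1 a2; ring.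
- move=> i.
  have DA := derivableP (Ck_derivable (v := e i) CA1 (OV Ox)).
  have DDA := derivableP (Ck_derivable (v := e i) (Ck_derive (e i) CA) (OV Ox)).
  have DDs := derivableP (Ck_derivable (v := e i) (Ck_derive (e i) Cs) (OV Ox)).
  have Df := is_derive_comp1 (fD _ (z0 x Ox)) (dz i x Ox).
  have Df1 := is_derive_comp1 (f1D _ (z0 x Ox)) (dz i x Ox).
  have Ds := scal _ _ _ _ DDs.
  have D5 := is_deriveM DDA (is_deriveZ (P t) Df).
  have D6 := is_deriveM DA (is_deriveZ (P t) (is_deriveM Df1 Ds)).
  apply: is_derive_eq (is_deriveD D5 D6) _.
  have Ef : ((fun y => f1 (s y * q t)) * (fun y => 'D_(e i) s y * q t)) x =
      f1 z * ('D_(e i) s x * q t) by [].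
  rewrite /= /GRing.scale/= Ef -/z.
  move: ('D_(e i) ('D_(e i) A) x) ('D_(e i) ('D_(e i) s) x) ('D_(e i) A x) ('D_(e i) s x).
  by move=> a1 a2 a3 a4; ring.
have dotE' F G : dot (grad F x) (grad G x) = \sum_i 'D_(e i) F x * 'D_(e i) G x.
  by apply: eq_bigr => i _; rewrite !mxE.
have sumE := sum_second_order (fun i => 'D_(e i) ('D_(e i) A) x)
  (fun i => 'D_(e i) A x) (fun i => 'D_(e i) s x) (fun i => 'D_(e i) ('D_(e i) s) x)
  (P t * f z) (P t) (f1 z) (f2 z) (A x) (q t).
rewrite -!dotE' in sumE.
exact: esym (f_equal (fun S => _ - S) sumE).
Qed.

Definition simterm (A s : E -> R) (j : nat) (f : R -> R) : E -> R -> R :=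
  septerm A s (fun t => Num.sqrt t ^+ j) (fun t => (Num.sqrt t)^-1) f.

Lemma is_derive_sqrt_pow (t : R) j : 0 < t -> is_derive t 1
  (fun t => Num.sqrt t ^+ j) (j%:R / 2 * (Num.sqrt t ^+ j / t)).
Proof.
move=> t0; have := is_derive1_sqrt t0 => D.
have -> : (fun t => Num.sqrt t ^+ j) = (Num.sqrt ^+ j : R -> R) by rewrite exprfctE.
have D2 := is_deriveX j D; apply: is_derive_eq D2 _.
have r0 : 0 < Num.sqrt t by rewrite sqrtr_gt0.
have -> : Num.sqrt t ^+ j / t = Num.sqrt t ^+ j / Num.sqrt t ^+ 2.
  by rewrite sqr_sqrtr// ltW.
rewrite /GRing.scale/=; case: (j) => [|k]; first by rewrite !mul0r.
rewrite exprS /=; by field; rewrite gt_eqF.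
Qed.

Lemma is_derive_rsqrt_time (t : R) : 0 < t -> is_derive t 1
  (fun t => (Num.sqrt t)^-1) (- ((Num.sqrt t)^-1 / 2 / t)).
Proof.
move=> t0; have r0 : 0 < Num.sqrt t by rewrite sqrtr_gt0.
have sn : Num.sqrt t != 0 by rewrite gt_eqF.
apply: is_derive_eq (is_deriveV sn (is_derive1_sqrt t0)) _.
have -> : (Num.sqrt t)^-1 / 2 / t = (Num.sqrt t)^-1 / 2 / Num.sqrt t ^+ 2.
  by rewrite sqr_sqrtr// ltW.
by rewrite /GRing.scale/=; field.
Qed.

(** The residual is sorted by powers of [r]: the similarity operator j/2 f - z/2 f' - |grad s|^2 f''
    comes at order r^(j-2), followed by orders r^(j-1) and r^j. *)
Lemma simterm_res A s j f f1 f2 x t : Ck V 2 A -> Ck V 2 s -> O x -> 0 < t ->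
  (forall y, O y -> 0 < s y) ->
  (forall z : R, 0 < z -> is_derive z 1 f (f1 z)) ->
  (forall z : R, 0 < z -> is_derive z 1 f1 (f2 z)) ->
  let r := Num.sqrt t in let z := s x / r in
  heat_res O (simterm A s j f) x t
   (A x * (r ^+ j / t) * (j%:R / 2 * f z - z / 2 * f1 z
       - f2 z * dot (grad s x) (grad s x))
    - r ^+ j / r * (2 * f1 z * dot (grad A x) (grad s x) + A x * f1 z * laplacian s x)
    - r ^+ j * f z * laplacian A x).
Proof.
move=> CA Cs Ox t0 spos fD f1D r z.
have r0 : 0 < r by rewrite sqrtr_gt0.
have rr : r ^+ 2 = t by rewrite sqr_sqrtr// ltW.
have ri0 : 0 < (Num.sqrt t)^-1 by rewrite invr_gt0.
have := septerm_res (q := fun t => (Num.sqrt t)^-1) (t := t) CA Cs Ox ri0 (is_derive_sqrt_pow j t0) (is_derive_rsqrt_time t0)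
  spos fD f1D; congr heat_res; rewrite -/r -/z.
move: (laplacian A x) (laplacian s x) (dot _ _) (dot _ _) => a1 a2 a3 a4.
by rewrite /z -rr; field; rewrite gt_eqF.
Qed.

End SimilarityTerm.

(** * Leibniz rules for gradient and Laplacian *)

Section LeibnizRules.
Context {R : realType} {N : nat}.
Local Notation E := 'rV[R]_N.
Variable V : set E.
Hypothesis oV : open V.
Implicit Types (f g : E -> R) (x : E).

Lemma gradD f g x : Ck V 1 f -> Ck V 1 g -> V x ->
  grad (fun y => f y + g y) x = grad f x + grad g x.
Proof.
move=> Cf Cg Vx; apply/rowP => i; rewrite !mxE.
have D1 := derivableP (Ck_derivable (v := evec R i) Cf Vx).
have D2 := derivableP (Ck_derivable (v := evec R i) Cg Vx).
by have [_ ->] := is_deriveD D1 D2.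
Qed.

Lemma gradM f g x : Ck V 1 f -> Ck V 1 g -> V x ->
  grad (fun y => f y * g y) x = f x *: grad g x + g x *: grad f x.
Proof.
move=> Cf Cg Vx; apply/rowP => i; rewrite !mxE.
have D1 := derivableP (Ck_derivable (v := evec R i) Cf Vx).
have D2 := derivableP (Ck_derivable (v := evec R i) Cg Vx).
have [_ ->] := is_deriveM D1 D2.
by [].
Qed.

Lemma laplacianM f g x : Ck V 2 f -> Ck V 2 g -> V x ->
  laplacian (fun y => f y * g y) x =
  f x * laplacian g x + 2 * dot (grad f x) (grad g x) + g x * laplacian f x.
Proof.
move=> Cf Cg Vx.
have Cf1 : Ck V 1 f by exact: Ck_le Cf.
have Cg1 : Ck V 1 g by exact: Ck_le Cg.
have E1 i : 'D_(evec R i) ('D_(evec R i) (fun y => f y * g y)) x =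
    f x * 'D_(evec R i) ('D_(evec R i) g) x +
    2 * ('D_(evec R i) f x * 'D_(evec R i) g x) +
    g x * 'D_(evec R i) ('D_(evec R i) f) x.
  have D1 y : V y -> is_derive y (evec R i) f ('D_(evec R i) f y).
    by move=> Vy; exact: derivableP (Ck_derivable (v := evec R i) Cf1 Vy).
  have D2 y : V y -> is_derive y (evec R i) g ('D_(evec R i) g y).
    by move=> Vy; exact: derivableP (Ck_derivable (v := evec R i) Cg1 Vy).
  have D3 := derivableP (Ck_derivable (v := evec R i) (Ck_derive (evec R i) Cf) Vx).
  have D4 := derivableP (Ck_derivable (v := evec R i) (Ck_derive (evec R i) Cg) Vx).
  have D5 := is_deriveD (is_deriveM (D1 x Vx) D4) (is_deriveM (D2 x Vx) D3).
  have -> : 'D_(evec R i) ('D_(evec R i) (fun y => f y * g y)) x =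
      'D_(evec R i) (fun y => f y * 'D_(evec R i) g y + g y * 'D_(evec R i) f y) x.
    apply: near_eq_derive; apply: (near_open oV Vx) => y Vy.
    by have [_ ->] := is_deriveM (D1 y Vy) (D2 y Vy).
  have [_ E5] := D5; apply: etrans E5 _; rewrite /GRing.scale/=.
  move: ('D_(evec R i) ('D_(evec R i) f) x) ('D_(evec R i) ('D_(evec R i) g) x).
  by move: ('D_(evec R i) f x) ('D_(evec R i) g x) => a1 a2 a3 a4; ring.
have E2 : laplacian (fun y => f y * g y) x = \sum_i (
    f x * 'D_(evec R i) ('D_(evec R i) g) x +
    2 * ('D_(evec R i) f x * 'D_(evec R i) g x) +
    g x * 'D_(evec R i) ('D_(evec R i) f) x) by apply: eq_bigr => i _; exact: E1.
have E3 : dot (grad f x) (grad g x) = \sum_i 'D_(evec R i) f x * 'D_(evec R i) g x.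
  by apply: eq_bigr => i _; rewrite !mxE.
have S (p q m : 'I_N -> R) c d : \sum_i (c * p i + 2 * q i + d * m i) =
    c * (\sum_i p i) + 2 * (\sum_i q i) + d * (\sum_i m i).
  by rewrite !mulr_sumr -!big_split.
by rewrite E3; exact: etrans E2 (S _ _ _ _ _).
Qed.

Lemma grad_comp1 (F : R -> R) f x (a : R) : is_derive (f x) 1 F a -> Ck V 1 f -> V x ->
  grad (fun y => F (f y)) x = a *: grad f x.
Proof.
move=> DF Cf Vx; apply/rowP => i; rewrite !mxE.
have D1 := derivableP (Ck_derivable (v := evec R i) Cf Vx).
by have [_ ->] := is_derive_comp1 DF D1.
Qed.

Lemma dot_grad_sqnorm f x : Ck V 2 f -> V x ->
  dot (grad (fun y => dot (grad f y) (grad f y)) x) (grad f x) =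
  2 * dot (grad f x *m hess f x) (grad f x).
Proof.
move=> Cf Vx.
have E0 j : grad (fun y => dot (grad f y) (grad f y)) x 0 j =
    \sum_i 2 * (grad f x 0 i * hess f x i j).
  rewrite mxE.
  have D i : is_derive x (evec R j) (fun y => grad f y 0 i * grad f y 0 i)
      (2 * (grad f x 0 i * hess f x i j)).
    have D1 : is_derive x (evec R j) (fun y => grad f y 0 i) (hess f x i j).
      rewrite hessE; have -> : (fun y => grad f y 0 i) = 'D_(evec R i) f.
        by apply/funext => y; rewrite mxE.
      exact: derivableP (Ck_derivable (v := evec R j) (Ck_derive (evec R i) Cf) Vx).
    by apply: is_derive_eq (is_deriveM D1 D1) _; rewrite /GRing.scale/=; ring.
  have -> : (fun y => dot (grad f y) (grad f y)) =
      \sum_i (fun y => grad f y 0 i * grad f y 0 i).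
    by apply/funext => y; rewrite fct_sumE.
  by have [_ ->] := is_derive_sum D.
rewrite /dot mulr_sumr; apply: eq_bigr => j _; rewrite E0.
have -> : (grad f x *m hess f x) 0 j = \sum_i grad f x 0 i * hess f x i j.
  by rewrite mxE.
rewrite !mulr_suml mulr_sumr.
by apply: eq_bigr => i _; ring.
Qed.

End LeibnizRules.

(** * A smooth substitute for the distance to the boundary *)

Section BoundaryDepth.
Context {R : realType} {N : nat}.
Local Notation E := 'rV[R]_N.
Variable m : E -> R.
Hypothesis Cm : forall n, Ck setT n m.
Implicit Types (x : E).

(** The square of [m] keeps the normaliser positive at critical points of [m] off its zero set; on
    the zero set only the squared gradient remains. *)
Definition gramQ x := dot (grad m x) (grad m x) + m x * m x.
Definition depthV : set E := [set x | 0 < gramQ x].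
Definition gam x := rsqrt (gramQ x).
(* A global substitute for the distance to the zero set of [m]: on that set
   [grad depth] is a unit vector. *)
Definition depth x := m x * gam x.
Definition dbeta x := 2 * dot (grad m x) (grad gam x).
Definition dzeta x := dot (grad gam x) (grad gam x) * gramQ x - 1.
Definition bcoef x := - (1 / 4) * dbeta x.
Definition acoef x := 1 / 2 * laplacian depth x + bcoef x.

Lemma CkT_gramQ n : Ck setT n gramQ.
Proof.
apply: (CkD openT); last by apply: (CkM openT).
by apply: Ck_dotgrad; [exact: openT|exact: Cm|exact: Cm].
Qed.

Lemma open_depthV : open depthV.
Proof.
have -> : depthV = gramQ @^-1` [set y | 0 < y] by [].
apply: open_comp; last exact: open_gt.
by move=> x _; exact: Ck_cont (CkT_gramQ 0).
Qed.

Let oV := open_depthV.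

Lemma Ck_m n : Ck depthV n m.
Proof. by apply: Ck_sub (Cm n). Qed.
Lemma Ck_gramQ n : Ck depthV n gramQ.
Proof. by apply: Ck_sub (CkT_gramQ n). Qed.
Lemma Ck_gam n : Ck depthV n gam.
Proof. by apply: (Ck_rsqrt oV) => //; exact: Ck_gramQ. Qed.
Lemma Ck_depth n : Ck depthV n depth.
Proof. by apply: (CkM oV); [exact: Ck_m|exact: Ck_gam]. Qed.
Lemma Ck_dbeta n : Ck depthV n dbeta.
Proof.
apply: (CkZ oV); apply: Ck_dotgrad; [exact: oV|exact: Ck_m|exact: Ck_gam].
Qed.
Lemma Ck_dzeta n : Ck depthV n dzeta.
Proof.
apply: (CkD oV); last exact: Ck_cst.
apply: (CkM oV); last exact: Ck_gramQ.
apply: Ck_dotgrad; [exact: oV|exact: Ck_gam|exact: Ck_gam].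
Qed.
Lemma gam_gt0 x : depthV x -> 0 < gam x.
Proof. by move=> Vx; rewrite invr_gt0 sqrtr_gt0. Qed.

Lemma gam_sqr x : depthV x -> gam x ^+ 2 * gramQ x = 1.
Proof.
move=> Vx; have Q0 : 0 < gramQ x by [].
by rewrite /gam /rsqrt exprVn sqr_sqrtr ?ltW// mulVf// gt_eqF.
Qed.

(** By [gam_sqr], gam^2 |grad m|^2 = 1 - depth^2 and m^2 = depth^2 gramQ. Inserted into the squared
    product rule for [depth], these give an exact identity; the -1 in [dzeta] comes from the
    first. *)
Lemma grad_depth_sqr x : depthV x ->
  dot (grad depth x) (grad depth x) = 1 + dbeta x * depth x + dzeta x * depth x ^+ 2.
Proof.
move=> Vx.
have E1 : grad depth x = m x *: grad gam x + gam x *: grad m x.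
  exact: (gradM (Ck_m 1) (Ck_gam 1) Vx).
have D (v w : E) (a b : R) : dot (a *: v + b *: w) (a *: v + b *: w) =
    a ^+ 2 * dot v v + 2 * a * b * dot w v + b ^+ 2 * dot w w.
  by rewrite dotDl !dotDr !dotZl !dotZr (dotC v w); ring.
have e0 : gam x ^+ 2 * (dot (grad m x) (grad m x) + m x * m x) = 1 := gam_sqr Vx.
rewrite E1 D; apply: etrans (_ : _ = 1 + (2 * dot (grad m x) (grad gam x)) * (m x * gam x) +
  (dot (grad gam x) (grad gam x) * (dot (grad m x) (grad m x) + m x * m x) - 1) *
  (m x * gam x) ^+ 2) _ => //; move: e0.
move: (dot (grad gam x) (grad gam x)) (dot (grad m x) (grad gam x)).
move: (dot (grad m x) (grad m x)) (gam x) (m x) => G g y Z B e.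
apply/eqP; rewrite -subr_eq0; apply/eqP.
transitivity ((y ^+ 2 * Z - 1) * (1 - g ^+ 2 * (G + y * y))); first by ring.
by rewrite e subrr mulr0.
Qed.


Lemma grad_depth0 x : depthV x -> m x = 0 -> grad depth x = gam x *: grad m x.
Proof.
move=> Vx m0; have -> : grad depth x = m x *: grad gam x + gam x *: grad m x.
  exact: (gradM (Ck_m 1) (Ck_gam 1) Vx).
by rewrite m0 scale0r add0r.
Qed.

Lemma dot_grad_gramQ0 x : m x = 0 ->
  dot (grad gramQ x) (grad m x) = 2 * dot (grad m x *m hess m x) (grad m x).
Proof.
move=> m0; have Cg : Ck setT 1 (fun y => dot (grad m y) (grad m y)).
  by apply: Ck_dotgrad; [exact: openT|exact: Cm|exact: Cm].
have Cmm : Ck setT 1 (fun y => m y * m y) by exact: (CkM openT (Cm 1) (Cm 1)).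
have -> : grad gramQ x = grad (fun y => dot (grad m y) (grad m y)) x +
    grad (fun y => m y * m y) x by exact: (gradD Cg Cmm (I : setT x)).
have -> : grad (fun y => m y * m y) x = m x *: grad m x + m x *: grad m x.
  exact: (gradM (Cm 1) (Cm 1) (I : setT x)).
by rewrite m0 scale0r !addr0; exact: (dot_grad_sqnorm (Cm 2) (I : setT x)).
Qed.

(** On the zero set the Laplacian of [depth] is [dbeta x + gam x * laplacian m x], and [dbeta] is -2
    gam^3 times the Hessian form on [grad m]. Half of [dbeta] minus a quarter of it leaves half of
    the normal part of the curvature. *)
Lemma acoef_curv x : depthV x -> m x = 0 -> acoef x = 1 / 2 * curv m x.
Proof.
move=> Vx m0; have QE : gramQ x = dot (grad m x) (grad m x).
  by rewrite /gramQ m0 mul0r addr0.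
have G0 : grad m x != 0.
  by apply/eqP => G0; have : 0 < gramQ x by []; rewrite QE G0 dot0l ltxx.
have lapE : laplacian depth x =
    m x * laplacian gam x + dbeta x + gam x * laplacian m x.
  exact: (laplacianM oV (Ck_m 2) (Ck_gam 2) Vx).
have gradE : grad gam x = (- 2^-1 * gam x ^+ 3) *: grad gramQ x.
  exact: (grad_comp1 (is_derive_rsqrt Vx) (Ck_gramQ 1) Vx).
have bE : dbeta x = - (2 * gam x ^+ 3 * dot (grad m x *m hess m x) (grad m x)).
  rewrite /dbeta gradE dotZr dotC dot_grad_gramQ0//; by field.
have cE : curv m x = laplacian m x * gam x -
    dot (grad m x *m hess m x) (grad m x) * gam x ^+ 3.
  have gE : gam x = normcoef (grad m x) by rewrite /gam QE.
  have e1 : (eucl (grad m x))^-1 = gam x by rewrite gE normcoefE.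
  have e2 : (dot (grad m x) (grad m x))^-1 = gam x ^+ 2.
    rewrite -[LHS]mul1r -(gam_sqr Vx) QE mulfK// gt_eqF//.
    exact: dot_gt0.
  by rewrite /curv /tanlap e1 e2; ring.
have -> : acoef x = 1 / 2 * laplacian depth x - 1 / 4 * dbeta x.
  by rewrite -mulNr.
rewrite cE; move: lapE bE; rewrite m0; move: (laplacian depth x) (laplacian gam x).
move: (laplacian m x) (dbeta x) (dot _ _) (gam x) => a b c g d e -> ->; by field.
Qed.

End BoundaryDepth.

(** * The two-term boundary layer ansatz *)

Section BoundaryLayer.
Context {R : realType} {N : nat}.
Local Notation E := 'rV[R]_N.

(** The geometry as seen by the heat estimates. [V] is an open neighbourhood of the closure, so
    derivatives of [s] at boundary points are two-sided. *)
Record depth_data (O V : set E) (s be ze : E -> R) : Prop := {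
  dd_open : open O;
  dd_compact : compact (closure O);
  dd_openV : open V;
  dd_sub : closure O `<=` V;
  dd_Cks : forall n, Ck V n s;
  dd_Ckbe : forall n, Ck V n be;
  dd_Ckze : forall n, Ck V n ze;
  dd_pos : forall x, O x -> 0 < s x;
  dd_bdry : forall x, bdry O x -> s x = 0;
  dd_eik : forall x, O x ->
    dot (grad s x) (grad s x) = 1 + be x * s x + ze x * s x ^+ 2 }.

Variables (O V : set E) (s be ze : E -> R).
Hypothesis H : depth_data O V s be ze.
Implicit Types (x y : E) (t : R) (g : E -> R -> R).

Let oV := dd_openV H.
Let OV : O `<=` V.
Proof. by move=> x Ox; apply: dd_sub H _ _; exact: subset_closure. Qed.

(** The operator f/2 - z f'/2 - f'' maps z (1 - Phi) to 2 phi and z^2 phi to (2 z^2 - 2) phi, while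
    [Phi] itself leaves (beta z^2 / 2 - Laplacian s) phi at order 1/r. Cancellation forces b = -
    beta / 4 and a = Laplacian s / 2 + b. *)
Definition layer_b (be : E -> R) x := - (1 / 4) * be x.
Definition layer_a (s be : E -> R) x := 1 / 2 * laplacian s x + layer_b be x.
Local Notation b := (layer_b be).
Local Notation a := (layer_a s be).

Lemma Ck_b n : Ck V n b.
Proof. by apply: (CkZ oV); exact: dd_Ckbe H n. Qed.
Lemma Ck_a n : Ck V n a.
Proof.
apply: (CkD oV); last exact: Ck_b.
by apply: (CkZ oV); apply: Ck_laplacian; [exact: oV|exact: dd_Cks H _].
Qed.

Lemma Ck_bounded (F : E -> R) : Ck V 0 F -> exists C, forall x, closure O x -> `|F x| <= C.
Proof.
move=> CF; have cF : {within closure O, continuous F}.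
  apply: continuous_in_subspaceT => x; rewrite inE => cx.
  exact: Ck_continuous CF (dd_sub H cx).
have [C [_ CP]] := compact_bounded (continuous_compact cF (dd_compact H)).
exists (C + 1) => x cx; apply: (CP (C + 1)); first by rewrite ltrDl.
by exists x.
Qed.

(** Bounds uniform up to t = 0. Being closed under sums and products, they let boundedness of a
    residual be read off from its shape. *)
Definition bdd g := exists C, forall x t, O x -> 0 < t <= 1 -> `|g x t| <= C.

Lemma bddD g1 g2 : bdd g1 -> bdd g2 -> bdd (fun x t => g1 x t + g2 x t).
Proof.
move=> [C1 H1] [C2 H2]; exists (C1 + C2) => x t Ox tt.
by apply: le_trans (ler_normD _ _) _; apply: lerD; [exact: H1|exact: H2].
Qed.
Lemma bddM g1 g2 : bdd g1 -> bdd g2 -> bdd (fun x t => g1 x t * g2 x t).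
Proof.
move=> [C1 H1] [C2 H2]; exists (C1 * C2) => x t Ox tt.
by rewrite normrM; apply: ler_pM => //; [exact: H1|exact: H2].
Qed.
Lemma bddN g : bdd g -> bdd (fun x t => - g x t).
Proof. by move=> [C HC]; exists C => x t Ox tt; rewrite normrN; exact: HC. Qed.
Lemma bdd_cst (c : R) : bdd (fun _ _ => c).
Proof. by exists `|c|. Qed.
Lemma bdd_Ck (F : E -> R) : Ck V 0 F -> bdd (fun x _ => F x).
Proof.
move=> CF; have [C HC] := Ck_bounded CF; exists C => x t Ox _; apply: HC.
exact: subset_closure.
Qed.
Lemma bdd_sqrt : bdd (fun _ t => Num.sqrt t).
Proof.
exists 1 => _ t _ /andP[t0 t1]; rewrite ger0_norm ?sqrtr_ge0//.
by rewrite -[leRHS]sqrtr1 ler_sqrt.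
Qed.
Lemma bdd_profile (h : R -> R) C : (forall z, 0 <= z -> `|h z| <= C) ->
  bdd (fun x t => h (s x / Num.sqrt t)).
Proof.
move=> HC; exists C => x t Ox /andP[t0 _]; apply: HC.
by rewrite divr_ge0 ?sqrtr_ge0// ltW// (dd_pos H).
Qed.

Lemma bdd_laplacian (F : E -> R) : Ck V 2 F -> bdd (fun x _ => laplacian F x).
Proof. by move=> CF; apply: bdd_Ck; apply: Ck_laplacian. Qed.
Lemma bdd_dotgrad (F G : E -> R) : Ck V 1 F -> Ck V 1 G ->
  bdd (fun x _ => dot (grad F x) (grad G x)).
Proof. by move=> CF CG; apply: bdd_Ck; apply: Ck_dotgrad. Qed.

Variables (Phi : R -> R) (c0 C1 : R).
Hypothesis HPhi : is_profile Phi c0 C1.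

Definition gphi (c0 z : R) : R := c0 * expR (- z ^+ 2 / 4).
Definition prof1 (Phi : R -> R) (z : R) : R := z * (1 - Phi z).
Definition prof2 (c0 z : R) : R := z ^+ 2 * gphi c0 z.
Local Notation phi := (gphi c0).

Lemma profile_derive (z : R) : 0 <= z -> is_derive z 1 Phi (phi z).
Proof.
by case: HPhi => _ _ _ D _ z0; apply: D; rewrite (lt_le_trans _ z0)// oppr_lt0.
Qed.

Lemma gphi_derive (z : R) : is_derive z 1 phi (- (z / 2) * phi z).
Proof.
have D0 : is_derive z 1 (fun z : R => - z ^+ 2 / 4) (- (z / 2)).
  have -> : (fun z : R => - z ^+ 2 / 4) = (fun z : R => (- 4^-1) * (z * z)).
    by apply/funext => u; field.
  apply: is_derive_eq; rewrite /GRing.scale/=; by field.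
have D1 := @is_derive1_comp R expR (fun z : R => - z ^+ 2 / 4) z _ _ (is_derive_expR _) D0.
by apply: is_derive_eq (is_deriveZ c0 D1) _; rewrite /GRing.scale/= /gphi; ring.
Qed.

Lemma prof1_derive (z : R) : 0 <= z ->
  is_derive z 1 (prof1 Phi) (1 - Phi z - z * phi z).
Proof.
move=> z0; have D := profile_derive z0.
have D1 : is_derive z 1 (fun z => 1 - Phi z) (- phi z).
  by apply: is_derive_eq (is_deriveB (is_derive_cst (1 : R) z 1) D) _; rewrite sub0r.
by apply: is_derive_eq (is_deriveM (is_derive_id z 1) D1) _; rewrite /GRing.scale/=; ring.
Qed.

Lemma prof1_derive2 (z : R) : 0 <= z ->
  is_derive z 1 (fun z => 1 - Phi z - z * phi z) ((z ^+ 2 / 2 - 2) * phi z).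
Proof.
move=> z0; have D := profile_derive z0; have D2 := gphi_derive z.
have D1 : is_derive z 1 (fun z => 1 - Phi z) (- phi z).
  by apply: is_derive_eq (is_deriveB (is_derive_cst (1 : R) z 1) D) _; rewrite sub0r.
have D3 := is_deriveM (is_derive_id z 1) D2.
by apply: is_derive_eq (is_deriveB D1 D3) _; rewrite /GRing.scale/=; ring.
Qed.

Lemma is_derive_pow (z : R) n : is_derive z 1 (fun z => z ^+ n) (n%:R * z ^+ n.-1).
Proof.
have -> : (fun z => z ^+ n) = (id ^+ n : R -> R) by rewrite exprfctE.
have D := is_deriveX n (is_derive_id z 1); apply: is_derive_eq D _.
by rewrite /GRing.scale/= mulr1.
Qed.

Lemma prof2_derive (z : R) :
  is_derive z 1 (prof2 c0) ((2 * z - z ^+ 3 / 2) * phi z).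
Proof.
have D2 := gphi_derive z.
apply: is_derive_eq (is_deriveM (is_derive_pow z 2) D2) _.
by rewrite /GRing.scale/=; ring.
Qed.

Lemma prof2_derive2 (z : R) :
  is_derive z 1 (fun z => (2 * z - z ^+ 3 / 2) * phi z)
    ((2 - 5 * z ^+ 2 / 2 + z ^+ 4 / 4) * phi z).
Proof.
have D2 := gphi_derive z.
have D1 : is_derive z 1 (fun z : R => 2 * z - z ^+ 3 / 2) (2 - 3 * z ^+ 2 / 2).
  have D3 := is_derive_pow z 3.
  have -> : (fun z : R => 2 * z - z ^+ 3 / 2) = (fun z : R => 2 * z - 2^-1 * z ^+ 3).
    by apply/funext => u; field.
  apply: is_derive_eq (is_deriveB (is_deriveZ 2 (is_derive_id z 1)) (is_deriveZ 2^-1 D3)) _.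
  by rewrite /GRing.scale/=; field.
by apply: is_derive_eq (is_deriveM D1 D2) _; rewrite /GRing.scale/=; field.
Qed.

Lemma bdd_gphi n : bdd (fun x t => (s x / Num.sqrt t) ^+ n * phi (s x / Num.sqrt t)).
Proof.
apply: (@bdd_profile (fun z => z ^+ n * phi z) (c0 * (1 + 4 ^+ n * n`!%:R))) => z z0.
have [c00 _ _ _ _] := HPhi.
rewrite ger0_norm; last by rewrite !mulr_ge0 ?exprn_ge0 ?expR_ge0// ltW.
by rewrite mulrCA ler_pM2l//; exact: gauss_moment_bound.
Qed.

Lemma mul_expRN_le1 (z : R) : 0 <= z -> z * expR (- z) <= 1.
Proof.
move=> z0; rewrite expRN ler_pdivrMr ?expR_gt0// mul1r.
by apply: le_trans (expR_ge1Dx z); rewrite lerDr.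
Qed.

Lemma profile_tail z : 0 <= z -> `|1 - Phi z| <= C1 /\ `|prof1 Phi z| <= C1.
Proof.
have [_ C10 _ _ tail] := HPhi => z0; have /andP[p1 p2] := tail z z0.
rewrite /prof1 ger0_norm// normrM (ger0_norm z0) (ger0_norm p1); split.
  apply: le_trans p2 _; rewrite -[leRHS]mulr1 ler_wpM2l//.
  by rewrite -expR0 ler_expR oppr_le0.
apply: le_trans (ler_wpM2l z0 p2) _.
by rewrite mulrCA -[leRHS]mulr1 ler_wpM2l// mul_expRN_le1.
Qed.

(** The residual of the ansatz with its ingredients replaced by variables, so that the closure rules
    of [bdd] apply by syntax alone; [m n] stands for z^n phi(z). *)
Lemma bdd_residual_form (A B D Z L LA LB DA DB q p r : E -> R -> R)
    (m : nat -> E -> R -> R) :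
  bdd A -> bdd B -> bdd D -> bdd Z -> bdd L -> bdd LA -> bdd LB -> bdd DA -> bdd DB ->
  bdd q -> bdd p -> bdd r -> (forall n, bdd (m n)) ->
  bdd (fun x t => 1 / 2 * (m 3 x t * Z x t)
  - A x t * (1 / 2 * (D x t * m 3 x t + Z x t * (m 4 x t * r x t))
     - 2 * (D x t * m 1 x t + Z x t * (m 2 x t * r x t)))
  - B x t * (2 * (D x t * m 1 x t + Z x t * (m 2 x t * r x t))
     - 5 / 2 * (D x t * m 3 x t + Z x t * (m 4 x t * r x t))
     + 1 / 4 * (D x t * m 5 x t + Z x t * (m 6 x t * r x t)))
  - (q x t - m 1 x t) * (2 * DA x t + A x t * L x t)
  - (2 * m 1 x t - 1 / 2 * m 3 x t) * (2 * DB x t + B x t * L x t)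
  - r x t * (p x t * LA x t + m 2 x t * LB x t)).
Proof.
move=> BA BB BD BZ BL BLA BLB BDA BDB Bq Bp Br Bm.
by do ?[exact: bdd_cst | exact: Bm | assumption | apply: bddN | apply: bddD | apply: bddM].
Qed.

(* Two-term expansion Phi(z) + r (a z (1 - Phi(z)) + b z^2 phi(z)), r = sqrt t and
   z = s/r. The coefficients [layer_a] and [layer_b] are the ones for which the
   terms of order 1/r in its heat residual cancel. *)
Definition ansatz (s be : E -> R) (Phi : R -> R) (c0 : R) x t : R :=
  simterm (fun _ => 1) s 0 Phi x t +
  (simterm (layer_a s be) s 1 (prof1 Phi) x t + simterm (layer_b be) s 1 (prof2 c0) x t).

Lemma ansatz_res_bounded : exists C, forall x t, O x -> 0 < t <= 1 ->
  exists2 h, `|h| <= C & heat_res O (ansatz s be Phi c0) x t h.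
Proof.
pose r t := Num.sqrt t; pose z x t := s x / r t.
(* The eikonal defect divided by [r]: on [O], |grad s|^2 = 1 + r E1. *)
pose E1 x t := be x * z x t + ze x * z x t ^+ 2 * r t.
pose g x t := z x t ^+ 3 / 2 * phi (z x t) * ze x
  - a x * ((z x t ^+ 2 / 2 - 2) * phi (z x t)) * E1 x t
  - b x * ((2 - 5 * z x t ^+ 2 / 2 + z x t ^+ 4 / 4) * phi (z x t)) * E1 x t
  - (1 - Phi (z x t) - z x t * phi (z x t)) *
      (2 * dot (grad a x) (grad s x) + a x * laplacian s x)
  - (2 * z x t - z x t ^+ 3 / 2) * phi (z x t) *
      (2 * dot (grad b x) (grad s x) + b x * laplacian s x)
  - r t * (prof1 Phi (z x t) * laplacian a x + prof2 c0 (z x t) * laplacian b x).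
pose m n x t := z x t ^+ n * phi (z x t).
suff [C CP] : bdd g.
  exists C => x t Ox tt; exists (g x t); first exact: CP.
  have /andP[t0 t1] := tt.
  have C1V := Ck_cst oV 2 (1 : R).
  have h1 := simterm_res OV 0 C1V (dd_Cks H 2) Ox t0 (dd_pos H)
    (fun z z0 => profile_derive (ltW z0)) (fun z _ => gphi_derive z).
  have h2 := simterm_res OV 1 (Ck_a 2) (dd_Cks H 2) Ox t0 (dd_pos H)
    (fun z z0 => prof1_derive (ltW z0)) (fun z z0 => prof1_derive2 (ltW z0)).
  have h3 := simterm_res OV 1 (Ck_b 2) (dd_Cks H 2) Ox t0 (dd_pos H)
    (fun z _ => prof2_derive z) (fun z _ => prof2_derive2 z).
  have g1 : grad (fun _ : E => 1) x = 0 by exact: grad_cst.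
  have l1 : laplacian (fun _ : E => 1) x = 0.
    by rewrite laplacian_hess hess_cst big1// => i _; rewrite mxE.
  rewrite g1 l1 dot0l in h1.
  have := heat_resD h1 (heat_resD h2 h3); congr heat_res.
  have r0 : 0 < r t by rewrite sqrtr_gt0.
  have tE : t = r t ^+ 2 by rewrite sqr_sqrtr// ltW.
  have sE : s x = z x t * r t by rewrite /z divfK// gt_eqF.
  have bE : be x = - 4 * b x by rewrite /layer_b; field.
  have LE : laplacian s x = 2 * (a x - b x) by rewrite /layer_a; field.
  rewrite (dd_eik H Ox) /g /E1 -/(r t) -/(z x t) sE bE LE.
  move: (laplacian a x) (laplacian b x) (dot (grad a x) (grad s x)) (dot (grad b x) (grad s x)).
  move: (a x) (b x) (ze x) (z x t) (r t) r0 tE => a0 b0 ze0 z0 r0 rp -> La Lb Da Db.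
  rewrite /prof1 /prof2; move: (phi z0) (Phi z0) => p P.
  field.
  by rewrite gt_eqF.
have -> : g = fun x t => 1 / 2 * (m 3 x t * ze x)
  - a x * (1 / 2 * (be x * m 3 x t + ze x * (m 4 x t * r t))
     - 2 * (be x * m 1 x t + ze x * (m 2 x t * r t)))
  - b x * (2 * (be x * m 1 x t + ze x * (m 2 x t * r t))
     - 5 / 2 * (be x * m 3 x t + ze x * (m 4 x t * r t))
     + 1 / 4 * (be x * m 5 x t + ze x * (m 6 x t * r t)))
  - (1 - Phi (z x t) - m 1 x t) * (2 * dot (grad a x) (grad s x) + a x * laplacian s x)
  - (2 * m 1 x t - 1 / 2 * m 3 x t) * (2 * dot (grad b x) (grad s x) + b x * laplacian s x)
  - r t * (prof1 Phi (z x t) * laplacian a x + m 2 x t * laplacian b x).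
  apply/funext => x; apply/funext => t; rewrite /g /m /E1 /prof2.
  move: (laplacian a x) (laplacian b x) (dot (grad a x) (grad s x)) (dot (grad b x) (grad s x)).
  move: (laplacian s x) (a x) (b x) (ze x) (be x) (z x t) (r t).
  move=> L a0 b0 ze0 be0 z0 r0 La Lb Da Db.
  by move: (phi z0) (Phi z0) (prof1 Phi z0) => p P p1; field.
have Bm n : bdd (m n) by exact: bdd_gphi.
have Bq : bdd (fun x t => 1 - Phi (z x t)).
  apply: (@bdd_profile (fun z => 1 - Phi z) C1) => y y0.
  exact: proj1 (profile_tail y0).
have Bp : bdd (fun x t => prof1 Phi (z x t)).
  apply: (@bdd_profile (prof1 Phi) C1) => y y0.
  exact: proj2 (profile_tail y0).
have Br : bdd (fun _ => r) by exact: bdd_sqrt.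
have Ba := bdd_Ck (Ck_a 0); have Bb := bdd_Ck (Ck_b 0).
have Bbe := bdd_Ck (dd_Ckbe H 0); have Bze := bdd_Ck (dd_Ckze H 0).
have BL := bdd_laplacian (dd_Cks H 2).
have BLa := bdd_laplacian (Ck_a 2); have BLb := bdd_laplacian (Ck_b 2).
have BDa := bdd_dotgrad (Ck_a 1) (dd_Cks H 1).
have BDb := bdd_dotgrad (Ck_b 1) (dd_Cks H 1).
by have := bdd_residual_form Ba Bb Bbe Bze BL BLa BLb BDa BDb Bq Bp Br Bm.
Qed.

End BoundaryLayer.

(** * Continuity of the comparison functions and the corrector *)

Section Comparison.
Context {R : realType} {N : nat}.
Local Notation E := 'rV[R]_N.
Variables (O V : set E) (s be ze : E -> R).
Hypothesis H : depth_data O V s be ze.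
Implicit Types (x y : E) (t : R) (f : E -> R -> R).

Let oV := dd_openV H.
Let OV : O `<=` V.
Proof. by move=> x Ox; apply: dd_sub H _ _; exact: subset_closure. Qed.

Lemma depth_ge0 x : closure O x -> 0 <= s x.
Proof.
move=> cx; have [Ox|nO] := pselect (O x); first by rewrite ltW// (dd_pos H).
by rewrite (dd_bdry H).
Qed.

Lemma is_derive_continuous (g : R -> R) (z d : R) : is_derive z 1 g d ->
  {for z, continuous g}.
Proof. by move=> [D _]; apply: differentiable_continuous; apply/derivable1_diffP. Qed.

Lemma septerm_continuous (A : E -> R) (P q g : R -> R) : Ck V 0 A ->
  (forall t : R, 0 < t -> {for t, continuous P}) ->
  (forall t : R, 0 < t -> {for t, continuous q}) -> (forall t, 0 < t -> 0 <= q t) ->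
  (forall z, 0 <= z -> {for z, continuous g}) ->
  {within closure O `*` `]0, +oo[,
    continuous (fun z : E * R => septerm A s P q g z.1 z.2)}.
Proof.
move=> CA cP cq q0 cg; apply: continuous_in_subspaceT => -[x t].
rewrite inE => -[/= cx]; rewrite in_itv/= andbT => t0.
have Vx := dd_sub H cx.
have c1 (F : E -> R) : Ck V 0 F -> {for (x, t), continuous (fun z : E * R => F z.1)}.
  move=> CF; apply: (@continuous_comp _ _ _ (fun z : E * R => z.1) F).
    exact: cvg_fst.
  exact: Ck_continuous CF Vx.
have c2 (G : R -> R) : {for t, continuous G} ->
    {for (x, t), continuous (fun z : E * R => G z.2)}.
  move=> cG; apply: (@continuous_comp _ _ _ (fun z : E * R => z.2) G).
    exact: cvg_snd.
  exact: cG.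
have c3 : {for (x, t), continuous (fun z : E * R => s z.1 * q z.2)}.
  by apply: cvgM; [exact: c1 (dd_Cks H 0)|exact: c2 (cq t t0)].
have c4 : {for (x, t), continuous (fun z : E * R => g (s z.1 * q z.2))}.
  apply: (@continuous_comp _ _ _ (fun z : E * R => s z.1 * q z.2) g).
    exact: c3.
  by apply: cg; rewrite mulr_ge0 ?depth_ge0// q0.
apply: cvgM; first exact: c1 CA.
by apply: cvgM; [exact: c2 (cP t t0)|exact: c4].
Qed.

Lemma simterm_continuous (A : E -> R) j (g : R -> R) : Ck V 0 A ->
  (forall z, 0 <= z -> {for z, continuous g}) ->
  {within closure O `*` `]0, +oo[, continuous (fun z : E * R => simterm A s j g z.1 z.2)}.
Proof.
move=> CA cg; apply: septerm_continuous => // t t0.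
- exact: is_derive_continuous (is_derive_sqrt_pow j t0).
- exact: is_derive_continuous (is_derive_rsqrt_time t0).
Qed.

Lemma withinD {T : topologicalType} (F G : T -> R) (K : set T) : {within K, continuous F} ->
  {within K, continuous G} -> {within K, continuous (fun z => F z + G z)}.
Proof. by move=> cF cG z; apply: cvgD; [exact: cF|exact: cG]. Qed.

Lemma withinZ {T : topologicalType} (F : T -> R) (c : R) (K : set T) : {within K, continuous F} ->
  {within K, continuous (fun z => c * F z)}.
Proof. by move=> cF z; apply: cvgM; [exact: cvg_cst|exact: cF]. Qed.

Definition corr_profile (z : R) : R := 1 - expR (- z).
(** It vanishes on the boundary with inward slope sqrt t, so an error bound by a multiple of it
    passes to the flux with an error of order sqrt t. *)
Definition corrector (s : E -> R) : E -> R -> R :=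
  simterm (fun _ => 1) s 2 corr_profile.

Lemma is_derive_expN (z : R) : is_derive z 1 (fun z : R => expR (- z)) (- expR (- z)).
Proof.
have D0 : is_derive z 1 (fun z : R => - z) (- 1).
  exact: (is_deriveN (is_derive_id z 1)).
by have := @is_derive1_comp R expR (fun z : R => - z) z _ _ (is_derive_expR _) D0; rewrite mulrN1.
Qed.

Lemma corr_profile_derive (z : R) : is_derive z 1 corr_profile (expR (- z)).
Proof.
have D := is_deriveB (is_derive_cst (1 : R) z 1) (is_derive_expN z).
by apply: is_derive_eq D _; rewrite sub0r opprK.
Qed.

Lemma bdd_pow_expN n :
  bdd O (fun x t => (s x / Num.sqrt t) ^+ n * expR (- (s x / Num.sqrt t))).
Proof.
apply: (bdd_profile H (h := fun z => z ^+ n * expR (- z)) (C := n`!%:R)) => z z0.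
rewrite ger0_norm ?mulr_ge0 ?exprn_ge0 ?expR_ge0//.
by rewrite expRN ler_pdivrMr ?expR_gt0//; exact: expR_ge_pow.
Qed.

(** To leading order the residual is 1 - z exp(-z) / 2, at least 1/2 because z exp(-z) <= 1. The
    remainder is [r] times a bounded function and drops below 1/4 once r <= k. *)
Lemma corrector_res : exists2 t1, 0 < t1 <= 1 & forall x t, O x -> 0 < t <= t1 ->
  exists2 h, 1 / 4 <= h & heat_res O (corrector s) x t h.
Proof.
pose r t := Num.sqrt t; pose z x t := s x / r t.
pose e x t := expR (- z x t).
pose g x t := be x * (z x t ^+ 1 * e x t) + ze x * (z x t ^+ 2 * e x t) * r t
  - (z x t ^+ 0 * e x t) * laplacian s x.
have [C CP] : bdd O g.
  apply: (bddD (bddD (bddM (bdd_Ck H (dd_Ckbe H 0)) (bdd_pow_expN 1))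
    (bddM (bddM (bdd_Ck H (dd_Ckze H 0)) (bdd_pow_expN 2)) (bdd_sqrt O)))
    (bddN (bddM (bdd_pow_expN 0) (bdd_laplacian H (dd_Cks H 2))))).
pose k := (4 * (`|C| + 1))^-1.
have k0 : 0 < k by rewrite invr_gt0 mulr_gt0// ltr_wpDl.
exists (Num.min 1 (k ^+ 2)).
  by rewrite lt_min ltr01 exprn_gt0//= ge_min lexx.
move=> x t Ox /andP[t0]; rewrite le_min => /andP[tle1 tk].
have D0 (y : R) : 0 < y -> is_derive y 1 corr_profile (expR (- y)).
  by move=> _; exact: corr_profile_derive.
have D1 (y : R) : 0 < y -> is_derive y 1 (fun y : R => expR (- y)) (- expR (- y)).
  by move=> _; exact: is_derive_expN.
have h1 := simterm_res OV 2 (Ck_cst oV 2 (1 : R)) (dd_Cks H 2) Ox t0 (dd_pos H) D0 D1.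
have g1 : grad (fun _ : E => 1) x = 0 by exact: grad_cst.
have l1 : laplacian (fun _ : E => 1) x = 0.
  by rewrite laplacian_hess hess_cst big1// => i _; rewrite mxE.
rewrite g1 l1 dot0l in h1.
have r0 : 0 < r t by rewrite sqrtr_gt0.
have tE : t = r t ^+ 2 by rewrite sqr_sqrtr// ltW.
have sE : s x = z x t * r t by rewrite /z divfK// gt_eqF.
exists (1 - (z x t * e x t) / 2 + r t * g x t).
  have z0 : 0 <= z x t by rewrite divr_ge0 ?(ltW r0)// ltW// (dd_pos H).
  have ze1 : z x t * e x t <= 1 by exact: mul_expRN_le1.
  have rk : r t <= k by rewrite -(ger0_norm (ltW k0)) -sqrtr_sqr ler_sqrt// sqr_ge0.
  have gC : `|g x t| <= C by apply: CP => //; rewrite t0 tle1.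
  have : `|r t * g x t| <= 1 / 4.
    rewrite normrM (ger0_norm (ltW r0)).
    have gC1 : `|g x t| <= `|C| + 1.
      by rewrite (le_trans gC)// (le_trans (ler_norm C))// lerDl.
    apply: le_trans (_ : k * (`|C| + 1) <= _).
      by apply: ler_pM => //; exact: ltW.
    by rewrite /k invfM -mulrA mulVf ?mulr1 ?div1r// gt_eqF// ltr_wpDl.
  rewrite ler_norml => /andP[g2 _].
  by move: ze1 g2; move: (z x t * e x t) (r t * g x t) => a b; lra.
move: h1; congr heat_res.
rewrite (dd_eik H Ox) /g -/(r t) -/(z x t) -/(e x t) sE /corr_profile -/(e x t).
move: (laplacian s x) (be x) (ze x) (z x t) (e x t) (r t) r0 tE => L b1 z1 z0 e0 r0 rp ->.
by field; rewrite gt_eqF.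
Qed.

End Comparison.

(** * The initial layer and a comparison principle *)

Section InitialLayer.
Context {R : realType} {N : nat}.
Local Notation E := 'rV[R]_N.
Variables (O V : set E) (s be ze : E -> R).
Hypothesis H : depth_data O V s be ze.
Implicit Types (x y : E) (t : R) (f : E -> R -> R).

Let oV := dd_openV H.
Let OV : O `<=` V.
Proof. by move=> x Ox; apply: dd_sub H _ _; exact: subset_closure. Qed.

Definition layer_amp (c d t : R) : R := expR (c * (ln d - ln (t + d))).
Definition layer_profile (c z : R) : R := expR (- c * z ^+ 2).
Definition shift_rsqrt (d t : R) : R := (Num.sqrt (t + d))^-1.
(* The value is (d/(t+d))^c exp(-c s^2/(t+d)): a shifted heat kernel with a
   small power, which for d -> 0 covers the initial boundary layer {s^2 <= d}
   and vanishes at positive times. *)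
Definition layer (s : E -> R) (c d : R) : E -> R -> R :=
  septerm (fun _ => 1) s (layer_amp c d) (shift_rsqrt d) (layer_profile c).

Lemma is_derive_shift (F : R -> R) (t d a : R) : is_derive (t + d) 1 F a ->
  is_derive t 1 (fun t => F (t + d)) a.
Proof.
move=> D; have D0 : is_derive t 1 (fun t : R => t + d) 1.
  by apply: is_derive_eq (is_deriveD (is_derive_id t 1) (is_derive_cst d t 1)) _; rewrite addr0.
by have := @is_derive1_comp R F (fun t : R => t + d) t _ _ D D0; rewrite mulr1.
Qed.

Lemma shift_rsqrt_derive (d t : R) : 0 < t + d ->
  is_derive t 1 (shift_rsqrt d) (- (shift_rsqrt d t / 2 / (t + d))).
Proof. by move=> td; exact: is_derive_shift (is_derive_rsqrt_time td). Qed.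

Lemma layer_amp_derive (c d t : R) : 0 < t + d ->
  is_derive t 1 (layer_amp c d) (- (c / (t + d) * layer_amp c d t)).
Proof.
move=> td; have D1 : is_derive t 1 (fun t => ln (t + d)) (t + d)^-1.
  exact: is_derive_shift (is_derive1_ln td).
have D2 : is_derive t 1 (fun t => c * (ln d - ln (t + d))) (c * - (t + d)^-1).
  have D3 := is_deriveB (is_derive_cst (ln d) t 1) D1.
  by apply: is_derive_eq (is_deriveZ c D3) _; rewrite sub0r.
have D4 := @is_derive1_comp R expR (fun t => c * (ln d - ln (t + d))) t _ _ (is_derive_expR _) D2.
by apply: is_derive_eq D4 _; rewrite /layer_amp; ring.
Qed.

Lemma layer_profile_derive (c z : R) :
  is_derive z 1 (layer_profile c) (- (2 * c * z) * layer_profile c z).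
Proof.
have D0 := is_deriveZ (- c) (is_derive_pow z 2).
have D4 := @is_derive1_comp R expR (fun z => - c * z ^+ 2) z _ _ (is_derive_expR _) D0.
by apply: is_derive_eq D4 _; rewrite /layer_profile /GRing.scale/=; ring.
Qed.

Lemma layer_profile_derive2 (c z : R) :
  is_derive z 1 (fun z => - (2 * c * z) * layer_profile c z)
    ((4 * c ^+ 2 * z ^+ 2 - 2 * c) * layer_profile c z).
Proof.
have D0 : is_derive z 1 (fun z : R => - (2 * c * z)) (- (2 * c)).
  apply: is_derive_eq (is_deriveN (is_deriveZ (2 * c) (is_derive_id z 1))) _.
  by rewrite /GRing.scale/= mulr1.
apply: is_derive_eq (is_deriveM D0 (layer_profile_derive c z)) _.
rewrite /GRing.scale/=; ring.
Qed.

Lemma depth_bounds : exists2 B, 1 <= B & forall x, O x ->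
  [/\ s x <= B, `|laplacian s x| <= B, `|be x| <= B, `|ze x| <= B &
      dot (grad s x) (grad s x) <= B].
Proof.
have [C1 H1] := Ck_bounded H (dd_Cks H 0).
have [C2 H2] := Ck_bounded H (Ck_laplacian oV (dd_Cks H 2)).
have [C3 H3] := Ck_bounded H (dd_Ckbe H 0).
have [C4 H4] := Ck_bounded H (dd_Ckze H 0).
have [C5 H5] := Ck_bounded H (Ck_dotgrad oV (dd_Cks H 1) (dd_Cks H 1)).
exists (1 + `|C1| + `|C2| + `|C3| + `|C4| + `|C5|).
  by rewrite -!addrA lerDl !addr_ge0.
move=> x Ox; have cx : closure O x by exact: subset_closure.
have := (H1 x cx, H2 x cx, H3 x cx, H4 x cx, H5 x cx).
have := (ler_norm C1, ler_norm C2, ler_norm C3, ler_norm C4, ler_norm C5).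
have := (normr_ge0 C1, normr_ge0 C2, normr_ge0 C3, normr_ge0 C4, normr_ge0 C5).
have := (ler_norm (s x), ler_norm (dot (grad s x) (grad s x))).
move: `|C1| `|C2| `|C3| `|C4| `|C5| `|s x| `|laplacian s x| `|be x| `|ze x| (s x).
move: (dot _ _) => G; move: `|G| => nG c1 c2 c3 c4 c5 q1 q2 q3 q4 q5.
move=> [e1 e2] [[[[f1 f2] f3] f4] f5] [[[[g1 g2] g3] g4] g5] [[[[h1 h2] h3] h4] h5].
by split; lra.
Qed.

(** The right side is the residual of [layer] divided by layer c / T, with [y] the depth and [e] =
    |grad s|^2. The exponent c = 1 / (8 B) gives 4 c (y^2 / T) e <= (y^2 / T) / 2. For y <= 1 / (8
    B), [e] is at least 3/4 and the term 2 e pays for the rest; for larger [y] the bound on [T]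
    makes y^2 / T >= 2 (1 + 2 B^2), which pays. *)
Lemma layer_ineq (B y L b1 z1 e T : R) : 1 <= B -> 0 < y -> 0 < T ->
  y <= B -> `|L| <= B -> `|b1| <= B -> `|z1| <= B -> e <= B -> 0 <= e ->
  e = 1 + b1 * y + z1 * y ^+ 2 -> T <= (1 / (8 * B)) ^+ 2 / (2 * (1 + 2 * B ^+ 2)) ->
  0 <= - 1 + (2 - 4 * (1 / (8 * B)) * (y ^+ 2 / T)) * e + y ^+ 2 / T + 2 * y * L.
Proof.
move=> B1 y0 T0 yB; rewrite !ler_norml => /andP[L1 L2] /andP[b2 b3] /andP[z2 z3] eB e0 eE Tle.
have B0 : 0 < B by exact: lt_le_trans B1.
have T1 : 0 < y ^+ 2 / T by rewrite divr_gt0// exprn_gt0.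
move: T1; move ZE : (y ^+ 2 / T) => Z T1.
have ez : 4 * (1 / (8 * B)) * Z * e <= Z / 2.
  have -> : 4 * (1 / (8 * B)) * Z * e = Z / 2 * (e / B) by field; rewrite gt_eqF.
  rewrite -[leRHS]mulr1 ler_pM2l ?divr_gt0//.
  by rewrite ler_pdivrMr// mul1r.
have -> : - 1 + (2 - 4 * (1 / (8 * B)) * Z) * e + Z + 2 * y * L =
  - 1 + 2 * e + Z + 2 * (y * L) - 4 * (1 / (8 * B)) * Z * e by ring.
have [ys|ys] := leP y (1 / (8 * B)).
  have yB8 : y * B <= 1 / 8.
    apply: le_trans (ler_wpM2r (ltW B0) ys) _.
    by have -> : 1 / (8 * B) * B = 1 / 8 by field; rewrite gt_eqF.
  have h1 : - (1 / 8) <= y * L by nra.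
  have h2 : - (1 / 8) <= b1 * y by nra.
  have h3 : - (1 / 8) <= z1 * y ^+ 2.
    have : y * (y * B) <= 1 / 8 by nra.
    have : 0 <= y ^+ 2 by exact: sqr_ge0.
    by nra.
  by move: ez T1 eE h1 h2 h3; move: (4 * _ * _ * _) => q; lra.
have ZB : 1 + 2 * B ^+ 2 <= Z / 2.
  have k0 : 0 < 2 * (1 + 2 * B ^+ 2) by have := sqr_ge0 B; lra.
  have : T * (2 * (1 + 2 * B ^+ 2)) <= y ^+ 2.
    rewrite -ler_pdivlMr// (le_trans Tle)// ler_pM2r ?invr_gt0//.
    by rewrite lerXn2r ?nnegrE ?(ltW ys) ?(ltW y0)// divr_ge0// mulr_ge0// ltW.
  rewrite mulrC -ler_pdivlMr// ZE; lra.
have yL : - B ^+ 2 <= y * L.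
  by have := sqr_ge0 B; nra.
by move: ez ZB yL e0; move: (4 * _ * _ * _) => q; lra.
Qed.

Lemma layer_super : exists c T0, [/\ 0 < c, 0 < T0 & forall d x t,
  0 < d -> O x -> 0 < t -> t + d <= T0 ->
  exists2 h, 0 <= h & heat_res O (layer s c d) x t h].
Proof.
have [B B1 HB] := depth_bounds; have B0 : 0 < B by exact: lt_le_trans B1.
pose c := 1 / (8 * B); have c0 : 0 < c by rewrite divr_gt0// mulr_gt0.
exists c, ((1 / (8 * B)) ^+ 2 / (2 * (1 + 2 * B ^+ 2))).
split=> //; first by rewrite divr_gt0 ?exprn_gt0// mulr_gt0// ltr_wpDr// mulr_ge0// sqr_ge0.
move=> d x t d0 Ox t0 td; have T0 : 0 < t + d by rewrite addr_gt0.
have D0 (y : R) : 0 < y -> is_derive y 1 (layer_profile c) (- (2 * c * y) * layer_profile c y).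
  by move=> _; exact: layer_profile_derive.
have D1 (y : R) : 0 < y -> is_derive y 1 (fun z => - (2 * c * z) * layer_profile c z)
    ((4 * c ^+ 2 * y ^+ 2 - 2 * c) * layer_profile c y).
  by move=> _; exact: layer_profile_derive2.
have q0 : 0 < shift_rsqrt d t by rewrite invr_gt0 sqrtr_gt0.
have h1 := septerm_res (P := layer_amp c d) (q := shift_rsqrt d) OV (Ck_cst oV 2 (1 : R))
  (dd_Cks H 2) Ox q0 (layer_amp_derive c T0) (shift_rsqrt_derive T0) (dd_pos H) D0 D1.
have g1 : grad (fun _ : E => 1) x = 0 by exact: grad_cst.
have l1 : laplacian (fun _ : E => 1) x = 0.
  by rewrite laplacian_hess hess_cst big1// => i _; rewrite mxE.
rewrite g1 l1 dot0l in h1.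
have [b1 b2 b3 b4 b5] := HB x Ox.
have := layer_ineq B1 (dd_pos H Ox) T0 b1 b2 b3 b4 b5 (dot_ge0 _) (dd_eik H Ox) td.
rewrite -/c; set k := (X in 0 <= X) => k0.
exists (layer_amp c d t * layer_profile c (s x * shift_rsqrt d t) * (c / (t + d)) * k).
  apply: mulr_ge0 => //; apply: mulr_ge0; last by rewrite divr_ge0// ltW.
  by apply: mulr_ge0; exact: expR_ge0.
move: h1; congr heat_res; rewrite /k.
have qE : (t + d)^-1 = shift_rsqrt d t ^+ 2 by rewrite exprVn sqr_sqrtr// ltW.
rewrite qE; move: (laplacian s x) (dot _ _) (s x) (shift_rsqrt d t) => L e y q.
by move: (layer_amp c d t) (layer_profile c (y * q)) (c) => P p c'; field.
Qed.

Lemma layer_gt0 c d x t : 0 < layer s c d x t.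
Proof. by rewrite /layer /septerm mul1r mulr_gt0 ?expR_gt0. Qed.

(** In this strip each of the two exponential factors is at least exp(-c). *)
Lemma layer_lower c d x t : 0 < c -> 0 < d -> 0 < t <= d -> s x ^+ 2 <= d ->
  expR (- (2 * c)) <= layer s c d x t.
Proof.
move=> c0 d0 /andP[t0 td] sd.
rewrite /layer /septerm mul1r /layer_amp /layer_profile -expRD ler_expR.
have T0 : 0 < t + d by rewrite addr_gt0.
have h1 : (s x * shift_rsqrt d t) ^+ 2 <= 1.
  rewrite exprMn exprVn sqr_sqrtr ?(ltW T0)// ler_pdivrMr// mul1r.
  by apply: le_trans sd _; rewrite lerDr ltW.
have h2 : ln (t + d) - ln d <= 1.
  rewrite -ln_div ?posrE// mulrDl divff ?gt_eqF//.
  have td1 : t / d <= 1 by rewrite ler_pdivrMr// mul1r.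
  rewrite addrC; apply: le_trans td1; apply: le_ln1Dx.
  by rewrite (lt_trans _ (divr_gt0 t0 d0))// oppr_lt0.
by move: h1 h2; move: (_ ^+ 2) (ln _) (ln _) => a b b'; nra.
Qed.

(** The bound is (d / t)^c, which tends to 0 with [d] at fixed [t]. *)
Lemma layer_upper c d x t : 0 < c -> 0 < d -> 0 < t ->
  layer s c d x t <= expR (c * (ln d - ln t)).
Proof.
move=> c0 d0 t0; rewrite /layer /septerm mul1r -[leRHS]mulr1; apply: ler_pM.
- exact: expR_ge0.
- exact: expR_ge0.
- rewrite ler_expR ler_pM2l// lerD2l lerN2 ler_ln ?posrE ?addr_gt0//.
  by rewrite lerDl ltW.
by rewrite -expR0 ler_expR mulNr oppr_le0 mulr_ge0 ?sqr_ge0// ltW.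
Qed.

Lemma layer_continuous c d : 0 < d -> {within closure O `*` `]0, +oo[,
  continuous (fun z : E * R => layer s c d z.1 z.2)}.
Proof.
move=> d0; apply: (septerm_continuous H); first exact: Ck_cst.
- by move=> t t0; apply: is_derive_continuous (layer_amp_derive c _); rewrite addr_gt0.
- by move=> t t0; apply: is_derive_continuous (shift_rsqrt_derive _); rewrite addr_gt0.
- by move=> t t0; rewrite invr_ge0 sqrtr_ge0.
by move=> z _; exact: is_derive_continuous (layer_profile_derive c z).
Qed.

(** Near the boundary at t = 0 only the bound [A] is available. Subtracting eta / 2 + K layer
    repairs this: at a small time [ts] the layer dominates [A] in the strip s < sqrt d, and the
    initial condition covers the rest. The maximum principle carries the sign on to time [t], where
    [d] is so small that K layer is at most eta / 2. *)
Lemma comparison : exists2 T0, 0 < T0 & forall f A t1, 0 < t1 < T0 ->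
  {within closure O `*` `]0, +oo[, continuous (fun z : E * R => f z.1 z.2)} ->
  (forall x t, O x -> 0 < t <= t1 -> exists2 h, h < 0 & heat_res O f x t h) ->
  (forall x t, bdry O x -> 0 < t <= t1 -> f x t <= 0) ->
  (forall x t, O x -> 0 < t <= t1 -> f x t <= A) ->
  (forall d e, 0 < d -> 0 < e -> exists2 t0, 0 < t0 &
    forall x t, O x -> d <= s x -> 0 < t < t0 -> f x t <= e) ->
  forall x t, O x -> 0 < t <= t1 -> f x t <= 0.
Proof.
have [c [T0 [c0 T00 super]]] := layer_super; exists T0 => //.
move=> f A t1 /andP[t10 t1T] cf fres fb fA f0 x t Ox /andP[t0 tt1].
apply/ler_addgt0Pr => eta eta0; rewrite add0r.
have e20 : 0 < eta / 2 by rewrite divr_gt0.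
(* By [layer_lower] this makes K layer at least |A| + 1 in the strip. *)
pose K := (`|A| + 1) * expR (2 * c).
have K0 : 0 < K by rewrite mulr_gt0 ?expR_gt0// ltr_wpDl.
(* The first bound keeps r + d <= T0 for r <= t1; the second gives K (d / t)^c <= eta / 2 through
   exp(-y) <= 1 / y with y = 2 K / eta. *)
pose d := Num.min (T0 - t1) (expR (ln t - (2 * K / eta) / c)).
have d0 : 0 < d by rewrite lt_min subr_gt0 t1T expR_gt0.
have upper : K * layer s c d x t <= eta / 2.
  apply: le_trans (ler_wpM2l (ltW K0) (layer_upper x c0 d0 t0)) _.
  have ld : c * (ln d - ln t) <= - (2 * K / eta).
    rewrite mulrC -ler_pdivlMr// lerBlDr mulNr addrC -[leRHS]expRK.
    by rewrite ler_ln ?posrE ?expR_gt0// ge_min lexx orbT.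
  have y0 : 0 < 2 * K / eta by rewrite divr_gt0// mulr_gt0.
  have e1 : expR (c * (ln d - ln t)) <= (2 * K / eta)^-1.
    apply: le_trans (_ : expR (- (2 * K / eta)) <= _); first by rewrite ler_expR.
    rewrite expRN lef_pV2 ?posrE ?expR_gt0//.
    by apply: le_trans (expR_ge1Dx _); rewrite lerDr.
  apply: le_trans (ler_wpM2l (ltW K0) e1) _.
  by have -> : K * (2 * K / eta)^-1 = eta / 2 by field; rewrite !gt_eqF.
have dT : d <= T0 - t1 by rewrite ge_min lexx.
clearbody d; have sd0 : 0 < Num.sqrt d by rewrite sqrtr_gt0.
have [tau tau0 tauP] := f0 (Num.sqrt d) (eta / 2) sd0 e20.
have [ta ta2] := half_gt0_lt tau0.
pose ts := Num.min t (Num.min d (tau / 2)).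
have ts0 : 0 < ts by rewrite !lt_min t0 d0 ta.
have tst : ts <= t by rewrite ge_min lexx.
have tsd : ts <= d by rewrite !ge_min lexx orbT.
have tstau : ts < tau by apply: le_lt_trans ta2; rewrite !ge_min lexx !orbT.
pose F y r := f y r + ((- (eta / 2)) + (- K) * layer s c d y r).
have tsP r : ts <= r -> 0 < r by exact: lt_le_trans.
suff : F x t <= 0 by rewrite /F mulNr; move: upper; lra.
apply: (@max_principle R N O (dd_open H) F ts t1 (dd_compact H) ts0) => //.
- have c1 := withinZ (c := - K) (layer_continuous (c := c) d0).
  have c2 : {within closure O `*` `]0, +oo[, continuous (fun _ : E * R => - (eta / 2))}.
    by apply: continuous_subspaceT => z; exact: cvg_cst.
  exact: (withinD cf (withinD c2 c1)).
- move=> y r Oy /andP[rs rt].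
  have r0 : 0 < r by exact: lt_trans rs.
  have [|h hn Hh] := fres y r Oy; first by rewrite r0.
  have [|h' hp Hh'] := super d y r d0 Oy r0.
    by move: dT rt; lra.
  exists (h + (0 + (- K) * h')).
    by rewrite add0r mulNr; have := mulr_ge0 (ltW K0) hp; move: hn; lra.
  exact: heat_resD Hh (heat_resD (heat_res_cst _ _ _ _) (heat_resZ _ Hh')).
- move=> y r by_ /andP[rs rt]; have r0 := tsP r rs.
  have := fb y r by_; rewrite r0 rt => /(_ isT) f1.
  have := mulr_ge0 (ltW K0) (ltW (layer_gt0 c d y r)).
  by rewrite /F mulNr; move: f1 e20; lra.
- move=> y Oy; have tt : 0 < ts <= t1 by rewrite ts0 (le_trans tst).
  have w0 := mulr_ge0 (ltW K0) (ltW (layer_gt0 c d y ts)).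
  rewrite /F mulNr; have [sy|sy] := leP (Num.sqrt d) (s y).
    have := tauP y ts Oy sy; rewrite ts0 tstau => /(_ isT).
    by move: w0; lra.
  have sy2 : s y ^+ 2 <= d.
    rewrite -(sqr_sqrtr (ltW d0)) lerXn2r ?nnegrE ?(ltW sy) ?sqrtr_ge0//.
    by rewrite ltW// (dd_pos H).
  have lo : `|A| + 1 <= K * layer s c d y ts.
    have := layer_lower c0 d0 _ sy2; move=> /(_ ts); rewrite ts0 tsd => /(_ isT) l1.
    apply: le_trans (ler_wpM2l (ltW K0) l1).
    by rewrite /K -mulrA -expRD subrr expR0 mulr1.
  by have := fA y ts Oy tt; have := ler_norm A; move: lo e20; lra.
by rewrite tst.
Qed.

End InitialLayer.

(** * Short-time expansion of the solution and of its flux *)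

Section HeatAsymptotics.
Context {R : realType} {N : nat}.
Local Notation E := 'rV[R]_N.
Variables (O V : set E) (s be ze : E -> R).
Hypothesis H : depth_data O V s be ze.
Variables (Phi : R -> R) (c0 C1 : R).
Hypothesis HPhi : is_profile Phi c0 C1.
Variable u : E -> R -> R.
Hypothesis Hu : heat_solution_one O u.
Implicit Types (x y p : E) (t : R).

Local Notation W := (ansatz s be Phi c0).
Local Notation psi := (corrector s).
Local Notation a := (layer_a s be).
Local Notation b := (layer_b be).

Let oV := dd_openV H.
Let OV : O `<=` V.
Proof. by move=> x Ox; apply: dd_sub H _ _; exact: subset_closure. Qed.

Lemma heat_solution_res x t : O x -> 0 < t -> heat_res O u x t 0.
Proof.
have [_ [hu _]] := Hu => Ox t0; have [d1 [d2 d3]] := hu x t Ox t0.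
exists (derive1 (u x) t), (fun i => 'D_(evec R i) (u^~ t)),
  (fun i => 'D_(evec R i) ('D_(evec R i) (u^~ t)) x); split.
- by rewrite derive1E; exact: derivableP d1.
- by move=> i y Oy; have [d4 _] := d2 i; exact: derivableP (d4 y Oy).
- by move=> i; have [_ d4] := d2 i; exact: derivableP d4.
by rewrite d3 subrr.
Qed.

Lemma ansatz_continuous : {within closure O `*` `]0, +oo[,
  continuous (fun z : E * R => W z.1 z.2)}.
Proof.
have c1 := simterm_continuous H (j := 0%N) (Ck_cst oV 0 (1 : R))
  (fun z z0 => is_derive_continuous (profile_derive HPhi z0)).
have c2 := simterm_continuous H (j := 1%N) (Ck_a H 0)
  (fun z z0 => is_derive_continuous (prof1_derive HPhi z0)).
have c3 := simterm_continuous H (j := 1%N) (Ck_b H 0)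
  (fun z _ => is_derive_continuous (prof2_derive c0 z)).
exact: (withinD c1 (withinD c2 c3)).
Qed.

Lemma corrector_continuous : {within closure O `*` `]0, +oo[,
  continuous (fun z : E * R => psi z.1 z.2)}.
Proof.
exact: (simterm_continuous H (j := 2%N) (Ck_cst oV 0 (1 : R))
  (fun z _ => is_derive_continuous (corr_profile_derive z))).
Qed.

Lemma simterm_bdry (A : E -> R) j (f : R -> R) p t : f 0 = 0 -> bdry O p ->
  simterm A s j f p t = 0.
Proof.
by move=> f0 bp; rewrite /simterm /septerm (dd_bdry H bp) mul0r f0 !mulr0.
Qed.

Let Phi0 : Phi 0 = 0. Proof. by case: HPhi. Qed.
Let prof10 : prof1 Phi 0 = 0. Proof. by rewrite /prof1 mul0r. Qed.
Let prof20 : prof2 c0 0 = 0. Proof. by rewrite /prof2 expr0n/= mul0r. Qed.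
Let corr0 : corr_profile 0 = 0 :> R.
Proof. by rewrite /corr_profile oppr0 expR0 subrr. Qed.

Lemma ansatz_bdry p t : bdry O p -> W p t = 0.
Proof. by move=> bp; rewrite /ansatz !simterm_bdry// !addr0. Qed.

Lemma corrector_bdry p t : bdry O p -> psi p t = 0.
Proof. by move=> bp; rewrite /corrector simterm_bdry. Qed.

Lemma corrector_ge0 x t : O x -> 0 <= psi x t.
Proof.
move=> Ox; rewrite /corrector /simterm /septerm mul1r mulr_ge0 ?exprn_ge0 ?sqrtr_ge0//.
by rewrite subr_ge0 -expR0 ler_expR oppr_le0 mulr_ge0 ?invr_ge0 ?sqrtr_ge0// ltW// (dd_pos H).
Qed.

Lemma ansatz_near1 : exists C, forall x t, O x -> 0 < t <= 1 ->
  `|W x t - 1| <= C1 * expR (- (s x / Num.sqrt t)) + Num.sqrt t * C.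
Proof.
pose g x t := a x * prof1 Phi (s x / Num.sqrt t) +
  b x * ((s x / Num.sqrt t) ^+ 2 * gphi c0 (s x / Num.sqrt t)).
have [C CP] : bdd O g.
  have B1 : bdd O (fun x t => prof1 Phi (s x / Num.sqrt t)).
    apply: (@bdd_profile _ _ _ _ _ _ _ H (prof1 Phi) C1) => y y0.
    exact: proj2 (profile_tail HPhi y0).
  exact: (bddD (bddM (bdd_Ck H (Ck_a H 0)) B1) (bddM (bdd_Ck H (Ck_b H 0)) (bdd_gphi H HPhi 2))).
exists C => x t Ox tt; have /andP[t0 _] := tt.
have z0 : 0 <= s x / Num.sqrt t by rewrite divr_ge0 ?sqrtr_ge0// ltW// (dd_pos H).
have [_ _ _ _ tail] := HPhi; have /andP[p1 p2] := tail _ z0.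
have -> : W x t - 1 = - (1 - Phi (s x / Num.sqrt t)) + Num.sqrt t * g x t.
  rewrite /ansatz /simterm /septerm /g /prof2 expr0 expr1; ring.
apply: le_trans (ler_normD _ _) _; rewrite normrN (ger0_norm p1).
apply: lerD => //; rewrite normrM (ger0_norm (sqrtr_ge0 _)).
by rewrite ler_wpM2l ?sqrtr_ge0//; exact: CP.
Qed.

(** [s] vanishes on the boundary, so the part of the closure with s >= d lies in [O]; on it the
    solution attains its initial value uniformly. *)
Lemma depth_superlevel_compact d : 0 < d -> exists K : set E,
  [/\ compact K, K `<=` O & forall x, O x -> d <= s x -> K x].
Proof.
move=> d0; have cs : {within closure O, continuous s}.
  apply: continuous_in_subspaceT => x; rewrite inE => cx.
  exact: Ck_continuous (dd_Cks H 0) (dd_sub H cx).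
have /closed_subspaceP[F cF FE] := iffLR (continuous_closedP _) cs _ (@closed_ge R d).
exists (closure O `&` F); split.
- exact: compact_closedI (dd_compact H) cF.
- move=> x [cx Fx]; have [//|nO] := pselect (O x); exfalso.
  have : (F `&` closure O) x by [].
  rewrite FE => -[sx _]; have : d <= s x := sx.
  by rewrite (dd_bdry H (conj cx nO)) leNgt d0.
move=> x Ox sx; have cx : closure O x by exact: subset_closure.
split=> //; have : (s @^-1` [set y | d <= y] `&` closure O) x by [].
by rewrite -FE => -[].
Qed.

(** [comparison] is applied to e (u - W) - K psi for both signs e; [u] and the ansatz have the same
    boundary value 0 and the same initial value 1. With K = 4 (|C2| + 1), a quarter of K exceeds the
    residual bound of the ansatz, so the total residual is negative. *)
Lemma ansatz_error_bound : exists K t1, [/\ 0 <= K, 0 < t1 & forall x t, O x -> 0 < t <= t1 ->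
  `|u x t - W x t| <= K * psi x t].
Proof.
have [C2 HC2] := ansatz_res_bounded H HPhi.
have [t1 /andP[t10 t11] corr] := corrector_res H.
have [T0 T00 comp] := comparison H.
have [C HC] := ansatz_near1.
have [cu [_ [ub [[M uM] u1]]]] := Hu.
have [T2 T21] := half_gt0_lt T00.
pose K := 4 * (`|C2| + 1).
have K0 : 0 <= K by rewrite mulr_ge0// addr_ge0.
pose t2 := Num.min t1 (T0 / 2).
have t20 : 0 < t2 by rewrite lt_min t10.
have t2t1 : t2 <= t1 by rewrite ge_min lexx.
have t2T : t2 < T0 by apply: le_lt_trans T21; rewrite ge_min lexx orbT.
clearbody t2; exists K, t2; split=> // x t Ox tt.
suff sgn (e : R) : `|e| = 1 -> e * u x t + ((- e) * W x t + (- K) * psi x t) <= 0.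
  rewrite ler_norml; have := sgn 1 (normr1 _); have := sgn (- 1) (normrN1 _).
  by move=> h1 h2; apply/andP; split; move: h1 h2; lra.
move=> e1; pose f y r := e * u y r + ((- e) * W y r + (- K) * psi y r).
have tle r : 0 < r <= t2 -> 0 < r <= 1.
  by move=> /andP[-> rt]; rewrite (le_trans rt)// (le_trans t2t1).
have W1 y r : O y -> 0 < r <= 1 -> `|W y r - 1| <= C1 + `|C|.
  move=> Oy rr; have /andP[r0 r1] := rr; apply: le_trans (HC y r Oy rr) _; apply: lerD.
    rewrite -[leRHS]mulr1 ler_wpM2l//; first by case: HPhi.
    rewrite -expR0 ler_expR oppr_le0 divr_ge0 ?sqrtr_ge0// ltW// (dd_pos H)//.
  apply: le_trans (ler_wpM2l (sqrtr_ge0 r) (ler_norm C)) _.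
  by rewrite -[leRHS]mul1r ler_wpM2r// -[leRHS]sqrtr1 ler_sqrt.
apply: (comp f (M + 1 + (C1 + `|C|)) t2 _ _ _ _ _ _ x t Ox tt).
- by rewrite t20.
- exact: (withinD (withinZ (c := e) cu) (withinD (withinZ (c := - e) ansatz_continuous)
    (withinZ (c := - K) corrector_continuous))).
- move=> y r Oy rr; have /andP[r0 r2] := rr.
  have [h hC Hh] := HC2 y r Oy (tle r rr).
  have [|h' h4 Hh'] := corr y r Oy; first by rewrite r0 (le_trans r2).
  exists (e * 0 + ((- e) * h + (- K) * h')).
    have : `|e * h| <= `|C2| by rewrite normrM e1 mul1r (le_trans hC)// ler_norm.
    rewrite ler_norml => /andP[q1 q2].
    have : `|C2| + 1 <= K * h'.
      apply: le_trans (ler_wpM2l K0 h4); rewrite /K.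
      by have -> : 4 * (`|C2| + 1) * (1 / 4) = `|C2| + 1 by field.
    by rewrite mulr0 add0r !mulNr; move: q1 q2; lra.
  exact: heat_resD (heat_resZ e (heat_solution_res Oy r0))
    (heat_resD (heat_resZ (- e) Hh) (heat_resZ (- K) Hh')).
- move=> y r by_ /andP[r0 _].
  by rewrite /f ub// ansatz_bdry// corrector_bdry// !mulr0 !addr0.
- move=> y r Oy rr; have /andP[r0 _] := rr.
  have h1 := uM y r Oy r0; have h2 := W1 y r Oy (tle r rr).
  have h3 := mulr_ge0 K0 (corrector_ge0 r Oy).
  have -> : f y r = e * (u y r - 1) - e * (W y r - 1) - K * psi y r by rewrite /f; ring.
  have h4 : e * (u y r - 1) <= M + 1.
    apply: le_trans (ler_norm _) _; rewrite normrM e1 mul1r.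
    by apply: le_trans (ler_normB _ _) _; rewrite normr1 lerD2r.
  have h5 : - (e * (W y r - 1)) <= C1 + `|C|.
    by apply: le_trans (ler_norm _) _; rewrite normrN normrM e1 mul1r.
  by move: h3 h4 h5; lra.
move=> d eta d0 eta0; have e20 : 0 < eta / 2 by rewrite divr_gt0.
have [L [cL LO Ls]] := depth_superlevel_compact d0.
have [del [del0 delP]] := u1 L cL LO (eta / 2) e20.
have C10 : 0 <= C1 by case: HPhi.
(* With this constant |W - 1| <= sqrt r D where s >= d, using exp(-z) <= 1 / z. *)
pose D := C1 / d + `|C| + 1; have D0 : 0 < D by rewrite ltr_wpDl// addr_ge0// divr_ge0// ltW.
pose k := eta / 2 / D; have k0 : 0 < k by rewrite divr_gt0.
exists (Num.min del (Num.min 1 (k ^+ 2))).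
  by rewrite !lt_min del0 ltr01 exprn_gt0.
move=> y r Oy sy /andP[r0]; rewrite !lt_min => /andP[rdel /andP[r1 rk]].
have q0 : 0 < Num.sqrt r by rewrite sqrtr_gt0.
have h1 : `|u y r - 1| < eta / 2 by apply: delP; [exact: Ls|rewrite r0].
have h2 : `|W y r - 1| <= eta / 2.
  have r1' : 0 < r <= 1 by rewrite r0 ltW.
  apply: le_trans (HC y r Oy r1') _.
  have sp : 0 < s y by exact: (dd_pos H Oy).
  have h3 : expR (- (s y / Num.sqrt r)) <= Num.sqrt r / d.
    have := mul_expRN_le1 (ltW (divr_gt0 sp q0)).
    rewrite mulrC -ler_pdivlMr ?divr_gt0// invf_div mul1r => /le_trans; apply.
    by rewrite ler_pM2l// lef_pV2.
  have h4 : Num.sqrt r <= k by rewrite -(ger0_norm (ltW k0)) -sqrtr_sqr ler_sqrt ?sqr_ge0// ltW.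
  apply: le_trans (_ : Num.sqrt r * D <= _); last by rewrite -ler_pdivlMr.
  have h5 := ler_wpM2l C10 h3; have h6 := ler_wpM2l (ltW q0) (ler_norm C).
  have -> : Num.sqrt r * D = C1 * (Num.sqrt r / d) + Num.sqrt r * `|C| + Num.sqrt r.
    by rewrite /D; ring.
  by move: h5 h6 q0; lra.
have h3 := mulr_ge0 K0 (corrector_ge0 r Oy).
have -> : f y r = e * (u y r - 1) - e * (W y r - 1) - K * psi y r by rewrite /f; ring.
have h4 : e * (u y r - 1) <= eta / 2.
  by apply: le_trans (ler_norm _) _; rewrite normrM e1 mul1r ltW.
have h5 : - (e * (W y r - 1)) <= eta / 2.
  by apply: le_trans (ler_norm _) _; rewrite normrN normrM e1 mul1r.
by move: h3 h4 h5; lra.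
Qed.

(** On the boundary z = 0 and [f 0 = 0], so the product rule keeps only the term with the derivative
    of [f]. *)
Lemma simterm_slope (A : E -> R) j (f : R -> R) (f' : R) p v t : Ck V 1 A ->
  f 0 = 0 -> is_derive (0 : R) 1 f f' -> bdry O p -> 0 < t ->
  is_derive p v (simterm A s j f ^~ t)
    (A p * (Num.sqrt t ^+ j * (f' * ('D_v s p / Num.sqrt t)))).
Proof.
move=> CA f0 fD bp t0; have Vp : V p by apply: (dd_sub H); case: bp.
have DA := derivableP (Ck_derivable (v := v) CA Vp).
have Ds := derivableP (Ck_derivable (v := v) (dd_Cks H 1) Vp).
have sp : s p / Num.sqrt t = 0 by rewrite (dd_bdry H bp) mul0r.
have Dz : is_derive p v (fun y => s y / Num.sqrt t) ('D_v s p / Num.sqrt t).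
  have -> : (fun y => s y / Num.sqrt t) = (fun y => (Num.sqrt t)^-1 * s y).
    by apply/funext => y; rewrite mulrC.
  by rewrite mulrC; exact: is_deriveZ _ Ds.
have Df := is_derive_comp1 (F := f) (s := fun y => s y / Num.sqrt t).
have {}Df : is_derive p v (fun y => f (s y / Num.sqrt t)) (f' * ('D_v s p / Num.sqrt t)).
  by apply: Df Dz; rewrite sp.
apply: is_derive_eq (is_deriveM DA (is_deriveZ (Num.sqrt t ^+ j) Df)) _.
by rewrite /GRing.scale/= /GRing.scale/= sp f0 mulr0 mul0r addr0.
Qed.

Lemma ansatz_slope p v t : bdry O p -> 0 < t -> 'D_v s p = 1 ->
  is_derive p v (W ^~ t) (c0 / Num.sqrt t + a p).
Proof.
move=> bp t0 sp; have r0 : 0 < Num.sqrt t by rewrite sqrtr_gt0.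
have D1 := simterm_slope 0 v (Ck_cst oV 1 (1 : R)) Phi0 (profile_derive HPhi (lexx 0)) bp t0.
have D2 := simterm_slope 1 v (Ck_a H 1) prof10 (prof1_derive HPhi (lexx 0)) bp t0.
have D3 := simterm_slope 1 v (Ck_b H 1) prof20 (prof2_derive c0 0) bp t0.
apply: is_derive_eq (is_deriveD D1 (is_deriveD D2 D3)) _.
rewrite sp Phi0 /gphi expr0n/= oppr0 mul0r expR0.
by field; rewrite gt_eqF.
Qed.

Lemma corrector_slope p v t : bdry O p -> 0 < t -> 'D_v s p = 1 ->
  is_derive p v (psi ^~ t) (Num.sqrt t).
Proof.
move=> bp t0 sp; have r0 : 0 < Num.sqrt t by rewrite sqrtr_gt0.
have D1 := simterm_slope 2 v (Ck_cst oV 1 (1 : R)) corr0 (corr_profile_derive 0) bp t0.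
apply: is_derive_eq D1 _; rewrite sp oppr0 expR0.
by field; rewrite gt_eqF.
Qed.

(** Solution, ansatz and corrector all vanish at [p], so |u - W| <= K psi passes to difference
    quotients along [v], where the slopes are c0 / sqrt t + a and sqrt t. The quotient for [bn] has
    the opposite sign to the slope along [v], whence the plus sign. *)
Lemma flux_expansion : exists K t1, 0 < t1 /\ forall p v t bn,
  bdry O p -> 0 < t <= t1 -> 'D_v s p = 1 ->
  (exists2 d, 0 < d & forall h, 0 < h < d -> O (p + h *: v)) ->
  (fun h => (u p t - u (p + h *: v) t) / h) @ (0 : R)^'+ --> bn ->
  `|bn + (c0 / Num.sqrt t + a p)| <= K * Num.sqrt t.
Proof.
have [K [t1 [K0 t10 est]]] := ansatz_error_bound; exists K, t1; split=> //.
move=> p v t bn bp tt sp [d d0 inO] lim; have /andP[t0 _] := tt.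
have [_ [_ [ub _]]] := Hu.
have DW := ansatz_slope bp t0 sp; have Dp := corrector_slope bp t0 sp.
suff sgn (e : R) : `|e| = 1 -> e * (bn + (c0 / Num.sqrt t + a p)) <= K * Num.sqrt t.
  rewrite ler_norml; have := sgn 1 (normr1 _); have := sgn (- 1) (normrN1 _).
  by move=> h1 h2; apply/andP; split; move: h1 h2; lra.
move=> e1; apply/ler_addgt0Pr => eta eta0.
have e20 : 0 < eta / 2 by rewrite divr_gt0.
have [d1 d10 lim1] := cvg_right lim e20.
pose l := c0 / Num.sqrt t + a p.
pose g (h : R) := (- e) * W (p + h *: v) t + K * psi (p + h *: v) t.
have Dg : is_derive (0 : R) 1 g ((- e) * l + K * Num.sqrt t).
  have D1 := iffLR (line_is_derive0 _ _ _ _) DW.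
  have D2 := iffLR (line_is_derive0 _ _ _ _) Dp.
  exact: (is_deriveD (is_deriveZ (- e) D1) (is_deriveZ K D2)).
have [|d2 d20 gP] := right_growth_lt Dg (c := (- e) * l + K * Num.sqrt t + eta / 2).
  by rewrite ltrDl.
have m0 : 0 < Num.min d (Num.min d1 d2) by rewrite !lt_min d0 d10.
have [h0] := half_gt0_lt m0; rewrite !lt_min; set h := _ / 2 in h0 *.
move=> /andP[hd /andP[hd1 hd2]].
have Oh : O (p + h *: v) by apply: inO; rewrite h0.
have := est _ _ Oh tt; have := lim1 h; rewrite h0 hd1 => /(_ isT).
have := gP h; rewrite h0 hd2 => /(_ isT).
rewrite /g scale0r addr0 (ansatz_bdry _ bp) (corrector_bdry _ bp) !mulr0 !add0r ub//.
rewrite sub0r; set w := W _ _; set q := psi _ _; set y := u _ _ => g1 g2 g3.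
have g4 : - (e * (y - w)) <= K * q.
  by apply: le_trans (ler_norm _) _; rewrite normrN normrM e1 mul1r.
have g5 : e * (bn * h + y) < eta / 2 * h.
  apply: le_lt_trans (ler_norm _) _; rewrite normrM e1 mul1r.
  have -> : bn * h + y = (bn - - y / h) * h by field; rewrite gt_eqF.
  by rewrite normrM (gtr0_norm h0) ltr_pM2r.
rewrite -/l -(ler_pM2r h0).
have -> : e * (bn + l) * h = e * (bn * h + y) - e * (y - w) - e * w + e * l * h by ring.
move: g1 g4 g5; move: (Num.sqrt t) (h) => r h'.
by move: (e * (bn * h' + y)) (e * (y - w)) => A B; lra.
Qed.

End HeatAsymptotics.

(** * Constant mean curvature from the overdetermined condition *)

Section ConstantCurvature.
Context {R : realType} {N : nat}.
Local Notation E := 'rV[R]_N.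
Variables (O : set E) (rho : E -> R) (M : R).
Hypothesis H : regular_domain O rho M.
Implicit Types (x p : E).

Let m x := - rho x.

Let Cm n : Ck setT n m.
Proof. by apply: (CkN openT); exact: rd_Ck H n. Qed.

Lemma grad_opp x : grad m x = - grad rho x.
Proof.
apply/rowP => i; rewrite !mxE.
have D := derivableP (Ck_derivable (v := evec R i) (rd_Ck H 1) (I : setT x)).
by have [_ ->] := is_deriveN D.
Qed.

Lemma hess_opp x : hess m x = - hess rho x.
Proof.
have mE : m = (fun y => (fun _ : E => 0) y + (- 1) * rho y).
  by apply/funext => y; rewrite add0r mulN1r.
rewrite mE (hess_lin openT (- 1) (Ck_cst openT 2 0) (rd_Ck H 2) (I : setT x)).
by rewrite hess_cst add0r scaleN1r.
Qed.

Lemma curv_opp x : curv m x = - curv rho x.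
Proof.
rewrite /curv /tanlap !laplacian_hess grad_opp hess_opp.
have -> : eucl (- grad rho x) = eucl (grad rho x) by rewrite !euclE dotNl dotNr opprK.
have -> : \sum_i (- hess rho x) i i = - \sum_i hess rho x i i.
  by rewrite -sumrN; apply: eq_bigr => i _; rewrite mxE.
by rewrite mulNmx mulmxN opprK !dotNr !dotNl opprK; ring.
Qed.

Lemma closure_depthV : closure O `<=` depthV m.
Proof.
move=> x /closure_cases[Ox|bx]; rewrite /depthV /= /gramQ.
  rewrite ltr_wpDl ?dot_ge0// /m mulrNN.
  by rewrite -expr2 exprn_even_gt0//= lt_eqF//; apply/(rd_def H).
rewrite ltr_wpDr ?sqr_ge0 -?expr2 ?sqr_ge0//.
by apply: dot_gt0; rewrite grad_opp oppr_eq0; exact: (rd_grad H bx).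
Qed.

Lemma domain_depth_data : depth_data O (depthV m) (depth m) (dbeta m) (dzeta m).
Proof.
have cV := closure_depthV; have OV x : O x -> depthV m x by move=> /subset_closure /cV.
split.
- exact: rd_open H.
- exact: compact_closure H.
- exact: open_depthV Cm.
- exact: cV.
- by move=> n; exact: Ck_depth.
- by move=> n; exact: Ck_dbeta.
- by move=> n; exact: Ck_dzeta.
- move=> x Ox; rewrite mulr_gt0//; last exact: gam_gt0 (OV x Ox).
  by rewrite oppr_gt0; apply/(rd_def H).
- by move=> x bx; rewrite /depth /m (bdry_rho H bx) oppr0 mul0r.
by move=> x Ox; exact: (grad_depth_sqr Cm (OV x Ox)).
Qed.

Lemma depth_slope p : bdry O p -> 'D_(- ext_normal rho p) (depth m) p = 1.
Proof.
move=> bp; have Vp : depthV m p by apply: closure_depthV; case: bp.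
have m0 : m p = 0 by rewrite /m (bdry_rho H bp) oppr0.
rewrite (derive_dot (open_depthV Cm) _ (Ck_depth Cm 1) Vp) (grad_depth0 Cm Vp m0).
have gE : gam m p = (eucl (grad rho p))^-1.
  rewrite /gam /gramQ m0 mul0r addr0 grad_opp dotNl dotNr opprK.
  exact: normcoefE.
rewrite grad_opp gE /ext_normal dotZl dotNl dotNr opprK dotZr.
have e0 : 0 < eucl (grad rho p) by apply: eucl_gt0; exact: (rd_grad H bp).
by rewrite -eucl_sqr; field; rewrite gt_eqF.
Qed.

Lemma inward_normal p : bdry O p ->
  exists2 d, 0 < d & forall h : R, 0 < h < d -> O (p + h *: - ext_normal rho p).
Proof.
move=> bp; have G0 : grad rho p != 0 := rd_grad H bp.
apply: (ray_in H); first by rewrite (bdry_rho H bp).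
rewrite dotNr dotZr oppr_lt0 mulr_gt0 ?invr_gt0 ?eucl_gt0//.
exact: dot_gt0.
Qed.

(** At a common time t_n the terms [b n] and c0 / sqrt t_n do not depend on the boundary point.
    Subtracting the two expansions bounds half the difference of the curvatures by 2 K sqrt t_n,
    which is arbitrarily small. *)
Lemma overdetermined_curv_const (u : E -> R -> R) (t b : nat -> R) :
  heat_solution_one O u -> (forall n, 0 < t n) ->
  (forall n, normal_deriv_const O rho u (t n) (b n)) ->
  (forall eps : R, 0 < eps -> exists n, t n < eps) ->
  forall p p', bdry O p -> bdry O p' -> curv rho p = curv rho p'.
Proof.
move=> Hu t0 Hb Ht p p' bp bp'.
have [Phi [c0 [C1 HPhi]]] := @profile_exists R.
have [K [t1 [t10 est]]] := flux_expansion domain_depth_data HPhi Hu.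
have curvE q : bdry O q -> layer_a (depth m) (dbeta m) q = - (1 / 2 * curv rho q).
  move=> bq; rewrite -mulrN -curv_opp; apply: (acoef_curv Cm).
    by apply: closure_depthV; case: bq.
  by rewrite /m (bdry_rho H bq) oppr0.
have bound q n : bdry O q -> t n <= t1 ->
    `|b n + (c0 / Num.sqrt (t n) - 1 / 2 * curv rho q)| <= K * Num.sqrt (t n).
  move=> bq tn; rewrite -curvE//.
  apply: (est q (- ext_normal rho q) (t n) (b n) bq) => //.
  - by rewrite t0.
  - exact: depth_slope.
  - exact: inward_normal.
  have <- : (fun h : R => (u q (t n) - u (q - h *: ext_normal rho q) (t n)) / h) =
      (fun h => (u q (t n) - u (q + h *: - ext_normal rho q) (t n)) / h).
    by apply/funext => h; rewrite scalerN.
  exact: Hb.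
apply/eqP; rewrite -subr_eq0 -normr_le0; apply/ler_addgt0Pr => e e0; rewrite add0r.
have k0 : 0 < e / (4 * (`|K| + 1)) by rewrite divr_gt0// mulr_gt0// ltr_wpDl.
have [|n] := Ht (Num.min t1 ((e / (4 * (`|K| + 1))) ^+ 2)).
  by rewrite lt_min t10 exprn_gt0.
rewrite lt_min => /andP[n1 n2].
have r0 : 0 <= Num.sqrt (t n) := sqrtr_ge0 _.
have rk : Num.sqrt (t n) <= e / (4 * (`|K| + 1)).
  by rewrite -[leRHS](ger0_norm (ltW k0)) -sqrtr_sqr ler_sqrt ?sqr_ge0// ltW.
have Kr : K * Num.sqrt (t n) <= e / 4.
  apply: le_trans (_ : (`|K| + 1) * (e / (4 * (`|K| + 1))) <= _).
    apply: le_trans (ler_wpM2r r0 _) (ler_wpM2l _ rk).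
      by rewrite (le_trans (ler_norm K))// lerDl.
    by rewrite addr_ge0.
  have K10 : 0 < `|K| + 1 by rewrite ltr_wpDl.
  by have -> : (`|K| + 1) * (e / (4 * (`|K| + 1))) = e / 4 by field; rewrite gt_eqF.
have := bound p' n bp' (ltW n1); have := bound p n bp (ltW n1); move: Kr.
move: (curv rho p) (curv rho p') (c0 / _) (K * _) (b n) => k1 k2 c r y.
rewrite !ler_norml => h1 /andP[a1 a2] /andP[a3 a4].
by apply/andP; split; move: a1 a2 a3 a4 h1; lra.
Qed.

End ConstantCurvature.

Theorem mainTheorem2 (R : realType) (N : nat) (O : set 'rV[R]_N)
  (rho : 'rV[R]_N -> R) (u : 'rV[R]_N -> R -> R)
  (t : nat -> R) (b : nat -> R) :
  (2 <= N)%N ->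
  smooth_bounded_domain O ->
  smooth rho -> O = [set x | rho x < 0] ->
  (forall p, bdry O p -> grad rho p != 0) ->
  heat_solution_one O u ->
  (forall n, 0 < t n) ->
  (forall n, normal_deriv_const O rho u (t n) (b n)) ->
  (forall eps : R, 0 < eps -> exists n, t n < eps) ->
  is_euclidean_ball O.
Proof.
move=> N2 [oO [connO [neO [[M OM] _]]]] Crho rhoO G0 Hu t0 Hb Ht.
have H : regular_domain O rho (M : R).
  split=> //.
  - by move=> x Ox; apply: le_trans (norm_le_eucl x) (OM x Ox).
  - by move=> n; exact: smooth_Ck.
  - by move=> x; rewrite rhoO.
have curvc := overdetermined_curv_const H Hu t0 Hb Ht.
(* The constant is read off at a boundary point; 0 is the default value if there were none. *)
have [k curvk] : exists k, forall p, bdry O p -> curv rho p = k.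
  have [[p bp]|nb] := pselect (exists p, bdry O p).
    by exists (curv rho p) => q bq; exact: curvc.
  by exists 0 => q bq; exfalso; apply: nb; exists q.
exact: (constant_curvature_ball H curvk connO neO (Ordinal (ltnW N2))).
Qed.
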